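(* Let $\Gamma$ be a countable discrete group. Assume that there exists a non-singular $\Gamma$-space $(B,\nu)$ which has the SH-property (singular hereditary property) and is Zimmer amenable. Then: (1) every non-trivial $\Gamma$-$C^*$-subalgebra (i.e. $\Gamma$-invariant $C^*$-subalgebra) $\mathcal{A}\subset C^*_r(\Gamma)$ is co-amenable; and (2) every non-trivial $\Gamma$-invariant von Neumann subalgebra $\mathcal{M}\subset L(\Gamma)$ is co-amenable.
   Context: Conventions. $\lambda$ is the left regular representation of $\Gamma$ on $\ell^2(\Gamma)$, $C^*_r(\Gamma)$ and $L(\Gamma)$ are the reduced group $C^*$-algebra and the group von Neumann algebra. $\Gamma$ acts on $\mathbb{B}(\ell^2(\Gamma))$, and on $C^*_r(\Gamma)$ and $L(\Gamma)$, by conjugation by the unitaries $\lambda(g)$; ''$\Gamma$-invariant'' refers to this action. Subalgebras are unital, and a subalgebra is non-trivial if it is not equal to $\mathbb{C}1$. Co-amenability. A $\Gamma$-invariant $C^*$-subalgebra $\mathcal{A}\subset C^*_r(\Gamma)$ (resp. von Neumann subalgebra $\mathcal{M}\subset L(\Gamma)$) is co-amenable if its commutant $\mathcal{A}'$ (resp. $\mathcal{M}'$) in $\mathbb{B}(\ell^2(\Gamma))$ admits a $\Gamma$-invariant state. Non-singular spaces. A non-singular $\Gamma$-space $(B,\nu)$ is a standard probability space with a measurable $\Gamma$-action preserving the class of $\nu$. It is Zimmer amenable if there is a $\Gamma$-equivariant conditional expectation $L^\infty(\Gamma\times B)\to L^\infty(B,\nu)$ (for the diagonal action on $\Gamma\times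 B$). Crossed product. $L^\infty(B,\nu)\rtimes\Gamma$ is the von Neumann crossed product, generated by $L^\infty(B,\nu)$ and unitaries $\lambda(g)$, $g\in\Gamma$, implementing the action; $\Gamma$ acts on it by conjugation by the $\lambda(g)$. $\mathbb{E}:L^\infty(B,\nu)\rtimes\Gamma\to L^\infty(B,\nu)$ is the canonical faithful normal conditional expectation, with $\mathbb{E}(f\lambda(g))=0$ for $g\neq e$ and $\mathbb{E}(f)=f$ for $f\in L^\infty(B,\nu)$. Singularity. For a unital $C^*$-algebra $\mathcal{C}$, states $\tau,\tilde\tau$ on $\mathcal{C}$ are singular, $\tau\perp\tilde\tau$, if there is a net $a_i\in\mathcal{C}$, $0\le a_i\le 1$, with $\lim_i\tau(a_i)=1$ and $\lim_i\tilde\tau(a_i)=0$. If $\mathcal{N}$ is a $\Gamma$-von Neumann algebra (with separable predual) and $\Phi:\mathcal{N}\to L^\infty(B,\nu)$ is a $\Gamma$-equivariant ucp map, choose an ultraweakly dense $\Gamma$-invariant norm-separable $C^*$-subalgebra $\mathcal{C}\subset\mathcal{N}$; then there is a $\Gamma$-equivariant measurable map $\theta:B\to\mathcal{S}(\mathcal{C})$ into the state space of $\mathcal{C}$ with $\Phi(a)(b)=\theta(b)(a)$ for $a\in\mathcal{C}$ and a.e. $b$. $\Phi$ is called $\Gamma$-singular if $s.\theta(b)\perp\theta(b)$ for almost every $b\in B$ and every $s\in\Gamma\setminus\{e\}$, where $(s.\tau)(a)=\tau(s^{-1}.a)$. (This does not depend on the choice of $\mathcal{C}$.) SH-property. An ergodic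 non-singular $\Gamma$-space $(B,\nu)$ has the singular hereditary (SH) property if for every $\Gamma$-invariant von Neumann subalgebra $\mathcal{N}\subset L^\infty(B,\nu)\rtimes\Gamma$, either $\mathbb{E}|_{\mathcal{N}}$ is $\Gamma$-singular or $\mathbb{E}(\mathcal{N})=\mathbb{C}$. *)

(* Defs.v *)
From HB Require Import structures.
From mathcomp Require Import all_boot all_order all_algebra.
From mathcomp Require Import generic_quotient ring_quotient complex sesquilinear.
From mathcomp Require Import lra.
From mathcomp Require Import all_classical all_reals all_analysis.
Set Implicit Arguments. Unset Strict Implicit. Unset Printing Implicit Defensive.
Import Order.TTheory GRing.Theory Num.Theory.
Local Open Scope classical_set_scope.
Local Open Scope ring_scope.

(* The form is linear in its first argument. Completeness is not recorded: the
   spaces used below (the scalars, l2 I H over these, L2 mu) are complete. *)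
Record innerProductSpace (R : realType) := InnerProductSpace {
  ips_sort :> lmodType R[i];
  ips_dot : {dot ips_sort for Num.conj} }.

Notation "''[' x , y ]" := (ips_dot _ x%R y%R)
  (format "''[' x ,  y ]") : ring_scope.

Local Notation Re := complex.Re.
Local Notation Im := complex.Im.

Section complex_facts.
Variable R : realType.
Implicit Types x y : R[i].

Lemma ReM x y : Re (x * y) = Re x * Re y - Im x * Im y.
Proof. by case: x y => [a b] [c d]. Qed.

Lemma ImM x y : Im (x * y) = Re x * Im y + Im x * Re y.
Proof. by case: x y => [a b] [c d]. Qed.

Lemma ReD x y : Re (x + y) = Re x + Re y.
Proof. by case: x y => [a b] [c d]. Qed.

Lemma ImD x y : Im (x + y) = Im x + Im y.
Proof. by case: x y => [a b] [c d]. Qed.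

Lemma ReN x : Re (- x) = - Re x. Proof. by case: x. Qed.
Lemma ReJ x : Re (Num.conj x) = Re x. Proof. by case: x. Qed.
Lemma ImJ x : Im (Num.conj x) = - Im x. Proof. by case: x. Qed.

Lemma complex_ext x y : Re x = Re y -> Im x = Im y -> x = y.
Proof. by case: x y => [a b] [c d] /= -> ->. Qed.

End complex_facts.

Section csum.
Variables (R : realType) (I : choiceType).
Implicit Types (a b : I -> R) (f g : I -> R[i]).

Definition rsummable a := summable [set: I] (EFin \o a).

(* Unordered sum of an absolutely summable family. *)
Definition rsum a : R :=
  fine (\esum_(i in [set: I]) ((EFin \o a)^\+ i)
        - \esum_(i in [set: I]) ((EFin \o a)^\- i))%E.

Definition csum f : R[i] := (rsum (@Re R \o f) +i* rsum (@Im R \o f))%C.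

Definition csummable f := rsummable (@Re R \o f) /\ rsummable (@Im R \o f).

Lemma rsummable_le a b : (forall i, `|a i| <= `|b i|) ->
  rsummable b -> rsummable a.
Proof. by move=> ab; apply: le_lt_trans; apply: le_esum => i _; rewrite lee_fin. Qed.

Lemma rsummableD a b : rsummable a -> rsummable b ->
  rsummable (fun i => a i + b i).
Proof. by move=> /summableD h /h. Qed.

Lemma esumZ (r : R) a : 0 <= r -> (forall i, 0 <= a i) ->
  (\esum_(i in [set: I]) (r * a i)%:E = r%:E * \esum_(i in [set: I]) (a i)%:E)%E.
Proof.
move=> r0 a0; rewrite /esum -ereal_supZl//; last first.
  by apply/set0P; exists 0%E, set0; [exact: fsets_set0|rewrite fsbig_set0].
congr ereal_sup; rewrite image_comp; apply: eq_imagel => A _ /=.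
by rewrite ge0_mule_fsumr// => i; rewrite lee_fin.
Qed.

Lemma rsummableZ (r : R) a : rsummable a -> rsummable (fun i => r * a i).
Proof.
move=> sa; rewrite /rsummable /summable.
under eq_esum do rewrite /= normrM.
rewrite esumZ//; move: sa; rewrite /rsummable summableE => sa.
by rewrite ltey_eq fin_numM.
Qed.

Let S a : R := fine (\esum_(i in [set: I]) (a i)%:E).

Let esum_fin a : (forall i, 0 <= a i) -> rsummable a ->
  (\esum_(i in [set: I]) (a i)%:E)%E \is a fin_num.
Proof.
move=> a0; rewrite /rsummable summableE; congr (_ \is a fin_num).
by apply: eq_esum => i _ /=; rewrite ger0_norm.
Qed.

Let rsumE a b c : (forall i, a i = b i - c i) ->
  (forall i, 0 <= b i) -> (forall i, 0 <= c i) ->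
  rsummable b -> rsummable c -> rsum a = S b - S c.
Proof.
move=> abc b0 c0 sb sc; rewrite /rsum.
have -> : EFin \o a = ((EFin \o b) \- (EFin \o c))%E.
  by apply/funext => i /=; rewrite abc.
rewrite esumB//; last 2 first.
- by move=> i _; rewrite lee_fin.
- by move=> i _; rewrite lee_fin.
by rewrite fineB// esum_fin.
Qed.

Let SD a b : (forall i, 0 <= a i) -> (forall i, 0 <= b i) ->
  rsummable a -> rsummable b -> S (fun i => a i + b i) = S a + S b.
Proof.
move=> a0 b0 sa sb; rewrite /S -fineD ?esum_fin// -esumD//.
- by move=> i _; rewrite lee_fin.
- by move=> i _; rewrite lee_fin.
Qed.

Let SZ (r : R) a : 0 <= r -> (forall i, 0 <= a i) ->
  rsummable a -> S (fun i => r * a i) = r * S a.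
Proof. by move=> r0 a0 sa; rewrite /S esumZ// fineM// esum_fin. Qed.

Let pos a i := Num.max (a i) 0.
Let neg a i := Num.max (- a i) 0.

Let pos_ge0 a i : 0 <= pos a i. Proof. by rewrite /pos le_max lexx orbT. Qed.
Let neg_ge0 a i : 0 <= neg a i. Proof. by rewrite /neg le_max lexx orbT. Qed.
Let posneg a i : a i = pos a i - neg a i.
Proof.
rewrite /pos /neg; case: (leP 0 (a i)) => ai.
  by rewrite (max_idPr _) ?oppr_le0// subr0.
by rewrite (max_idPl _) ?oppr_ge0 ?ltW// sub0r opprK.
Qed.
Let pos_s a : rsummable a -> rsummable (pos a).
Proof.
apply: rsummable_le => i; rewrite ger0_norm ?pos_ge0//.
by rewrite ge_max normr_ge0 ler_norm.
Qed.
Let neg_s a : rsummable a -> rsummable (neg a).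
Proof.
apply: rsummable_le => i; rewrite ger0_norm ?neg_ge0//.
by rewrite ge_max normr_ge0 -normrN ler_norm.
Qed.

Let rsumE0 a : rsummable a -> rsum a = S (pos a) - S (neg a).
Proof.
move=> sa; apply: rsumE; [exact: posneg|exact: pos_ge0|exact: neg_ge0
  |exact: pos_s|exact: neg_s].
Qed.

Lemma rsumD a b : rsummable a -> rsummable b ->
  rsum (fun i => a i + b i) = rsum a + rsum b.
Proof.
move=> sa sb; have [pa na] := (pos_s sa, neg_s sa).
have [pb nb] := (pos_s sb, neg_s sb).
rewrite (@rsumE _ (fun i => pos a i + pos b i) (fun i => neg a i + neg b i)).
- by rewrite !SD// rsumE0// rsumE0// opprD addrACA.
- by move=> i; rewrite {1}(posneg a) {1}(posneg b) opprD addrACA.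
- by move=> i; rewrite addr_ge0.
- by move=> i; rewrite addr_ge0.
- exact: rsummableD.
- exact: rsummableD.
Qed.

Lemma rsumZ (r : R) a : rsummable a -> rsum (fun i => r * a i) = r * rsum a.
Proof.
move=> sa; have [pa na] := (pos_s sa, neg_s sa).
have [r0|r0] := leP 0 r.
  rewrite (@rsumE _ (fun i => r * pos a i) (fun i => r * neg a i)).
  - by rewrite !SZ// rsumE0// mulrBr.
  - by move=> i; rewrite -mulrBr -posneg.
  - by move=> i; rewrite mulr_ge0.
  - by move=> i; rewrite mulr_ge0.
  - exact: rsummableZ.
  - exact: rsummableZ.
have r0' : 0 <= - r by rewrite oppr_ge0 ltW.
rewrite (@rsumE _ (fun i => - r * neg a i) (fun i => - r * pos a i)).
- by rewrite !SZ// rsumE0// !mulNr opprK mulrBr addrC.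
- by move=> i; rewrite -mulrBr mulNr -mulrN opprB -posneg.
- by move=> i; rewrite mulr_ge0.
- by move=> i; rewrite mulr_ge0.
- exact: rsummableZ.
- exact: rsummableZ.
Qed.

Lemma rsum_ge0 a : (forall i, 0 <= a i) -> 0 <= rsum a.
Proof.
move=> a0; rewrite /rsum [X in (_ - X)%E]esum1 ?sube0; last first.
  by move=> i _; rewrite funenegE /= max_r// lee_fin oppr_le0 a0.
by apply: fine_ge0; apply: esum_ge0.
Qed.

Lemma rsum_eq0 a : (forall i, 0 <= a i) -> rsummable a -> rsum a = 0 ->
  forall i, a i = 0.
Proof.
move=> a0 sa; rewrite (@rsumE a a (fun=> 0))//; last 2 first.
- by move=> i; rewrite subr0.
- by rewrite /rsummable /summable esum1// => i _ /=; rewrite normr0.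
rewrite /S [X in _ - fine X]esum1// subr0 => h i.
have: ((a i)%:E <= \esum_(i in [set: I]) (a i)%:E)%E.
  apply: esum_ge; exists [set i]; first by split=> //; exact: finite_set1.
  by rewrite fsbig_set1.
rewrite -[X in (_ <= X)%E]fineK ?esum_fin// h lee_fin => ai0.
by apply/le_anti; rewrite ai0 a0.
Qed.

Let ReS f : Re (csum f) = rsum (fun i => Re (f i)). Proof. by []. Qed.
Let ImS f : Im (csum f) = rsum (fun i => Im (f i)). Proof. by []. Qed.
Let eq_rsum a b : a =1 b -> rsum a = rsum b. Proof. by move=> /funext ->. Qed.

Lemma csumD f g : csummable f -> csummable g ->
  csum (fun i => f i + g i) = csum f + csum g.
Proof.
move=> [f1 f2] [g1 g2]; apply: complex_ext; rewrite ?ReD ?ImD ?ReS ?ImS -rsumD//.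
  by apply: eq_rsum => i; rewrite ReD.
by apply: eq_rsum => i; rewrite ImD.
Qed.

Lemma csumZ z f : csummable f -> csum (fun i => z * f i) = z * csum f.
Proof.
move=> [f1 f2]; apply: complex_ext.
  rewrite ReM !ReS ImS -mulNr -!rsumZ// -rsumD; try exact: rsummableZ.
  by apply: eq_rsum => i; rewrite ReM mulNr.
rewrite ImM !ImS ReS -!rsumZ// -rsumD; try exact: rsummableZ.
by apply: eq_rsum => i; rewrite ImM.
Qed.

Lemma csummableZ z f : csummable f -> csummable (fun i => z * f i).
Proof.
move=> [f1 f2]; split; rewrite /rsummable.
  rewrite [X in summable _ (EFin \o X)](_ : _ =
    (fun i => Re z * Re (f i) + (- Im z) * Im (f i))).
    by apply: rsummableD; apply: rsummableZ.
  by apply/funext => i /=; rewrite ReM mulNr.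
rewrite [X in summable _ (EFin \o X)](_ : _ =
  (fun i => Re z * Im (f i) + Im z * Re (f i))).
  by apply: rsummableD; apply: rsummableZ.
by apply/funext => i /=; rewrite ImM.
Qed.

Lemma csumJ f : csummable f ->
  csum (fun i => Num.conj (f i)) = Num.conj (csum f).
Proof.
move=> [f1 f2]; apply: complex_ext; rewrite ?ReJ ?ImJ ?ReS ?ImS.
  by apply: eq_rsum => i; rewrite ReJ.
by rewrite -mulN1r -rsumZ//; apply: eq_rsum => i; rewrite ImJ mulN1r.
Qed.

End csum.

Section ips_facts.
Variables (R : realType) (H : innerProductSpace R).
Implicit Types x y : H.

(* Squared norm. *)
Definition sqn x : R := Re '[x, x].

Lemma dot_sqn x : '[x, x] = (sqn x)%:C%C.
Proof.
apply: complex_ext => //=.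
by have := dnorm_ge0 (ips_dot H) x; rewrite lecE => /andP[/eqP ->].
Qed.

Lemma sqn_ge0 x : 0 <= sqn x.
Proof. by have := dnorm_ge0 (ips_dot H) x; rewrite lecE => /andP[]. Qed.

Lemma sqn0 : sqn 0 = 0.
Proof. by rewrite /sqn linear0r. Qed.

Lemma sqnZ a x : sqn (a *: x) = (Re a ^+ 2 + Im a ^+ 2) * sqn x.
Proof.
rewrite /sqn dnormZ normCK dot_sqn ReM /= mulr0 subr0; congr (_ * _).
by rewrite ReM ReJ ImJ mulrN opprK -!expr2.
Qed.

Lemma sqnD x y : sqn (x + y) = sqn x + sqn y + Re '[x, y] *+ 2.
Proof. by rewrite /sqn dnormD !ReD ReJ mulr2n. Qed.

Lemma sqnN x : sqn (- x) = sqn x.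
Proof. by rewrite -scaleN1r sqnZ ReN /= oppr0 expr0n addr0 sqrrN expr1n mul1r. Qed.

Lemma sqn_addle x y : sqn (x + y) <= (sqn x + sqn y) *+ 2.
Proof.
have := sqn_ge0 (x - y); rewrite !sqnD sqnN linearNr ReN mulNrn => h.
by rewrite mulr2n lerD2l -subr_ge0.
Qed.

Lemma Re_dot_le x y : `|Re '[x, y]| <= sqn x + sqn y.
Proof.
have := sqn_ge0 (x - y); have := sqn_ge0 (x + y).
rewrite !sqnD sqnN linearNr ReN.
have := sqn_ge0 x; have := sqn_ge0 y.
rewrite ler_norml => *; apply/andP; split; lra.
Qed.

Lemma Im_dot_le x y : `|Im '[x, y]| <= sqn x + sqn y.
Proof.
have := Re_dot_le ('i%C *: x) y.
rewrite sqnZ /= expr0n expr1n add0r mul1r linearZl_LR /= ReM /=.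
by rewrite mul0r sub0r mul1r normrN.
Qed.

End ips_facts.

Section l2_space.
Variables (R : realType) (I : choiceType) (H : innerProductSpace R).

Definition square_summable : {pred I -> H} :=
  [pred xi | `[< rsummable (fun i => sqn (xi i)) >]].

Lemma square_summableP (xi : I -> H) :
  xi \in square_summable <-> rsummable (fun i => sqn (xi i)).
Proof. by split => [/asboolP|h]; last exact/asboolP. Qed.

Lemma square_summable_submod : submod_closed square_summable.
Proof.
split.
  apply/square_summableP; rewrite /rsummable /summable esum1// => i _ /=.
  by rewrite [X in `|X|](sqn0 H) normr0.
move=> a xi eta /square_summableP sx /square_summableP se.
apply/square_summableP.
apply: (@rsummable_le _ _ _ (fun i => 2 * ((Re a ^+ 2 + Im a ^+ 2) * sqn (xi i) + sqn (eta i)))).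
  move=> i; rewrite !ger0_norm ?sqn_ge0//.
    by apply: (le_trans (sqn_addle _ _)); rewrite sqnZ mulr_natl.
  by rewrite mulr_ge0// addr_ge0 ?mulr_ge0 ?sqn_ge0// addr_ge0 ?sqr_ge0.
by apply: rsummableZ; apply: rsummableD => //; apply: rsummableZ.
Qed.

HB.instance Definition _ := GRing.isSubmodClosed.Build _ _ square_summable
  square_summable_submod.

(* Carrier of the Hilbert direct sum of copies of H indexed by I. *)
Record l2seq := L2Seq {
  l2val :> I -> H;
  _ : l2val \in square_summable }.

HB.instance Definition _ := [isSub for l2val].
HB.instance Definition _ := [Choice of l2seq by <:].
HB.instance Definition _ := [SubChoice_isSubLmodule of l2seq by <:].

Lemma l2seqP (xi : l2seq) : rsummable (fun i => sqn (xi i)).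
Proof. by apply/square_summableP; exact: (valP xi). Qed.

Definition l2dot (xi eta : l2seq) : R[i] := csum (fun i => '[xi i, eta i]).

Lemma l2_csummable (xi eta : l2seq) : csummable (fun i => '[xi i, eta i]).
Proof.
have h : rsummable (fun i => sqn (xi i) + sqn (eta i)).
  by apply: rsummableD; exact: l2seqP.
by split; apply: rsummable_le h => i;
  rewrite [leRHS]ger0_norm ?addr_ge0 ?sqn_ge0//=; [exact: Re_dot_le|exact: Im_dot_le].
Qed.

Lemma l2dot_hermitian (xi eta : l2seq) :
  l2dot xi eta = (-1) ^+ false * Num.conj (l2dot eta xi).
Proof.
rewrite expr0 mul1r /l2dot -csumJ; last exact: l2_csummable.
by congr csum; apply/funext => i; rewrite hermC /= expr0 mul1r.
Qed.

Lemma l2dot_bilinear : bilinear_for *%R (Num.conj \; *%R) l2dot.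
Proof.
have lin xi : GRing.linear_for *%R (l2dot ^~ xi).
  move=> a u v; rewrite /l2dot -csumZ; last exact: l2_csummable.
  rewrite -csumD; [|exact/csummableZ/l2_csummable|exact: l2_csummable].
  by congr csum; apply/funext => i; rewrite -linearPl.
split => [//|xi a u v].
by rewrite l2dot_hermitian lin expr0 mul1r rmorphD rmorphM /=
  (l2dot_hermitian xi u) (l2dot_hermitian xi v) expr0 !mul1r.
Qed.

Lemma l2dot_gt0 (xi : l2seq) : xi != 0 -> 0 < l2dot xi xi.
Proof.
move=> xi0; have -> : l2dot xi xi = (rsum (fun i => sqn (xi i)))%:C%C.
  apply: complex_ext => //=.
  transitivity (rsum (fun i : I => 0 * (fun=> 0 : R) i)).
    by congr rsum; apply/funext => i; rewrite /= dot_sqn mul0r.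
  rewrite rsumZ ?mul0r// /rsummable /summable esum1// => i _ /=.
  by rewrite normr0.
rewrite ltcR lt0r rsum_ge0 ?andbT => [|i]; last exact: sqn_ge0.
apply: contra xi0 => /eqP r0; apply/eqP/val_inj/funext => i.
have /(_ i) := rsum_eq0 (fun i => sqn_ge0 (xi i)) (l2seqP xi) r0.
move=> h; apply/eqP; rewrite -(dnorm_eq0 (ips_dot H)).
by rewrite dot_sqn [sqn _]h.
Qed.

HB.instance Definition _ := @bilinear_isBilinear.Build _ _ _ _ _ _ l2dot l2dot_bilinear.
HB.instance Definition _ := @isHermitianSesquilinear.Build _ _ _ _ l2dot l2dot_hermitian.
HB.instance Definition _ := @isDotProduct.Build _ _ l2dot l2dot_gt0.

Definition l2 : innerProductSpace R := InnerProductSpace [the {dot l2seq for Num.conj} of l2dot].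

End l2_space.

Section L2_space.
Context d (T : measurableType d) (R : realType).
Variable mu : {measure set T -> \bar R}.

Definition square_integrable : {pred T -> R[i]} :=
  [pred f | (@Re R \o f \in Lfun mu 2%:E) && (@Im R \o f \in Lfun mu 2%:E)].

Lemma square_integrable_submod : submod_closed square_integrable.
Proof.
have [L0 LD] := @Lfun_submod_closed _ _ _ mu _ (lee1n 2).
split; first by apply/andP; split; exact: L0.
move=> a f g /andP[f1 f2] /andP[g1 g2]; apply/andP; split.
  rewrite (_ : _ \o _ = Re a *: (@Re R \o f) + ((- Im a) *: (@Im R \o f) + (@Re R \o g))).
    by apply: (LD) => //; apply: LD.
  apply/funext => x.
  transitivity (Re (a * f x + g x)); first by [].
  by rewrite ReD ReM -mulNr -addrA.
rewrite (_ : _ \o _ = Re a *: (@Im R \o f) + (Im a *: (@Re R \o f) + (@Im R \o g))).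
  by apply: (LD) => //; apply: LD.
apply/funext => x.
transitivity (Im (a * f x + g x)); first by [].
by rewrite ImD ImM -addrA.
Qed.

HB.instance Definition _ := GRing.isSubmodClosed.Build _ _ square_integrable
  square_integrable_submod.

Record L2fun := L2Fun {
  L2val :> T -> R[i];
  _ : L2val \in square_integrable }.

HB.instance Definition _ := [isSub for L2val].
HB.instance Definition _ := [Choice of L2fun by <:].
HB.instance Definition _ := [SubChoice_isSubLmodule of L2fun by <:].

Definition L2null : {pred L2fun} :=
  [pred f : L2fun | `[< (f : T -> R[i]) = cst 0 %[ae mu] >]].

Lemma L2nullP (f : L2fun) :
  f \in L2null <-> {ae mu, forall x, f x = 0}.
Proof.
split=> [/asboolP|h]; first by apply: filterS => x /(_ I).
by apply/asboolP; apply: filterS h.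
Qed.

Lemma L2null_submod : submod_closed L2null.
Proof.
split; first by apply/L2nullP; apply/nearW.
move=> a f g /L2nullP f0 /L2nullP g0; apply/L2nullP.
apply: filterS2 f0 g0 => x fx gx.
transitivity (a * f x + g x); first by [].
by rewrite fx gx mulr0 addr0.
Qed.

HB.instance Definition _ := GRing.isSubmodClosed.Build _ _ L2null L2null_submod.

Definition L2class := Quotient.quot (L2null : zmodClosed L2fun).
HB.instance Definition _ := GRing.Zmodule.on L2class.
HB.instance Definition _ := EqQuotient.on L2class.

Local Open Scope quotient_scope.

Lemma L2pi_eq (f g : L2fun) :
  \pi_L2class f = \pi_L2class g <-> {ae mu, forall x, f x = g x}.
Proof.
have e : \pi_L2class f = \pi_L2class g <-> f - g \in L2null.
  by rewrite Quotient.idealrBE; split => /eqP.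
rewrite e L2nullP; split; apply: filterS => x h.
  by apply/eqP; rewrite -subr_eq0; apply/eqP; exact: h.
by transitivity (f x - g x); [|rewrite h subrr].
Qed.

Lemma L2reprK (f : L2fun) : {ae mu, forall x, repr (\pi_L2class f) x = f x}.
Proof. by apply/L2pi_eq; rewrite reprK. Qed.

Definition L2scale (a : R[i]) (u : L2class) : L2class :=
  \pi_L2class (a *: repr u).

Let piD (f g : L2fun) : \pi_L2class (f + g) = \pi_L2class f + \pi_L2class g.
Proof. by rewrite !piE. Qed.

Let piZ a (f : L2fun) : L2scale a (\pi_L2class f) = \pi_L2class (a *: f).
Proof.
apply/L2pi_eq; apply: filterS (L2reprK f) => x h.
transitivity (a * repr (\pi_L2class f) x); first by [].
by rewrite h.
Qed.

Let L2scaleA a b u : L2scale a (L2scale b u) = L2scale (a * b) u.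
Proof. by rewrite piZ scalerA. Qed.

Let L2scale1 : left_id 1 L2scale.
Proof. by move=> u; rewrite /L2scale scale1r reprK. Qed.

Let L2scaleDr : right_distributive L2scale +%R.
Proof.
by move=> a u v; rewrite -[u]reprK -[v]reprK -piD !piZ scalerDr piD.
Qed.

Let L2scaleDl u : {morph L2scale^~ u : a b / a + b}.
Proof. by move=> a b; rewrite -[u]reprK !piZ scalerDl piD. Qed.

HB.instance Definition _ := GRing.Zmodule_isLmodule.Build R[i] L2class
  L2scaleA L2scale1 L2scaleDr L2scaleDl.

Definition cRintegral (f : T -> R[i]) : R[i] :=
  ((\int[mu]_x Re (f x)) +i* (\int[mu]_x Im (f x)))%C.

Definition L2dot (u v : L2class) : R[i] :=
  cRintegral (fun x => repr u x * Num.conj (repr v x)).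

Definition cintegrable (f : T -> R[i]) :=
  mu.-integrable setT (EFin \o (@Re R \o f)) /\
  mu.-integrable setT (EFin \o (@Im R \o f)).

Let L2_cintegrable (f g : L2fun) :
  cintegrable (fun x => f x * Num.conj (g x)).
Proof.
have /andP[f1 f2] := valP f; have /andP[g1 g2] := valP g.
have LM a b : a \in Lfun mu 2%:E -> b \in Lfun mu 2%:E ->
    mu.-integrable setT (EFin \o (a \* b)).
  by move=> la lb; apply/Lfun1_integrable; exact: Lfun2_mul_Lfun1.
split.
  have := integrableD measurableT (LM _ _ f1 g1) (LM _ _ f2 g2).
  by apply: eq_integrable => // x _; rewrite /= ReM ReJ ImJ mulrN opprK.
have := integrableB measurableT (LM _ _ f2 g1) (LM _ _ f1 g2).
by apply: eq_integrable => // x _; rewrite /= ImM ReJ ImJ mulrN addrC.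
Qed.

Let ReI f : Re (cRintegral f) = \int[mu]_x Re (f x). Proof. by []. Qed.
Let ImI f : Im (cRintegral f) = \int[mu]_x Im (f x). Proof. by []. Qed.

Let cRintegralD f g : cintegrable f -> cintegrable g ->
  cRintegral (fun x => f x + g x) = cRintegral f + cRintegral g.
Proof.
move=> [f1 f2] [g1 g2]; apply: complex_ext.
  rewrite ReD !ReI.
  by rewrite -RintegralD//; apply: eq_Rintegral => x _; rewrite ReD.
rewrite ImD !ImI.
by rewrite -RintegralD//; apply: eq_Rintegral => x _; rewrite ImD.
Qed.

Let integrable_Zl (r : R) (g : T -> R) : mu.-integrable setT (EFin \o g) ->
  mu.-integrable setT (EFin \o (fun x => r * g x)).
Proof.
move=> /(integrableZl measurableT r).
by apply: eq_integrable => // x _ /=; rewrite EFinM.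
Qed.

Let cRintegralZ a f : cintegrable f ->
  cRintegral (fun x => a * f x) = a * cRintegral f.
Proof.
move=> [f1 f2]; apply: complex_ext.
  rewrite ReM !ReI ImI.
  rewrite -!RintegralZl// -RintegralB//; try exact: integrable_Zl.
  by apply: eq_Rintegral => x _; rewrite ReM.
rewrite ImM !ImI ReI.
rewrite -!RintegralZl// -RintegralD//; try exact: integrable_Zl.
by apply: eq_Rintegral => x _; rewrite ImM.
Qed.

Let cRintegralJ f : cintegrable f ->
  cRintegral (fun x => Num.conj (f x)) = Num.conj (cRintegral f).
Proof.
move=> [f1 f2]; apply: complex_ext.
  by rewrite ReJ !ReI; apply: eq_Rintegral => x _; rewrite ReJ.
rewrite ImJ !ImI -mulN1r -RintegralZl//.
by apply: eq_Rintegral => x _; rewrite ImJ mulN1r.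
Qed.

Let ae_cRintegral f g : {ae mu, forall x, f x = g x} ->
  cintegrable f -> cintegrable g -> cRintegral f = cRintegral g.
Proof.
move=> fg [f1 f2] [g1 g2]; rewrite /cRintegral /Rintegral.
by congr (fine _ +i* fine _)%C; apply: ae_eq_integral => //;
  [exact: measurable_int f1|exact: measurable_int g1|
   |exact: measurable_int f2|exact: measurable_int g2|];
  apply: filterS fg => x /= -> _.
Qed.

Let L2dotE (f g : L2fun) : L2dot (\pi_L2class f) (\pi_L2class g) =
  cRintegral (fun x => f x * Num.conj (g x)).
Proof.
apply: ae_cRintegral; [|exact: L2_cintegrable|exact: L2_cintegrable].
by apply: filterS2 (L2reprK f) (L2reprK g) => x -> ->.
Qed.

Lemma L2dot_hermitian u v : L2dot u v = (-1) ^+ false * Num.conj (L2dot v u).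
Proof.
rewrite expr0 mul1r /L2dot -cRintegralJ; last exact: L2_cintegrable.
by congr cRintegral; apply/funext => x; rewrite rmorphM /= conjCK mulrC.
Qed.

Lemma L2dot_bilinear : bilinear_for *%R (Num.conj \; *%R) L2dot.
Proof.
have lin w : GRing.linear_for *%R (L2dot ^~ w).
  move=> a u v; rewrite -[u]reprK -[v]reprK -[w]reprK.
  rewrite [a *: _]piZ -piD !L2dotE -cRintegralZ; last exact: L2_cintegrable.
  rewrite -cRintegralD; last exact: L2_cintegrable.
    congr cRintegral; apply/funext => x.
    by rewrite mulrA -mulrDl.
  have := L2_cintegrable (a *: repr u) (repr w).
  by congr cintegrable; apply/funext => x; rewrite mulrA.
split => [//|w a u v].
by rewrite L2dot_hermitian lin expr0 mul1r rmorphD rmorphM /=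
  (L2dot_hermitian w u) (L2dot_hermitian w v) expr0 !mul1r.
Qed.

Lemma L2dot_gt0 u : u != 0 -> 0 < L2dot u u.
Proof.
move=> u0; have := L2_cintegrable (repr u) (repr u).
set h := fun x => _; move=> [h1 h2].
have Reh x : Re (h x) = Re (repr u x) ^+ 2 + Im (repr u x) ^+ 2.
  by rewrite /h ReM ReJ ImJ mulrN opprK -!expr2.
have Reh_ge0 x : 0 <= Re (h x) by rewrite Reh addr_ge0 ?sqr_ge0.
have -> : L2dot u u = (\int[mu]_x Re (h x))%:C%C.
  apply: complex_ext => //=.
  rewrite (_ : (fun x => _) = cst 0) ?Rintegral_cst ?mul0r//.
  by apply/funext => x; rewrite ImM ImJ ReJ mulrN mulrC addNr.
rewrite ltcR lt0r Rintegral_ge0 ?andbT//.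
apply: contra u0 => /eqP; rewrite /Rintegral => h0.
have {}h0 : (\int[mu]_x (Re (h x))%:E = 0)%E.
  rewrite -[LHS]fineK ?h0//; exact: integrable_fin_num h1.
have [+ _] := ae_eq_integral_abs mu measurableT (measurable_int mu h1).
have -> : (\int[mu]_x `|(EFin \o (@Re R \o h)) x| = 0)%E.
  by rewrite -h0; apply: eq_integral => x _ /=; rewrite ger0_norm.
move=> /(_ erefl) ae0; apply/eqP; rewrite -[u]reprK.
rewrite -[RHS](reprK 0); apply/L2pi_eq.
have r0 : {ae mu, forall x, repr (0 : L2class) x = 0}.
  have -> : (0 : L2class) = \pi_L2class 0 by rewrite !piE.
  exact: L2reprK.
apply: filterS2 ae0 r0 => x /(_ I)/= [+ ->].
rewrite Reh => /eqP; rewrite paddr_eq0 ?sqr_ge0// !sqrf_eq0.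
by move=> /andP[/eqP h3 /eqP h4]; exact: complex_ext.
Qed.

HB.instance Definition _ := @bilinear_isBilinear.Build _ _ _ _ _ _ L2dot L2dot_bilinear.
HB.instance Definition _ := @isHermitianSesquilinear.Build _ _ _ _ L2dot L2dot_hermitian.
HB.instance Definition _ := @isDotProduct.Build _ _ L2dot L2dot_gt0.

Definition L2 : innerProductSpace R :=
  InnerProductSpace [the {dot L2class for Num.conj} of L2dot].

End L2_space.

Section scalar_space.
Variable R : realType.

Definition scalar_dot (x y : R[i]^o) : R[i] := x * Num.conj y.

Lemma scalar_dot_bilinear : bilinear_for *%R (Num.conj \; *%R) scalar_dot.
Proof.
split=> [y a u v|y a u v]; rewrite /scalar_dot.
  by rewrite mulrDl -mulrA.
by rewrite rmorphD rmorphM /= mulrDr mulrCA.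
Qed.

Lemma scalar_dot_hermitian (x y : R[i]^o) :
  scalar_dot x y = (-1) ^+ false * Num.conj (scalar_dot y x).
Proof. by rewrite expr0 mul1r /scalar_dot rmorphM /= conjCK mulrC. Qed.

Lemma scalar_dot_gt0 (x : R[i]^o) : x != 0 -> 0 < scalar_dot x x.
Proof. by move=> x0; rewrite /scalar_dot -normCK exprn_gt0// normr_gt0. Qed.

HB.instance Definition _ :=
  @bilinear_isBilinear.Build _ _ _ _ _ _ scalar_dot scalar_dot_bilinear.
HB.instance Definition _ :=
  @isHermitianSesquilinear.Build _ _ _ _ scalar_dot scalar_dot_hermitian.
HB.instance Definition _ := @isDotProduct.Build _ _ scalar_dot scalar_dot_gt0.

Definition scalar_space : innerProductSpace R :=
  InnerProductSpace [the {dot R[i]^o for Num.conj} of scalar_dot].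

End scalar_space.

Section operators.
Variables (R : realType) (H : innerProductSpace R).
Implicit Types (S T : H -> H) (A : set (H -> H)).

Definition ips_norm (x : H) : R := Num.sqrt (sqn x).

Definition opnorm_le T (M : R) := forall x, ips_norm (T x) <= M * ips_norm x.

Definition bounded_operators : set (H -> H) :=
  [set T | linear T /\ exists M, opnorm_le T M].

Definition scalar_operators : set (H -> H) :=
  [set T | exists c : R[i], forall x, T x = c *: x].

(* S is the adjoint of T. *)
Definition is_adjoint T S := forall x y : H, '[T x, y] = '[x, S y].

Definition unital_star_subalgebra A :=
  [/\ A `<=` bounded_operators,
      A idfun,
      forall (a : R[i]) S T, A S -> A T -> A (fun x => a *: S x + T x),
      forall S T, A S -> A T -> A (S \o T)
    & forall T S, A T -> is_adjoint T S -> A S].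

Definition norm_closed A := forall T, bounded_operators T ->
  (forall e : R, 0 < e -> exists2 S, A S & opnorm_le (fun x => T x - S x) e) ->
  A T.

Definition wot_closed A := forall T, bounded_operators T ->
  (forall (n : nat) (xi eta : 'I_n -> H) (e : R), 0 < e ->
    exists2 S, A S &
      forall i, `| '[T (xi i), eta i] - '[S (xi i), eta i] | < e%:C%C) ->
  A T.

Definition Cstar_subalgebra A := unital_star_subalgebra A /\ norm_closed A.

Definition vN_subalgebra A := unital_star_subalgebra A /\ wot_closed A.

Definition Cstar_generated A : set (H -> H) :=
  \bigcap_(D in [set D | Cstar_subalgebra D /\ A `<=` D]) D.

Definition vN_generated A : set (H -> H) :=
  \bigcap_(D in [set D | vN_subalgebra D /\ A `<=` D]) D.

Definition commutant A : set (H -> H) :=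
  [set T | bounded_operators T /\ forall S, A S -> T \o S = S \o T].

(* Positivity of an operator on the Hilbert space; for an element of a
   C*-subalgebra of B(H) this is positivity in the subalgebra. *)
Definition positive_operator T := forall x : H, 0 <= '[T x, x].

(* States on A are represented by functions on all operators, of which only the
   values on A matter. *)
Definition state_on A (phi : (H -> H) -> R[i]) :=
  [/\ forall (a : R[i]) S T, A S -> A T ->
        phi (fun x => a *: S x + T x) = a * phi S + phi T,
      phi idfun = 1
    & forall T, A T -> positive_operator T -> 0 <= phi T].

Definition norm_separable A := exists D : set (H -> H),
  [/\ countable D, D `<=` A
    & forall T, A T -> forall e : R, 0 < e ->
        exists2 S, D S & opnorm_le (fun x => T x - S x) e].

(* The functional T |-> sum_k <T xi_k, eta_k>, for square-summable sequences xi
   and eta in H; these functionals define the ultraweak topology on B(H). *)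
Definition uw_functional (xi eta : l2seq nat H) T : R[i] :=
  csum (fun k => '[T (xi k), eta k]).

Definition ultraweakly_dense A D := A `<=` D /\
  forall T, D T ->
  forall (n : nat) (xi eta : 'I_n -> l2seq nat H) (e : R), 0 < e ->
    exists2 S, A S & forall i,
      `| uw_functional (xi i) (eta i) T - uw_functional (xi i) (eta i) S |
        < e%:C%C.

Definition directed (I : Type) (le : I -> I -> Prop) :=
  [/\ inhabited I, forall i, le i i,
      forall i j k, le i j -> le j k -> le i k
    & forall i j, exists k, le i k /\ le j k].

Definition net_cvg (I : Type) (le : I -> I -> Prop) (u : I -> R[i]) (l : R[i]) :=
  forall e : R, 0 < e -> exists i0, forall i, le i0 i -> `|u i - l| < e%:C%C.

Definition singular_states A (tau tau' : (H -> H) -> R[i]) :=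
  exists (I : Type) (le : I -> I -> Prop) (a : I -> H -> H),
    [/\ directed le,
        forall i, [/\ A (a i), positive_operator (a i)
                    & positive_operator (fun x => x - a i x)],
        net_cvg le (fun i => tau (a i)) 1
      & net_cvg le (fun i => tau' (a i)) 0].

End operators.

Arguments scalar_operators {R} H _.

Section equivariant_operators.
Variables (R : realType) (Gamma : groupType) (K : innerProductSpace R).
Implicit Types (g h : Gamma) (T : l2 Gamma K -> l2 Gamma K)
  (A : set (l2 Gamma K -> l2 Gamma K)).

(* 0 if f is not square-summable. *)
Definition l2_mk (f : Gamma -> K) : l2 Gamma K :=
  insubd (0 : l2seq Gamma K) f.

Lemma l2_mkE (f : Gamma -> K) : f \in @square_summable R Gamma K ->
  (l2_mk f : l2seq Gamma K) = f :> (Gamma -> K).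
Proof. by move=> fs; rewrite /l2_mk (insubdK 0 fs). Qed.

(* lambda(g) (tensored with the identity of K) on l2(Gamma, K). *)
Definition translation g : l2 Gamma K -> l2 Gamma K :=
  fun xi : l2seq Gamma K => l2_mk (fun h => xi (g^-1 * h)%g).

Lemma translationE g (xi : l2seq Gamma K) h :
  (translation g xi : l2seq Gamma K) h = xi (g^-1 * h)%g.
Proof.
rewrite /translation l2_mkE//; apply/square_summableP.
have := l2seqP xi; rewrite /rsummable /summable.
rewrite (reindex_esum setT setT (fun h => g^-1 * h)%g)//.
split=> //; first by move=> x y _ _; exact: mulgI.
by move=> x _; exists (g * x)%g => //; rewrite mulKg.
Qed.

(* The vector of l2(Gamma, K) supported at 1 with value u there. *)
Definition delta1 (u : K) : l2 Gamma K :=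
  l2_mk (fun h => if h == 1%g then u else 0).

Lemma delta1E u h :
  (delta1 u : l2seq Gamma K) h = if h == 1%g then u else 0.
Proof.
rewrite /delta1 l2_mkE//; apply/square_summableP; rewrite /rsummable /summable.
rewrite (esumID [set 1%g])//= setTI esum_set1// esum1 ?adde0 ?ltry//.
by move=> i [_ /= /eqP/negPf ->]; rewrite sqn0 normr0.
Qed.

Definition conj_action g T := translation g \o T \o translation g^-1%g.

Definition conj_invariant A := forall g T, A T -> A (conj_action g T).

Definition co_amenable A := exists phi : (l2 Gamma K -> l2 Gamma K) -> R[i],
  state_on (commutant A) phi /\
  forall g T, commutant A T -> phi (conj_action g T) = phi T.

End equivariant_operators.

Section group_algebras.
Variables (R : realType) (Gamma : groupType).

Definition ell2 : innerProductSpace R := l2 Gamma (scalar_space R).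

Definition reduced_Cstar : set (ell2 -> ell2) :=
  Cstar_generated (range (@translation R Gamma (scalar_space R))).

Definition group_vN : set (ell2 -> ell2) :=
  vN_generated (range (@translation R Gamma (scalar_space R))).

End group_algebras.

Arguments reduced_Cstar R Gamma _ : clear implicits.
Arguments group_vN R Gamma _ : clear implicits.

(* B is Borel isomorphic to a Polish space X. *)
Definition standard_borel (R : realType) d (B : measurableType d) :=
  exists (X : completePseudoMetricType R) (f : B -> X),
    [/\ hausdorff_space X, @second_countable X, bijective f
      & forall A : set B, measurable A <->
          exists2 U : set X, <<s open >> U & A = f @^-1` U].

Section nonsingular_spaces.
Variables (R : realType) (Gamma : groupType).
Context d (B : measurableType d) (nu : probability B R).
Variable act : Gamma -> B -> B.
Implicit Types (f : B -> R[i]) (F : Gamma -> B -> R[i]).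

Definition nonsingular_space :=
  [/\ standard_borel R B,
      (forall b, act 1%g b = b) /\
        (forall g h b, act (g * h)%g b = act g (act h b)),
      forall g, measurable_fun setT (act g)
    & forall g (A : set B), measurable A ->
        nu (act g @^-1` A) = 0%E <-> nu A = 0%E].

Definition ergodic := forall A : set B, measurable A ->
  (forall g, act g @^-1` A = A) -> nu A = 0%E \/ nu (~` A) = 0%E.

Definition cmeasurable f :=
  measurable_fun setT (@Re R \o f) /\ measurable_fun setT (@Im R \o f).

(* Representatives of elements of L^oo(B, nu). *)
Definition Linf : set (B -> R[i]) :=
  [set f | cmeasurable f /\
           exists M : R, {ae nu, forall b, `|f b| <= M%:C%C}].

(* Representatives of elements of L^oo(Gamma x B), for the product of the
   counting measure with nu: as Gamma is countable and discrete, measurability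
   and almost everywhere statements on Gamma x B are tested on the slices. *)
Definition Linf_prod : set (Gamma -> B -> R[i]) :=
  [set F | (forall g, cmeasurable (F g)) /\
           exists M : R, forall g, {ae nu, forall b, `|F g b| <= M%:C%C}].

(* P is a conditional expectation: positive (complete positivity is automatic
   for commutative algebras), the identity on L^oo(B, nu), which sits in
   L^oo(Gamma x B) as the functions of b only, and L^oo(B, nu)-bimodular. It is
   given on representatives, compatibly with almost everywhere equality, and it
   need not be normal. *)
Definition zimmer_amenable := exists P : (Gamma -> B -> R[i]) -> (B -> R[i]),
  [/\ forall F, Linf_prod F -> Linf (P F),
      forall F F', Linf_prod F -> Linf_prod F' ->
        (forall g, F g = F' g %[ae nu]) -> P F = P F' %[ae nu],
      forall (a : R[i]) F F', Linf_prod F -> Linf_prod F' ->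
        P (fun g b => a * F g b + F' g b) =
          (fun b => a * P F b + P F' b) %[ae nu],
      forall F, Linf_prod F -> (forall g, {ae nu, forall b, 0 <= F g b}) ->
        {ae nu, forall b, 0 <= P F b}
    & [/\ forall f, Linf f -> P (fun=> f) = f %[ae nu],
          forall f F, Linf f -> Linf_prod F ->
            P (fun g b => f b * F g b) = (fun b => f b * P F b) %[ae nu]
        & forall s F, Linf_prod F ->
            P (fun g b => F (s^-1 * g)%g (act s^-1%g b)) =
              (fun b => P F (act s^-1%g b)) %[ae nu] ] ].

(* The class of f, or 0 if f is not square-integrable. *)
Definition L2_mk f : L2 nu := \pi_(L2class nu)%qT (insubd (0 : L2fun nu) f).

(* Multiplication by f; L^oo(B, nu) is identified with the algebra of these
   operators on L^2(B, nu), f ranging over Linf. *)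
Definition mul_operator f : L2 nu -> L2 nu :=
  fun u : L2class nu => L2_mk (fun b => f b * repr u b).

(* The copy of f in the crossed product, acting on l2(Gamma, L^2(B, nu)) by
   (f xi)(h) = (h^-1 . f) xi(h), where (h^-1 . f)(b) = f (h b). Then
   translation g \o crossed_embed f \o translation g^-1 = crossed_embed (g . f). *)
Definition crossed_embed f : l2 Gamma (L2 nu) -> l2 Gamma (L2 nu) :=
  fun xi : l2seq Gamma (L2 nu) =>
    l2_mk (fun h => mul_operator (f \o act h) (xi h)).

Definition crossed_product : set (l2 Gamma (L2 nu) -> l2 Gamma (L2 nu)) :=
  vN_generated ([set crossed_embed f | f in Linf]
                `|` range (@translation R Gamma (L2 nu))).

(* The entry of index (1, 1) of T as a matrix over Gamma x Gamma. On the crossed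
   product its values are multiplication operators: f lambda(g) is sent to 0 if
   g <> 1 and to the multiplication by f if g = 1. *)
Definition cond_exp (T : l2 Gamma (L2 nu) -> l2 Gamma (L2 nu)) :
    L2 nu -> L2 nu :=
  fun u => (T (delta1 Gamma u) : l2seq Gamma (L2 nu)) 1%g.

Section singular.
Variable K : innerProductSpace R.
Notation op := (l2 Gamma K -> l2 Gamma K).

Definition state_action (s : Gamma) (tau : op -> R[i]) : op -> R[i] :=
  fun a => tau (conj_action s^-1%g a).

(* Phi : N -> L^oo(B, nu), the values being seen as multiplication operators.
   The C*-algebra C is existentially quantified: the condition does not depend
   on the choice of C, and such a C always exists. *)
Definition gamma_singular (N : set op) (Phi : op -> (L2 nu -> L2 nu)) :=
  exists (C : set op) (theta : B -> op -> R[i]),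
    [/\ [/\ Cstar_subalgebra C, ultraweakly_dense C N,
            conj_invariant C & norm_separable C],
        [/\ forall b, state_on C (theta b),
            forall a, C a -> cmeasurable (fun b => theta b a)
          & forall s, {ae nu, forall b, forall a, C a ->
              theta (act s b) a = state_action s (theta b) a} ],
        forall a, C a -> Phi a = mul_operator (fun b => theta b a)
      & {ae nu, forall b, forall s : Gamma, s != 1%g ->
          singular_states C (state_action s (theta b)) (theta b)} ].

End singular.

Definition SH_property :=
  ergodic /\
  forall N, vN_subalgebra N -> N `<=` crossed_product -> conj_invariant N ->
    gamma_singular N cond_exp \/
    [set cond_exp T | T in N] = scalar_operators (L2 nu).

End nonsingular_spaces.

(* Main.v *)
From mathcomp Require Import all_boot all_order all_algebra.
From mathcomp Require Import complex ring lra.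
From mathcomp Require Import all_classical all_reals all_analysis.
From mathcomp Require Import measurable_realfun.
Set Implicit Arguments. Unset Strict Implicit. Unset Printing Implicit Defensive.
Import Order.TTheory GRing.Theory Num.Theory.
Import numFieldNormedType.Exports.
Require Import Defs.

(** Both statements reduce to one about a conjugation-invariant unital *-algebra [A]
    of operators in L(Gamma) that is not reduced to the scalars: a von Neumann algebra
    is norm closed, so C*_r(Gamma) is contained in L(Gamma). An invariant state on the
    commutant A' has to be found ([co_amenable_of_SH]).

    Zimmer amenability gives an equivariant conditional expectation [P] from
    L^oo(Gamma x B) to L^oo(B). Let R_x be the right translations of l2(Gamma). For a
    bounded operator T, the images under [P] of the functions
    x => <T R_x xi, R_x eta>, for xi and eta in the canonical basis, are the entries of
    a bounded matrix, that is, of an operator W on l2(Gamma, L2(B))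
    ([averaged_exists]). The equivariance of [P] says that this matrix has the symmetry
    of the elements of the crossed product, and the bicommutant theorem then puts W in
    the crossed product ([averaged_covariant], [covariant_in_crossed_product]).
    Operators X in L(Gamma) commute with the R_x, so their average is X (x) 1, and the
    average of an operator of A' commutes with X (x) 1 for every X in A
    ([averaged_commutes]). Thus the averages of A' lie in the algebra N of the elements
    of the crossed product that commute with A (x) 1. It is an invariant von Neumann
    subalgebra, and the SH-property applies to it.

    Assume first that the canonical expectation E is singular on N, with states
    theta b on a separable C*-algebra dense in N. An X in A has X (x) 1 commuting with
    N, and by the Cauchy-Schwarz inequality its Fourier coefficient a at s satisfies
    |a|^2 <= 2 C (1 - theta b (c) + theta b (s . c)) for almost all b and all c between
    0 and 1, where C is a bound of the square of the norm of X (x) 1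
    ([fourier_le_on_vectors]). Singularity makes the right-hand side arbitrarily small
    when s is not 1, so a = 0 for these s ([singular_fourier_eq0]), and X is a scalar
    ([scalar_of_fourier]). This contradicts the choice of [A].

    Hence E maps N to the scalars. For T in A', the image under [P] of
    x => <T R_x 1, R_x 1>, where 1 stands for the basis vector at the unit, is E of the
    average of T and is therefore constant. Its value is a state of T, positive and
    unital because [P] is, and invariant because [P] is equivariant and constants are
    fixed by the action on B. *)

Local Open Scope classical_set_scope.
Local Open Scope ring_scope.
Local Notation Re := complex.Re.
Local Notation Im := complex.Im.

(** * Complex numbers *)

Section complex_numbers.
Variable R : realType.
Implicit Types (a z w : R[i]).

(** The squared modulus as a real number, which keeps the estimates in the real field. *)
Definition normsq z : R := Re z ^+ 2 + Im z ^+ 2.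

Lemma ImN z : Im (- z) = - Im z. Proof. by case: z. Qed.

Lemma normsq_ge0 z : 0 <= normsq z.
Proof. by rewrite addr_ge0 ?sqr_ge0. Qed.

Lemma normsqM z w : normsq (z * w) = normsq z * normsq w.
Proof. by rewrite /normsq ReM ImM; ring. Qed.

Lemma normsqJ z : normsq (Num.conj z) = normsq z.
Proof. by rewrite /normsq ReJ ImJ sqrrN. Qed.

Lemma normsq_eq0 z : normsq z = 0 -> z = 0.
Proof.
move=> /eqP; rewrite paddr_eq0 ?sqr_ge0// !sqrf_eq0 => /andP[/eqP a /eqP b].
exact: complex_ext.
Qed.

Lemma Re_le_normsq z : Re z ^+ 2 <= normsq z.
Proof. by rewrite lerDl sqr_ge0. Qed.

Lemma mulcJ z : z * Num.conj z = (normsq z)%:C%C.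
Proof.
apply: complex_ext; rewrite ?ReM ?ImM ReJ ImJ /= /normsq; ring.
Qed.

Lemma ReZ (r : R) z : Re (r%:C%C * z) = r * Re z.
Proof. by rewrite ReM /= mul0r subr0. Qed.

Lemma normsq_real (r : R) : normsq r%:C%C = r ^+ 2.
Proof. by rewrite /normsq /= expr0n addr0. Qed.

Lemma normsq_lin_le a z w :
  normsq (a * z + w) <= 2 * (normsq a * normsq z + normsq w).
Proof.
rewrite -normsqM; move: (a * z) w => [x1 x2] [y1 y2]; rewrite /normsq /=.
have := sqr_ge0 (x1 - y1); have := sqr_ge0 (x2 - y2); nra.
Qed.

Lemma Re_le_sqrt z (c : R) : 0 <= c -> normsq z <= c ^+ 2 -> Re z <= c.
Proof.
move=> c0 h; have := le_trans (Re_le_normsq z) h.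
by move=> h2; rewrite leNgt; apply/negP => h3; nra.
Qed.

(** Optimizing the modulus of [a] in the hypothesis; its phase is used to turn
    the real part into the modulus. *)
Lemma normsq_le_of_Re w (A s b : R) : 0 <= A -> 0 <= s -> 0 <= b ->
  (forall a, Re (a * w) <= A * (normsq a * s + b)) ->
  normsq w <= 4 * A ^+ 2 * b * s.
Proof.
move=> A0 s0 b0 h; have W0 := normsq_ge0 w; set W := normsq w in W0 *.
have {}h t : t * W <= A * (t ^+ 2 * W * s + b).
  have := h (t%:C%C * Num.conj w).
  rewrite -mulrA [_ * w]mulrC mulcJ ReZ /= normsqM normsqJ normsq_real.
  by rewrite -/W.
have [->|Wn0] := eqVneq W 0; first by rewrite !mulr_ge0// sqr_ge0.
have Wp : 0 < W by rewrite lt0r Wn0.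
have [As|As] := eqVneq (A * s) 0.
  have := h ((A * b + 1) / W); rewrite divfK//.
  rewrite mulrDr (_ : A * (_ * s) = (((A * b + 1) / W) ^+ 2 * W) * (A * s)).
    by rewrite As mulr0 add0r => ?; lra.
  by ring.
have Asp : 0 < A * s by rewrite lt0r As mulr_ge0.
(* [t] minimizes [A * (t ^+ 2 * W * s) - t * W] *)
have := h (2 * (A * s))^-1; set t := _^-1.
have tE : t * (A * s) = 2^-1 by rewrite /t invfM mulfVK.
have t0 : 0 < t by rewrite invr_gt0 mulr_gt0.
rewrite [A * _]mulrDr (_ : A * (t ^+ 2 * W * s) = t * (A * s) * t * W); last by ring.
rewrite tE => h1.
have h2 : t * W <= 2 * (A * b) by lra.
have := ler_wpM2r (ltW Asp) h2.
rewrite mulrAC tE => h3.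
rewrite (_ : 4 * _ * _ * _ = 2 * (2 * (A * b) * (A * s))); last by ring.
lra.
Qed.

End complex_numbers.

(** * Hilbert spaces: projections, Riesz representation, adjoints *)

Section inner_product.
Variables (R : realType) (H : innerProductSpace R).
Implicit Types (x y z : H) (a : R[i]).

Lemma dotC x y : '[x, y] = Num.conj '[y, x].
Proof. by rewrite hermC /= expr0 mul1r. Qed.

Lemma dotDl x y z : '[x + y, z] = '[x, z] + '[y, z]. Proof. exact: linearDl. Qed.
Lemma dotDr x y z : '[z, x + y] = '[z, x] + '[z, y]. Proof. exact: linearDr. Qed.
Lemma dotBl x y z : '[x - y, z] = '[x, z] - '[y, z]. Proof. exact: linearBl. Qed.
Lemma dotBr x y z : '[z, x - y] = '[z, x] - '[z, y]. Proof. exact: linearBr. Qed.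
Lemma dotZl a x y : '[a *: x, y] = a * '[x, y]. Proof. exact: linearZl_LR. Qed.
Lemma dotZr a x y : '[x, a *: y] = Num.conj a * '[x, y].
Proof. by rewrite dotC dotZl rmorphM /= -dotC. Qed.
Lemma dot0l x : '[0, x] = 0. Proof. exact: linear0l. Qed.
Lemma dot0r x : '[x, 0] = 0. Proof. exact: linear0r. Qed.
Lemma dot_sumr I r (P : pred I) (f : I -> H) x :
  '[x, \sum_(i <- r | P i) f i] = \sum_(i <- r | P i) '[x, f i].
Proof. exact: linear_sumr. Qed.
Lemma dot_suml I r (P : pred I) (f : I -> H) x :
  '[\sum_(i <- r | P i) f i, x] = \sum_(i <- r | P i) '[f i, x].
Proof. exact: linear_sumlz. Qed.

Lemma sqn_scale a x : sqn (a *: x) = normsq a * sqn x.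
Proof. exact: sqnZ. Qed.

Lemma sqn_eq0 x : sqn x = 0 -> x = 0.
Proof. by move=> h; apply/eqP; rewrite -(dnorm_eq0 (ips_dot H)) dot_sqn h. Qed.

Lemma dot_ext x y : (forall z, '[x, z] = '[y, z]) -> x = y.
Proof.
move=> h; apply/eqP; rewrite -subr_eq0; apply/eqP/sqn_eq0.
by rewrite /sqn dotBl h subrr.
Qed.

Lemma sqnB_sym x y : sqn (x - y) = sqn (y - x).
Proof. by rewrite -sqnN opprB. Qed.

Lemma Re_dot_le_half x y : Re '[x, y] <= 2^-1 * (sqn x + sqn y).
Proof.
have := sqn_ge0 (x - y); rewrite sqnD sqnN linearNr ReN; lra.
Qed.

Lemma dot_normsq_le x y : normsq '[x, y] <= sqn x * sqn y.
Proof.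
have : normsq '[x, y] <= 4 * 2^-1 ^+ 2 * sqn y * sqn x.
  apply: normsq_le_of_Re; rewrite ?sqn_ge0// => a.
  by rewrite -dotZl -sqn_scale; exact: Re_dot_le_half.
by rewrite mulrC (_ : 4 * _ = 1) ?mul1r//; field.
Qed.

Lemma dot_normsq_le_bound x y (a b : R) : sqn x <= a -> sqn y <= b ->
  normsq '[x, y] <= a * b.
Proof. by move=> xa yb; apply: le_trans (dot_normsq_le x y) _; rewrite ler_pM ?sqn_ge0. Qed.

Lemma Re_dot_small y (e : R) : 0 < e ->
  exists2 d, 0 < d & forall x, sqn x < d -> Re '[x, y] < e.
Proof.
move=> e0; have y0 := sqn_ge0 y; exists (e ^+ 2 / (sqn y + 1)).
  by rewrite divr_gt0 ?exprn_gt0//; lra.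
move=> x; rewrite ltr_pdivlMr; last by lra.
move=> h; have := le_trans (Re_le_normsq _) (dot_normsq_le x y).
have := sqn_ge0 x; move=> x0 h2; rewrite ltNge; apply/negP => h3; nra.
Qed.

Definition linear_functional (f : H -> R[i]) :=
  forall a x y, f (a *: x + y) = a * f x + f y.

Definition bounded_functional (f : H -> R[i]) :=
  linear_functional f /\ exists C, forall x, normsq (f x) <= C * sqn x.

Lemma linear_functional0 f : linear_functional f -> f 0 = 0.
Proof.
by move=> fl; have := fl (-1) 0 0; rewrite scaler0 addr0 mulN1r addNr.
Qed.

Lemma linear_functionalZ f a x : linear_functional f -> f (a *: x) = a * f x.
Proof. by move=> fl; rewrite -[a *: x]addr0 fl linear_functional0// addr0. Qed.

Lemma linear_functionalB f x y : linear_functional f -> f (x - y) = f x - f y.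
Proof. by move=> fl; rewrite addrC -scaleN1r fl mulN1r addrC. Qed.

(** The constant [b] is not homogeneous in [x], but replacing [x] by its multiples and
    optimizing turns the hypothesis into a genuine norm bound. *)
Lemma bounded_functional_of_Re f (A b : R) : linear_functional f -> 0 <= A ->
  0 <= b -> (forall x, Re (f x) <= A * (sqn x + b)) -> bounded_functional f.
Proof.
move=> fl A0 b0 h; split=> //; exists (4 * A ^+ 2 * b) => x.
apply: normsq_le_of_Re => //; first exact: sqn_ge0.
by move=> a; rewrite -linear_functionalZ// -sqn_scale.
Qed.

Definition hilbert := forall u : nat -> H,
  (forall e : R, 0 < e -> exists N, forall m n, (N <= m)%N -> (N <= n)%N ->
     sqn (u m - u n) < e) ->
  exists l, forall e : R, 0 < e -> exists N, forall n, (N <= n)%N ->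
     sqn (u n - l) < e.

Definition subspace (K : set H) := K 0 /\ forall a x y, K x -> K y -> K (a *: x + y).

Definition adherent (K : set H) x :=
  forall e : R, 0 < e -> exists2 y, K y & sqn (x - y) < e.

Lemma parallelogram x y : sqn (x + y) + sqn (x - y) = 2 * (sqn x + sqn y).
Proof. by rewrite !sqnD sqnN linearNr ReN; lra. Qed.

(** The limit of a minimizing sequence. As [K] need not be closed, the projection is
    only adherent to it. *)
Lemma orthogonal_projection (K : set H) : hilbert -> subspace K ->
  forall x, exists p, adherent K p /\ forall y, K y -> '[x - p, y] = 0.
Proof.
move=> cH [K0 KD] x.
have KZ a y : K y -> K (a *: y) by move=> Ky; rewrite -[_ *: _]addr0; exact: KD.
have KA y z : K y -> K z -> K (y + z) by move=> ? ?; rewrite -[y]scale1r; exact: KD.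
pose D := [set sqn (x - y) | y in K].
have D0 : D !=set0 by exists (sqn (x - 0)), 0.
have lbD : lbound D 0 by move=> _ [y _ <-]; exact: sqn_ge0.
have hD : has_inf D by split=> //; exists 0.
pose d := inf D.
have dle y : K y -> d <= sqn (x - y).
  by move=> Ky; apply: ge_inf; [exists 0|exists y].
have hu n : exists y, K y /\ sqn (x - y) < d + n.+1%:R^-1.
  have [_ [y Ky <-] lt] := inf_adherent (eps := n.+1%:R^-1) (etrans (invr_gt0 _) (ltr0Sn R n)) hD.
  by exists y.
have [u uP] := choice hu.
have small (e : R) : 0 < e -> exists N, forall n, (N <= n)%N -> n.+1%:R^-1 < e.
  move=> e0; exists (Num.truncn e^-1) => n Nn.
  rewrite invf_plt ?posrE//; apply: lt_le_trans (truncnS_gt _) _.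
  by rewrite ler_nat.
have [|p pP] := cH u.
  move=> e e0; have [N NP] := small (e / 4) (divr_gt0 e0 (ltr0n _ 4)).
  exists N => m n Nm Nn.
  have [Km mlt] := uP m; have [Kn nlt] := uP n.
  have := parallelogram (x - u m) (x - u n).
  have -> : x - u m + (x - u n) = 2%:R *: (x - 2%:R^-1 *: (u m + u n)).
    rewrite scalerBr scalerA divff ?pnatr_eq0// scale1r.
    by rewrite scaler_nat mulr2n opprD addrACA.
  have -> : x - u m - (x - u n) = u n - u m.
    by rewrite opprB addrC addrA subrK.
  rewrite sqn_scale (_ : normsq 2%:R = 4); last first.
    by rewrite (_ : 2%:R = (2%:R : R)%:C%C) ?normsq_real ?rmorph_nat//; ring.
  have := dle _ (KZ 2%:R^-1 _ (KA _ _ Km Kn)).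
  rewrite (sqnB_sym (u m)); have := NP _ Nm; have := NP _ Nn.
  move: mlt nlt; move: (sqn (x - u m)) (sqn (x - u n)) => A1 A2.
  move: (sqn _) (sqn _) (n.+1%:R^-1) (m.+1%:R^-1) => A B r1 r2; lra.
exists p; split.
  move=> e e0; have [N NP] := pP e e0.
  by exists (u N); [exact: (uP N).1|rewrite sqnB_sym; exact: NP].
(* moving from [p] in the direction [y] does not decrease the distance to [x] *)
have key y : K y -> - (Re '[x - p, y] *+ 2) <= sqn y.
  move=> Ky; apply/ler_addgt0Pr => e e0.
  have e2 : 0 < e / 2 by rewrite divr_gt0.
  have e4 : 0 < e / 4 by rewrite divr_gt0.
  have [dl dl0 dlP] := Re_dot_small y e4.
  have [N NP] := small _ e2; have [N' N'P] := pP _ dl0.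
  pose n := maxn N N'.
  have h1 := NP n (leq_maxl _ _); have h2 := N'P n (leq_maxr _ _).
  have := dlP (p - u n); rewrite sqnB_sym => /(_ h2) h3.
  have [Kn nlt] := uP n.
  have := dle _ (KA _ _ Kn (KZ (-1) _ Ky)).
  rewrite opprD scaleN1r opprK addrA sqnD.
  have -> : x - u n = x - p + (p - u n) by rewrite addrA subrK.
  rewrite (dotDl (x - p)).
  have -> : sqn (x - p + (p - u n)) = sqn (x - u n) by rewrite addrA subrK.
  move: h1 h3 nlt; rewrite ReD (mulr2n (Re '[x - p, y])) (mulr2n (_ + _)).
  move: (sqn (x - u n)) (sqn y) (Re _) (Re _) (n.+1%:R^-1) => A B r1 r2 r3; lra.
move=> y Ky; apply: normsq_eq0; apply/eqP; rewrite -normsqJ eq_le normsq_ge0 andbT.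
have /(_ 1 (sqn y) 0) := @normsq_le_of_Re R (Num.conj '[x - p, y]).
rewrite mulr0 mul0r; apply => //; first exact: sqn_ge0.
move=> a; rewrite addr0 mul1r -{1}[a]conjCK -rmorphM /= ReJ -dotZr.
have := key _ (KZ (- Num.conj (Num.conj a)) _ Ky).
rewrite scaleNr linearNr ReN sqnN sqn_scale mulNrn opprK conjCK.
have := normsq_ge0 a; have := sqn_ge0 y; nra.
Qed.

(** Riesz representation: up to a scalar, the vector is the component of any [x0]
    outside the kernel of [f] that is orthogonal to this kernel. *)
Lemma riesz f : hilbert -> bounded_functional f -> exists z, forall x, f x = '[x, z].
Proof.
move=> cH [fl [C fC]].
have [f0|/existsNP[x0 /eqP fx0]] := pselect (forall x, f x = 0).
  by exists 0 => x; rewrite f0 dot0r.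
pose K := [set x | f x = 0].
have sK : subspace K.
  split; first exact: linear_functional0.
  by move=> a x y /= fx fy; rewrite /K /= fl fx fy mulr0 addr0.
have [p [pK pO]] := orthogonal_projection cH sK x0.
have fp : f p = 0.
  apply: normsq_eq0; apply/eqP; rewrite eq_le normsq_ge0 andbT.
  apply/ler_addgt0Pr => e e0; rewrite add0r.
  have [y fy lt] := pK (e / (`|C| + 1)) (divr_gt0 e0 (ltr_pwDr ltr01 (normr_ge0 _))).
  have := fC (p - y); rewrite linear_functionalB// fy subr0.
  move=> /le_trans; apply.
  apply: (@le_trans _ _ ((`|C| + 1) * sqn (p - y))).
    by apply: ler_wpM2r; [exact: sqn_ge0|have := ler_norm C; lra].
  rewrite mulrC -ler_pdivlMr; first exact: ltW.
  by have := normr_ge0 C; lra.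
pose q := x0 - p.
have fq : f q != 0 by rewrite /q linear_functionalB// fp subr0.
have q0 : '[q, q] != 0.
  rewrite dnorm_eq0; apply: contra fq => /eqP ->.
  by rewrite linear_functional0.
exists (Num.conj (f q / '[q, q]) *: q) => x.
rewrite dotZr conjCK.
have : '[q, f q *: x - f x *: q] = 0.
  apply: pO; rewrite /K /= linear_functionalB// !linear_functionalZ//.
  by rewrite [X in X - _]mulrC subrr.
move=> /(congr1 Num.conj); rewrite -dotC dotBl !dotZl conjC0 => /eqP.
rewrite subr_eq0 => /eqP e.
by apply/(mulIf q0); rewrite -e mulrAC divfK.
Qed.

Lemma bounded_operatorsP (T : H -> H) : bounded_operators T <->
  linear T /\ exists2 C, 0 <= C & forall x, sqn (T x) <= C * sqn x.
Proof.
split=> [[Tl [M TM]]|[Tl [C C0 TC]]]; split=> //.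
  exists (M ^+ 2); first exact: sqr_ge0.
  move=> x; have := TM x; rewrite /ips_norm => h.
  rewrite -[sqn (T x)]sqr_sqrtr ?sqn_ge0// -[sqn x]sqr_sqrtr ?sqn_ge0//.
  by rewrite -exprMn ler_sqr ?nnegrE ?sqrtr_ge0//; exact: le_trans (sqrtr_ge0 _) h.
exists (Num.sqrt C) => x; rewrite /ips_norm -sqrtrM//.
by apply: ler_wsqrtr.
Qed.

Lemma bounded_linear (T : H -> H) : bounded_operators T -> linear T.
Proof. by case. Qed.

Lemma linear_op0 (T : H -> H) : linear T -> T 0 = 0.
Proof. by move=> Tl; have := Tl (-1) 0 0; rewrite !scaleN1r oppr0 addr0 addNr. Qed.

Lemma linear_opD (T : H -> H) x y : linear T -> T (x + y) = T x + T y.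
Proof. by move=> Tl; rewrite -[x in LHS]scale1r Tl scale1r. Qed.

Lemma linear_opZ (T : H -> H) a x : linear T -> T (a *: x) = a *: T x.
Proof. by move=> Tl; rewrite -[a *: x]addr0 Tl linear_op0// addr0. Qed.

Lemma linear_opB (T : H -> H) x y : linear T -> T (x - y) = T x - T y.
Proof. by move=> Tl; rewrite linear_opD// -scaleN1r linear_opZ// scaleN1r. Qed.

Lemma linear_op_sum (T : H -> H) I r (P : pred I) (f : I -> H) : linear T ->
  T (\sum_(i <- r | P i) f i) = \sum_(i <- r | P i) T (f i).
Proof.
move=> Tl; apply: (big_morph T); last exact: linear_op0.
by move=> x y; exact: linear_opD.
Qed.

Lemma is_adjoint_sym (S T : H -> H) : is_adjoint T S -> is_adjoint S T.
Proof. by move=> h x y; rewrite dotC -h -dotC. Qed.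

Lemma adjoint_bounded (S T : H -> H) : is_adjoint T S -> bounded_operators T ->
  bounded_operators S.
Proof.
move=> TS /bounded_operatorsP[Tl [C C0 TC]]; have ST := is_adjoint_sym TS.
apply/bounded_operatorsP; split.
  move=> a x y; apply: dot_ext => z.
  by rewrite dotDl dotZl !ST dotDl dotZl.
exists C => // x.
have h1 := dot_normsq_le (S x) (S x).
have := le_trans (Re_le_normsq _) (dot_normsq_le (T (S x)) x).
rewrite TS -/(sqn (S x)); have h2 := TC (S x).
have := sqn_ge0 (S x); have := sqn_ge0 x.
move: h2; set s := sqn (S x); set t := sqn x; set r := sqn (T _).
move=> h2 t0 s0 h3.
have {h2 h3} h : s ^+ 2 <= C * s * t by apply: le_trans h3 _; exact: ler_wpM2r.
rewrite leNgt; apply/negP => lt.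
have sp : 0 < s by apply: le_lt_trans lt; exact: mulr_ge0.
by move: h; rewrite mulrAC expr2 ler_pM2r// leNgt lt.
Qed.

Lemma adjoint_exists (T : H -> H) : hilbert -> bounded_operators T ->
  exists S, is_adjoint T S.
Proof.
move=> cH /bounded_operatorsP[Tl [C C0 TC]].
suff /choice[S hS] : forall y, exists z, forall x, '[T x, y] = '[x, z].
  by exists S => x y; exact: hS.
move=> y; apply: riesz => //; split; first by move=> a u v; rewrite Tl dotDl dotZl.
exists (C * sqn y) => x; apply: le_trans (dot_normsq_le _ _) _.
by rewrite mulrAC; apply: ler_wpM2r; [exact: sqn_ge0|exact: TC].
Qed.

Lemma bounded_comp (S T : H -> H) : bounded_operators S -> bounded_operators T ->
  bounded_operators (S \o T).
Proof.
move=> /bounded_operatorsP[Sl [C C0 SC]] /bounded_operatorsP[Tl [D D0 TD]].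
apply/bounded_operatorsP; split; first by move=> a x y /=; rewrite Tl Sl.
exists (C * D); first exact: mulr_ge0.
by move=> x /=; rewrite -mulrA; apply: le_trans (SC _) _; exact: ler_wpM2l.
Qed.

Lemma bounded_lin (a : R[i]) (S T : H -> H) :
  bounded_operators S -> bounded_operators T ->
  bounded_operators (fun x => a *: S x + T x).
Proof.
move=> /bounded_operatorsP[Sl [C C0 SC]] /bounded_operatorsP[Tl [D D0 TD]].
apply/bounded_operatorsP; split.
  move=> b x y; rewrite Sl Tl !scalerDr !scalerA mulrC.
  by rewrite -!addrA; congr (_ + _); rewrite addrCA.
have n0 := normsq_ge0 a.
exists (2 * (normsq a * C + D)); first by rewrite mulr_ge0// addr_ge0// mulr_ge0.
move=> x; apply: le_trans (sqn_addle _ _) _; rewrite sqn_scale.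
rewrite -[leLHS]mulr_natl -[leRHS]mulrA ler_pM2l// [leRHS]mulrDl lerD//.
by rewrite -mulrA ler_wpM2l.
Qed.

Lemma bounded_id : bounded_operators (idfun : H -> H).
Proof. by apply/bounded_operatorsP; split=> //; exists 1 => // x; rewrite mul1r. Qed.

End inner_product.
Arguments hilbert {R} H.

(** * Square-summable families *)

Section unordered_sums.
Variables (R : realType) (I : choiceType).
Implicit Types (a b : I -> R) (f g : I -> R[i]).

Lemma rsumE_ge0 a : (forall i, 0 <= a i) ->
  rsum a = fine (\esum_(i in [set: I]) (a i)%:E)%E.
Proof.
move=> a0; rewrite /rsum [X in (_ - X)%E]esum1 ?sube0; last first.
  by move=> i _; rewrite funenegE /= max_r// lee_fin oppr_le0 a0.
by congr fine; apply: eq_esum => i _; rewrite funeposE /= max_l// lee_fin.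
Qed.

Lemma esum_fin_ge0 a : (forall i, 0 <= a i) -> rsummable a ->
  (\esum_(i in [set: I]) (a i)%:E)%E = (rsum a)%:E.
Proof.
move=> a0 sa; rewrite rsumE_ge0// fineK//.
move: sa; rewrite /rsummable summableE; congr (_ \is a fin_num).
by apply: eq_esum => i _ /=; rewrite ger0_norm.
Qed.

Lemma rsum_le_bound a (C : R) : (forall i, 0 <= a i) ->
  (forall s, uniq s -> \sum_(i <- s) a i <= C) -> rsummable a /\ rsum a <= C.
Proof.
move=> a0 h.
have le : (\esum_(i in [set: I]) (a i)%:E <= C%:E)%E.
  apply: ge_ereal_sup => _ [A [finA _] <-].
  by rewrite fsbig_finite//= sumEFin lee_fin; exact: h.
have sa : rsummable a.
  rewrite /rsummable /summable; apply: le_lt_trans (ltry C).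
  by under eq_esum => i _ do rewrite /= ger0_norm//.
by split=> //; rewrite -lee_fin -esum_fin_ge0.
Qed.

Lemma sum_le_rsum a s : (forall i, 0 <= a i) -> rsummable a -> uniq s ->
  \sum_(i <- s) a i <= rsum a.
Proof.
move=> a0 sa us; rewrite -lee_fin -esum_fin_ge0// -sumEFin.
apply: esum_ge; exists [set` s]; first by split.
by rewrite fsbig_seq.
Qed.

Lemma term_le_rsum a i : (forall i, 0 <= a i) -> rsummable a -> a i <= rsum a.
Proof.
by move=> a0 sa; have := @sum_le_rsum a [:: i] a0 sa isT; rewrite big_seq1.
Qed.

Lemma rsum_reindex a (h : I -> I) : bijective h -> rsum (a \o h) = rsum a.
Proof.
rewrite -setTT_bijective => bh; rewrite /rsum; congr (fine (_ - _)%E).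
  by rewrite [RHS](reindex_esum _ _ _ _ bh); apply: eq_esum => i _; rewrite !funeposE.
by rewrite [RHS](reindex_esum _ _ _ _ bh); apply: eq_esum => i _; rewrite !funenegE.
Qed.

Lemma csum_reindex f (h : I -> I) : bijective h -> csum (f \o h) = csum f.
Proof.
by move=> bh; apply: complex_ext => /=; rewrite -[RHS](rsum_reindex _ bh).
Qed.

Lemma rsum_single a i0 : (forall i, i != i0 -> a i = 0) -> rsum a = a i0.
Proof.
move=> ai; rewrite /rsum.
have E (g : I -> \bar R) : (forall i, i != i0 -> g i = 0%E) -> (0 <= g i0)%E ->
    (\esum_(i in [set: I]) g i = g i0)%E.
  move=> g0 gi; rewrite -(esum_set1 gi) [RHS]esum_mkcond.
  apply: eq_esum => i _; rewrite in_set1; case: eqVneq => [->//|/g0->//].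
rewrite !E ?funeposE ?funenegE//=.
- case: (leP 0 (a i0)) => h.
    by rewrite max_l ?lee_fin// max_r ?lee_fin ?oppr_le0// sube0.
  rewrite max_r ?lee_fin ?(ltW h)// max_l ?lee_fin ?oppr_ge0 ?(ltW h)//.
  by rewrite add0e /= opprK.
- by move=> i /ai h; rewrite funenegE /= h oppr0 max_l.
- by rewrite le_max lexx orbT.
- by move=> i /ai h; rewrite funeposE /= h max_l.
- by rewrite le_max lexx orbT.
Qed.

Lemma csum_single f i0 : (forall i, i != i0 -> f i = 0) -> csum f = f i0.
Proof.
by move=> fi; apply: complex_ext; rewrite /csum /=; apply: rsum_single => i /fi /= ->.
Qed.

End unordered_sums.

Section l2_sequences.
Variables (R : realType) (I : choiceType) (H : innerProductSpace R).
Implicit Types (xi eta : l2 I H) (i j : I) (u v : H) (a : R[i]).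

Definition coord xi i : H := (xi : l2seq I H) i.

Lemma coord_ext xi eta : (forall i, coord xi i = coord eta i) -> xi = eta.
Proof. by move=> h; apply/val_inj/funext => i; exact: h. Qed.

Lemma coordD xi eta i : coord (xi + eta) i = coord xi i + coord eta i.
Proof. by []. Qed.

Lemma coordB xi eta i : coord (xi - eta) i = coord xi i - coord eta i.
Proof. by []. Qed.

Lemma coordZ a xi i : coord (a *: xi) i = a *: coord xi i.
Proof. by []. Qed.

Lemma l2_dotE xi eta : '[xi, eta] = csum (fun i => '[coord xi i, coord eta i]).
Proof. by []. Qed.

Lemma l2_sqnE xi : sqn xi = rsum (fun i => sqn (coord xi i)).
Proof. by []. Qed.

Lemma l2_rsummable xi : rsummable (fun i => sqn (coord xi i)).
Proof. exact: l2seqP. Qed.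

Lemma sqn_coord_le xi i : sqn (coord xi i) <= sqn xi.
Proof.
rewrite l2_sqnE; apply: (@term_le_rsum _ _ (fun i => sqn (coord xi i))).
  by move=> j; exact: sqn_ge0.
exact: l2_rsummable.
Qed.

Lemma sum_sqn_coord_le xi s : uniq s -> \sum_(i <- s) sqn (coord xi i) <= sqn xi.
Proof.
move=> us; rewrite l2_sqnE; apply: sum_le_rsum => //.
  by move=> j; exact: sqn_ge0.
exact: l2_rsummable.
Qed.

Lemma l2_exists (f : I -> H) (C : R) :
  (forall s, uniq s -> \sum_(i <- s) sqn (f i) <= C) ->
  exists xi : l2 I H, coord xi = f /\ sqn xi <= C.
Proof.
move=> h; have [sf le] := rsum_le_bound (fun i => sqn_ge0 (f i)) h.
by exists (L2Seq (introT (asboolP _) sf : f \in @square_summable R I H)).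
Qed.

Definition single i u : l2 I H :=
  insubd (0 : l2seq I H) (fun j => if j == i then u else 0).

Lemma coord_single i u j : coord (single i u) j = if j == i then u else 0.
Proof.
have [xi [xiE _]] : exists xi : l2 I H,
    coord xi = (fun j => if j == i then u else 0) /\ sqn xi <= sqn u.
  apply: l2_exists => s us.
  have [si|si] := boolP (i \in s).
    rewrite (bigD1_seq i)//= eqxx big1 ?addr0// => k /negPf ->.
    exact: sqn0.
  rewrite big_seq big1 ?sqn_ge0// => k ks; case: eqVneq => [ki|]; last by rewrite sqn0.
  by rewrite -ki ks in si.
rewrite /coord /single insubdK//.
by rewrite -xiE; exact: (valP (xi : l2seq I H)).
Qed.

Lemma dot_single xi i u : '[xi, single i u] = '[coord xi i, u].
Proof.
rewrite l2_dotE (csum_single (i0 := i)) ?coord_single ?eqxx// => j /negPf ji.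
by rewrite coord_single ji dot0r.
Qed.

Lemma single_dot xi i u : '[single i u, xi] = '[u, coord xi i].
Proof. by rewrite dotC dot_single -dotC. Qed.

Lemma sqn_single i u : sqn (single i u) = sqn u.
Proof. by rewrite /sqn dot_single coord_single eqxx. Qed.

Lemma single_linear i : linear (single i).
Proof.
move=> a u v; apply: coord_ext => j; rewrite coordD coordZ !coord_single.
by case: eqP => // _; rewrite scaler0 addr0.
Qed.

Lemma singleZ i a u : single i (a *: u) = a *: single i u.
Proof.
by apply: coord_ext => j; rewrite coordZ !coord_single; case: eqP; rewrite ?scaler0.
Qed.

Lemma orth_singles xi : (forall i u, '[single i u, xi] = 0) -> xi = 0.
Proof.
move=> h; apply: coord_ext => i; apply: dot_ext => u.
by rewrite dotC -single_dot h conjC0 dot0l.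
Qed.

(** Limits are taken coordinatewise; the Cauchy property bounds the finite sums of
    [sqn (coord (u n) i - l i)] uniformly over the finite sets of indices. *)
Lemma l2_hilbert : hilbert H -> hilbert (l2 I H).
Proof.
move=> cH u cu.
have /choice[l lP] : forall i, exists l, forall e : R, 0 < e -> exists N,
    forall n, (N <= n)%N -> sqn (coord (u n) i - l) < e.
  move=> i; apply: (cH (fun n => coord (u n) i)) => e e0.
  have [N NP] := cu e e0; exists N => m n Nm Nn.
  by apply: le_lt_trans (NP m n Nm Nn); rewrite -coordB; exact: sqn_coord_le.
have tail (e : R) : 0 < e -> exists N, forall n, (N <= n)%N -> forall s, uniq s ->
    \sum_(i <- s) sqn (coord (u n) i - l i) <= e.
  move=> e0; have e4 : 0 < e / 2 / 2 by rewrite !divr_gt0.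
  have [N NP] := cu _ e4.
  exists N => n Nn s us; apply/ler_addgt0Pr => d d0.
  have [M MP] : exists M, forall m, (M <= m)%N -> forall i, i \in s ->
      sqn (coord (u m) i - l i) < d / 2 / (size s).+1%:R.
    have d1 : 0 < d / 2 / (size s).+1%:R by rewrite !divr_gt0.
    elim: (s) (d / _ / _) d1 => [|i s' IH] d' d'0; first by exists 0%N.
    have [M1 M1P] := IH d' d'0; have [M2 M2P] := lP i d' d'0.
    exists (maxn M1 M2) => m; rewrite geq_max => /andP[m1 m2] j.
    rewrite in_cons => /orP[/eqP->|]; first exact: M2P.
    exact: M1P.
  pose m := maxn N M.
  have h1 := NP n m Nn (leq_maxl _ _).
  have h2 : \sum_(i <- s) sqn (coord (u m) i - l i) <= d / 2.
    apply: (@le_trans _ _ (\sum_(i <- s) (d / 2 / (size s).+1%:R))).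
      by rewrite big_seq [leRHS]big_seq; apply: ler_sum => i si;
        apply/ltW/MP => //; exact: leq_maxr.
    rewrite big_const_seq count_predT iter_addr_0 -[leLHS]mulr_natr mulrAC ler_pdivrMr//.
    by rewrite ler_pM2l ?divr_gt0// ler_nat.
  have h3 := le_trans (sum_sqn_coord_le (u n - u m) us) (ltW h1).
  apply: (@le_trans _ _ (\sum_(i <- s) 2 * (sqn (coord (u n - u m) i) +
      sqn (coord (u m) i - l i)))).
    apply: ler_sum => i _.
    rewrite (_ : coord (u n) i - l i =
      coord (u n - u m) i + (coord (u m) i - l i)); last first.
      by rewrite coordB addrA subrK.
    by rewrite mulr_natl; exact: sqn_addle.
  rewrite -mulr_sumr big_split /=.
  move: h2 h3; move: (\sum_(_ <- _) _) (\sum_(_ <- _) _) => A B; lra.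
have [N0 N0P] := tail 1 ltr01.
have [d [dE _]] := l2_exists (N0P N0 (leqnn _)).
exists (u N0 - d) => e e0.
have [N NP] := tail (e / 2) (divr_gt0 e0 (ltr0Sn _ _)).
exists N => n Nn.
have [xi [xiE xile]] := l2_exists (NP n Nn).
rewrite (_ : u n - (u N0 - d) = xi).
  by apply: le_lt_trans xile _; rewrite ltr_pdivrMr// ltr_pMr// ltr1n.
apply: coord_ext => i; rewrite !coordB dE xiE; congr (_ - _).
by rewrite opprB addrC subrK.
Qed.

End l2_sequences.

(** * The scalars as a Hilbert space *)

Section complete_spaces.
Variable R : realType.

Lemma cauchy_real_converges (u : nat -> R) :
  (forall e : R, 0 < e -> exists N, forall m n, (N <= m)%N -> (N <= n)%N ->
     (u m - u n) ^+ 2 < e) ->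
  exists l, forall e : R, 0 < e -> exists N, forall n, (N <= n)%N ->
     (u n - l) ^+ 2 < e.
Proof.
move=> cu.
have sq (x d : R) : 0 < d -> x ^+ 2 < d ^+ 2 -> `|x| < d.
  move=> d0; rewrite -[x ^+ 2]real_normK ?num_real// ltr_sqr ?nnegrE//.
  exact: ltW.
have : cvgn u.
  apply/cauchy_cvgP/cauchy_exP => d d0.
  have [N NP] := cu _ (exprn_gt0 2 d0).
  exists (u N), N => // n /= Nn.
  by rewrite -ball_normE /=; apply: sq => //; exact: NP.
move=> /cvg_ex[l /cvgrPdist_lt ul]; exists l => e e0.
have [N _ NP] := ul (Num.sqrt e) (etrans (sqrtr_gt0 _) e0).
exists N => n Nn; have := NP n Nn; rewrite distrC => h.
rewrite -[_ ^+ 2]real_normK ?num_real// -[ltRHS](sqr_sqrtr (ltW e0)).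
by rewrite ltr_sqr ?nnegrE ?sqrtr_ge0.
Qed.

Lemma scalar_sqnE (z : scalar_space R) : sqn z = normsq (z : R[i]).
Proof. by rewrite -[RHS]/(Re (normsq (z : R[i]))%:C%C) -mulcJ. Qed.

Lemma scalar_hilbert : hilbert (scalar_space R).
Proof.
move=> u cu.
have [a aP] : exists l, forall e : R, 0 < e -> exists N, forall n, (N <= n)%N ->
     (Re (u n : R[i]) - l) ^+ 2 < e.
  apply: cauchy_real_converges => e e0; have [N NP] := cu e e0; exists N => m n Nm Nn.
  apply: le_lt_trans (NP m n Nm Nn); rewrite scalar_sqnE.
  by apply: le_trans (Re_le_normsq _); rewrite ReD ReN.
have [b bP] : exists l, forall e : R, 0 < e -> exists N, forall n, (N <= n)%N ->
     (Im (u n : R[i]) - l) ^+ 2 < e.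
  apply: cauchy_real_converges => e e0; have [N NP] := cu e e0; exists N => m n Nm Nn.
  apply: le_lt_trans (NP m n Nm Nn); rewrite scalar_sqnE /normsq.
  by rewrite [X in _ + X ^+ 2]ImD; case: (u n : R[i]) => x y /=; rewrite lerDr sqr_ge0.
exists ((a +i* b)%C : R[i]) => e e0; have e2 : 0 < e / 2 by rewrite divr_gt0.
have [N NP] := aP _ e2; have [M MP] := bP _ e2.
exists (maxn N M) => n; rewrite geq_max => /andP[Nn Mn].
have := NP n Nn; have := MP n Mn; rewrite scalar_sqnE /normsq ReD ImD.
case: (u n : R[i]) => x y /=; lra.
Qed.

Lemma normc_lt (z : R[i]) (e : R) : 0 < e -> (`|z| < e%:C%C) = (normsq z < e ^+ 2).
Proof.
move=> e0; rewrite -(ltr_pXn2r (n := 2))// ?nnegrE ?normr_ge0//; last first.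
  by rewrite lecR ltW.
by rewrite normCK mulcJ -rmorphXn /= ltcR.
Qed.

Lemma normc_le (z : R[i]) (e : R) : 0 <= e -> (`|z| <= e%:C%C) = (normsq z <= e ^+ 2).
Proof.
move=> e0; rewrite -(ler_pXn2r (n := 2))// ?nnegrE ?normr_ge0//; last first.
  by rewrite lecR.
by rewrite normCK mulcJ -rmorphXn /= lecR.
Qed.

End complete_spaces.

(** * Operators with a bounded matrix *)

Section operator_matrices.
Variables (R : realType) (I : choiceType) (K : innerProductSpace R).
Hypothesis cK : hilbert K.

Variables (m m' : I -> I -> K -> K) (C : R).
Hypothesis C0 : 0 <= C.
Hypothesis mm' : forall i j, is_adjoint (m i j) (m' i j).
Hypothesis m_bounded : forall (s t : seq I) (x y : I -> K), uniq s -> uniq t ->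
  normsq (\sum_(i <- s) \sum_(j <- t) '[m i j (x j), y i]) <=
  C * (\sum_(j <- t) sqn (x j)) * (\sum_(i <- s) sqn (y i)).

Lemma adjoint_entry_linear i j : linear (m' i j).
Proof.
move=> a x y; apply: dot_ext => z.
by rewrite dotDl dotZl !(is_adjoint_sym (mm' i j)) dotDl dotZl.
Qed.

Lemma adjoint_matrix_on_finite s (y : I -> K) : uniq s ->
  exists r : l2 I K, coord r = (fun j => \sum_(i <- s) m' i j (y i)) /\
    sqn r <= C * \sum_(i <- s) sqn (y i).
Proof.
move=> us; apply: l2_exists => t ut.
set Y := \sum_(i <- s) _; set x := fun j => \sum_(i <- s) m' i j (y i).
set X := \sum_(j <- t) _.
have X0 : 0 <= X by apply: sumr_ge0 => j _; exact: sqn_ge0.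
have Y0 : 0 <= Y by apply: sumr_ge0 => j _; exact: sqn_ge0.
have : normsq X%:C%C <= C * X * Y.
  rewrite (_ : X%:C%C = \sum_(i <- s) \sum_(j <- t) '[m i j (x j), y i]).
    exact: m_bounded.
  rewrite exchange_big /= /X rmorph_sum /=; apply: eq_bigr => j _.
  rewrite -[X in sqn X]/(x j) -dot_sqn {2}/x dot_sumr; apply: eq_bigr => i _.
  by rewrite mm'.
rewrite normsq_real leNgt => h; rewrite leNgt; apply: contra h => h.
have Xp : 0 < X by apply: le_lt_trans h; exact: mulr_ge0.
by rewrite mulrAC expr2 ltr_pM2r.
Qed.

(** Coordinate [i] of [T xi] is the Riesz vector of the functional
    [v => '[r i v, xi]], where [r i v] is the image of [single i v] by the adjoint
    matrix, square-summable by [adjoint_matrix_on_finite]. This defines [T] on all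
    vectors at once, with no extension from finitely supported ones. *)
Lemma matrix_operator : exists T : l2 I K -> l2 I K, bounded_operators T /\
  forall i j u, coord (T (single j u)) i = m i j u.
Proof.
have hr i : forall v, exists r : l2 I K, coord r = (fun j => m' i j v) /\
    sqn r <= C * sqn v.
  move=> v; have [r [rE rC]] := @adjoint_matrix_on_finite [:: i] (fun=> v) isT.
  by exists r; rewrite rE; rewrite big_seq1 in rC; split=> //; apply/funext => j;
    rewrite big_seq1.
have /choice[r rP] : forall i, exists r : K -> l2 I K, forall v,
    coord (r v) = (fun j => m' i j v) /\ sqn (r v) <= C * sqn v.
  by move=> i; have [f fP] := choice (hr i); exists f.
have rlin i : linear_for *:%R (r i).
  move=> a u v; apply: coord_ext => j; rewrite coordD coordZ !(rP i _).1.
  exact: adjoint_entry_linear.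
have tP xi i : exists z, forall v, '[z, v] = '[xi, r i v].
  have [|z zP] := @riesz R K (fun v => '[r i v, xi]) cK.
    split; first by move=> a u v; rewrite rlin dotDl dotZl.
    exists (C * sqn xi) => v; apply: le_trans (dot_normsq_le _ _) _.
    by rewrite mulrAC ler_wpM2r ?sqn_ge0//; exact: (rP i v).2.
  by exists z => v; rewrite dotC -zP -dotC.
have {tP} /choice[t tP] : forall xi, exists t : I -> K,
    forall i v, '[t i, v] = '[xi, r i v].
  by move=> xi; have [f fP] := choice (tP xi); exists f.
have tC xi s : uniq s -> \sum_(i <- s) sqn (t xi i) <= C * sqn xi.
  move=> us; have [rho [rhoE rhoC]] := @adjoint_matrix_on_finite s (t xi) us.
  have rhoS : rho = \sum_(i <- s) r i (t xi i).
    apply: coord_ext => j; rewrite rhoE.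
    rewrite (big_morph (fun x => coord x j) (id1 := 0) (op1 := +%R))//.
    by apply: eq_bigr => i _; rewrite (rP i _).1.
  set W := \sum_(i <- s) _ in rhoC *.
  have W0 : 0 <= W by apply: sumr_ge0 => j _; exact: sqn_ge0.
  have WE : W%:C%C = '[xi, rho].
    rewrite rhoS dot_sumr /W rmorph_sum /=; apply: eq_bigr => i _.
    by rewrite -tP -dot_sqn.
  have := dot_normsq_le xi rho; rewrite -WE normsq_real => h.
  rewrite leNgt; apply/negP => lt.
  have Wp : 0 < W by apply: le_lt_trans lt; rewrite mulr_ge0 ?sqn_ge0.
  have := le_trans h (ler_wpM2l (sqn_ge0 xi) rhoC).
  by rewrite mulrA expr2 ler_pM2r// mulrC leNgt lt.
have /choice[T TP] : forall xi, exists z : l2 I K, coord z = t xi /\ sqn z <= C * sqn xi.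
  by move=> xi; apply: l2_exists; exact: tC.
exists T; split.
  apply/bounded_operatorsP; split; last by exists C => // xi; exact: (TP xi).2.
  move=> a u v; apply: coord_ext => i; apply: dot_ext => w.
  by rewrite coordD coordZ !(TP _).1 dotDl dotZl !tP dotDl dotZl.
move=> i j u; apply: dot_ext => v; rewrite (TP _).1 tP single_dot (rP i v).1.
by rewrite mm'.
Qed.

End operator_matrices.

(** * Commutants and the bicommutant theorem *)

Section von_Neumann_algebras.
Variables (R : realType) (H : innerProductSpace R).
Implicit Types (S T : H -> H) (A D G : set (H -> H)).

Lemma commutant_vN_subalgebra A : A `<=` bounded_operators (H := H) ->
  (forall S, A S -> exists2 S', A S' & is_adjoint S S') ->
  vN_subalgebra (commutant A).
Proof.
move=> Ab Aadj; split; first split.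
- by move=> T [].
- by split; [exact: bounded_id|].
- move=> a S T [Sb Sc] [Tb Tc]; split; first exact: bounded_lin.
  move=> X AX; apply/funext => x /=; have [Xl _] := Ab _ AX.
  have /(congr1 (@^~ x))/= -> := Sc X AX.
  have /(congr1 (@^~ x))/= -> := Tc X AX.
  by rewrite Xl.
- move=> S T [Sb Sc] [Tb Tc]; split; first exact: bounded_comp.
  by move=> X AX; rewrite -compA Tc// compA Sc.
- move=> T S [Tb Tc] TS; split; first exact: adjoint_bounded TS Tb.
  move=> X AX; have [Y AY XY] := Aadj X AX; apply/funext => x /=.
  have ST := is_adjoint_sym TS.
  apply: dot_ext => z; rewrite ST XY XY ST.
  by have /(congr1 (@^~ z))/= -> := Tc Y AY.
move=> T Tb hT; split=> // X AX; have [Y AY XY] := Aadj X AX.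
apply/funext => x; apply: dot_ext => z /=; rewrite XY.
apply/eqP; rewrite -subr_eq0; apply/eqP/normsq_eq0/eqP.
rewrite eq_le normsq_ge0 andbT; apply/ler_addgt0Pr => e e0; rewrite add0r.
have d0 : 0 < Num.sqrt (e / 4) by rewrite sqrtr_gt0 divr_gt0.
(* two weak conditions compare [T (X x)] and [X (T x)] with [S (X x) = X (S x)] *)
pose xi (i : 'I_2) := if i == ord0 then X x else x.
pose eta (i : 'I_2) := if i == ord0 then z else Y z.
have [S [Sb Sc] hS] := hT 2%N xi eta _ d0.
have := hS ord0; have := hS (lift ord0 ord0).
rewrite !normc_lt// sqr_sqrtr ?divr_ge0 ?(ltW e0)//= /xi /eta /=.
have -> : '[S (X x), z] = '[S x, Y z].
  by have /(congr1 (@^~ x))/= -> := Sc X AX; rewrite XY.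
set a := '[T x, _]; set b := '[T (X x), _]; set c := '[S x, _].
rewrite (_ : b - a = (b - c) - (a - c)); last by rewrite opprB addrA subrK.
move: (a - c) (b - c) => [a1 a2] [b1 b2]; rewrite /normsq /=.
have := sqr_ge0 (a1 + b1); have := sqr_ge0 (a2 + b2); nra.
Qed.

Lemma vN_generated_inter A G : vN_subalgebra A ->
  vN_subalgebra (A `&` vN_generated G).
Proof.
move=> [[A1 A2 A3 A4 A5] Aw]; split; first split.
- by move=> T [/A1].
- by split=> // D [[[]]].
- move=> a S T [AS GS] [AT GT]; split; first exact: A3.
  by move=> D DG; have [[[_ _ + _ _] _] _] := DG; apply; [exact: GS|exact: GT].
- move=> S T [AS GS] [AT GT]; split; first exact: A4.
  by move=> D DG; have [[[_ _ _ + _] _] _] := DG; apply; [exact: GS|exact: GT].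
- move=> T S [AT GT] TS; split; first exact: A5 TS.
  by move=> D DG; have [[[_ _ _ _ h] _] _] := DG; apply: h TS; exact: GT.
move=> T Tb hT; split.
  by apply: Aw => // n xi eta e /(hT n xi eta)[S [AS _] h]; exists S.
move=> D DG; have [[_ Dw] _] := DG.
by apply: Dw => // n xi eta e /(hT n xi eta)[S [_ GS] h]; exists S => //; exact: GS.
Qed.

End von_Neumann_algebras.

Section projection_operators.
Variables (R : realType) (H : innerProductSpace R).

Lemma adherent_lin (K : set H) a x y : subspace K -> adherent K x -> adherent K y ->
  adherent K (a *: x + y).
Proof.
move=> [_ KD] Kx Ky e e0.
have n0 := normsq_ge0 a.
have [x' Kx' xx'] := Kx (e / 4 / (normsq a + 1)) (divr_gt0 (divr_gt0 e0 (ltr0Sn _ _)) (ltr_wpDl n0 ltr01)).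
have [y' Ky' yy'] := Ky (e / 4) (divr_gt0 e0 (ltr0Sn _ _)).
exists (a *: x' + y'); first exact: KD.
rewrite opprD addrACA -scalerBr; apply: le_lt_trans (sqn_addle _ _) _.
rewrite sqn_scale mulr2n; rewrite ltr_pdivlMr in xx'; last by lra.
have := sqn_ge0 (x - x'); nra.
Qed.

Lemma orth_adherent (K : set H) w z : (forall y, K y -> '[w, y] = 0) ->
  adherent K z -> '[w, z] = 0.
Proof.
move=> wK Kz; apply/normsq_eq0/eqP; rewrite eq_le normsq_ge0 andbT.
apply/ler_addgt0Pr => e e0; rewrite add0r.
have w0 := sqn_ge0 w.
have [y Ky yz] := Kz (e / (sqn w + 1)) (divr_gt0 e0 (ltr_wpDl w0 ltr01)).
have -> : '[w, z] = '[w, z - y] by rewrite dotBr (wK y)// subr0.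
apply: le_trans (dot_normsq_le _ _) _.
rewrite ltr_pdivlMr in yz; last by lra.
have := sqn_ge0 (z - y); nra.
Qed.

Lemma projection_operator (K : set H) : hilbert H -> subspace K ->
  exists p : H -> H, [/\ bounded_operators p, forall x, adherent K (p x)
    & forall x z, adherent K z -> (forall y, K y -> '[x - z, y] = 0) -> p x = z].
Proof.
move=> cH sK; have /choice[p pP] := orthogonal_projection cH sK.
have unique x z : adherent K z -> (forall y, K y -> '[x - z, y] = 0) -> p x = z.
  move=> Kz xz; have [Kp xp] := pP x.
  apply/eqP; rewrite -subr_eq0; apply/eqP/sqn_eq0.
  rewrite /sqn (@orth_adherent K)//.
    move=> y Ky; rewrite (_ : p x - z = (x - z) - (x - p x)).
      by rewrite dotBl xz// xp// subrr.
    by rewrite opprB [RHS]addrC addrA subrK.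
  by rewrite addrC -scaleN1r; apply: adherent_lin.
exists p; split=> //; last by move=> x; exact: (pP x).1.
apply/bounded_operatorsP; split.
  move=> a x y; apply: unique.
    by apply: adherent_lin => //; [exact: (pP x).1|exact: (pP y).1].
  move=> z Kz; rewrite opprD addrACA -scalerBr dotDl dotZl.
  by rewrite (pP x).2// (pP y).2// mulr0 addr0.
exists 1 => // x; rewrite mul1r -[x in leRHS](subrK (p x)) sqnD.
rewrite (@orth_adherent K _ (p x)); [|exact: (pP x).2|exact: (pP x).1].
by rewrite mul0rn addr0 lerDr sqn_ge0.
Qed.

End projection_operators.

Section bicommutant.
Variables (R : realType) (H : innerProductSpace R).
Implicit Types (S T : H -> H) (D : set (H -> H)).

Lemma l2_fin n (f : 'I_n -> H) : exists x : l2 'I_n H, coord x = f.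
Proof.
have [s us|x [xf _]] := @l2_exists R 'I_n H f (\sum_i sqn (f i)); last by exists x.
rewrite big_uniq//= [leRHS](bigID (mem s))/= lerDl.
by apply: sumr_ge0 => i _; exact: sqn_ge0.
Qed.

Lemma l2_fin_sum n (x : l2 'I_n H) : x = \sum_j single j (coord x j).
Proof.
apply: coord_ext => i; rewrite (big_morph (fun x => coord x i) (id1 := 0) (op1 := +%R))//.
rewrite (bigD1 i)//= coord_single eqxx big1 ?addr0// => j ji.
by rewrite coord_single eq_sym (negPf ji).
Qed.

Lemma l2_fin_sqn_le n (x : l2 'I_n H) (C : R) :
  (forall i, sqn (coord x i) <= C) -> 0 <= C -> sqn x <= n%:R * C.
Proof.
move=> h C0; rewrite l2_sqnE.
have [|//] := @rsum_le_bound R 'I_n (fun i => sqn (coord x i)) (n%:R * C) (fun i => sqn_ge0 _).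
move=> s us; apply: (@le_trans _ _ (\sum_(i <- s) C)); first exact: ler_sum.
rewrite big_const_seq count_predT iter_addr_0 -[leLHS]mulr_natl ler_wpM2r// ler_nat.
by rewrite -(card_uniqP us) -[X in (_ <= X)%N]card_ord max_card.
Qed.

(** A weak neighbourhood of [T] involves finitely many vectors [xi i], the coordinates
    of one vector [x] of the sum of [n] copies of [H]. The projection [p] onto the
    closure of the orbit [K] of [x] under [D], acting diagonally, commutes with this
    action; its matrix entries are therefore in the commutant of [D], so [T] acting
    diagonally commutes with [p] too. Hence the image of [x] by [T] is adherent
    to [K]. *)
Lemma bicommutant D T : hilbert H -> vN_subalgebra D -> bounded_operators T ->
  (forall S, commutant D S -> forall x, T (S x) = S (T x)) -> D T.
Proof.
move=> cH [[Db D1 Dlin Dmul Dadj] Dw] Tb TD.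
apply: Dw => // n xi eta e e0.
pose L := l2 'I_n H.
have cL : hilbert L by exact: l2_hilbert.
have /choice[tup tupE] : forall f : 'I_n -> H, exists x : L, coord x = f.
  exact: l2_fin.
pose amp S (x : L) : L := tup (fun i => S (coord x i)).
have ampE S x i : coord (amp S x) i = S (coord x i) by rewrite /amp tupE.
pose K : set L := [set x | exists2 S, D S & forall i, coord x i = S (xi i)].
have sK : subspace K.
  split.
    exists (fun x => (-1) *: (idfun x) + idfun x); first exact: Dlin.
    by move=> i; rewrite /= scaleN1r addNr.
  move=> a x y [S DS Sx] [S' DS' S'y]; exists (fun x => a *: S x + S' x).
    exact: Dlin.
  by move=> i; rewrite coordD coordZ Sx S'y.
have [p [pb pK unique]] := projection_operator cL sK.
have [pl _] := pb.
have ampadj S S' : is_adjoint S S' -> is_adjoint (amp S) (amp S').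
  move=> SS' x y; rewrite !l2_dotE; congr csum; apply/funext => i.
  by rewrite !ampE SS'.
have pdiff x y : K y -> '[x - p x, y] = 0.
  have [q [Kq xq]] := orthogonal_projection cL sK x.
  by rewrite (unique x q Kq xq); exact: xq.
have pamp S x : D S -> p (amp S x) = amp S (p x).
  move=> DS; have Sb := Db _ DS; have [Sl [C C0 SC]] := iffLR (bounded_operatorsP _) Sb.
  have KS y : K y -> K (amp S y).
    move=> [X DX Xy]; exists (S \o X); first exact: Dmul.
    by move=> i; rewrite ampE Xy.
  have ampB y z : amp S (y - z) = amp S y - amp S z.
    by apply: coord_ext => i; rewrite coordB !ampE coordB linear_opB.
  apply: unique.
    move=> d d0.
    have nC0 : 0 <= n%:R * C by rewrite mulr_ge0.
    have [|y Ky yd] := pK x (d / (n%:R * C + 1)).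
      by rewrite divr_gt0// ltr_wpDl.
    exists (amp S y); first exact: KS.
    rewrite -ampB; apply: (@le_lt_trans _ _ (n%:R * (C * sqn (p x - y)))).
      apply: l2_fin_sqn_le; last by rewrite mulr_ge0 ?sqn_ge0.
      move=> i; rewrite ampE; apply: le_trans (SC _) _.
      by rewrite ler_wpM2l// sqn_coord_le.
    rewrite ltr_pdivlMr in yd; last by rewrite ltr_wpDl.
    have := sqn_ge0 (p x - y); rewrite mulrA; nra.
  move=> y [X DX Xy].
  have [S' SS'] := adjoint_exists cH Sb.
  rewrite -ampB (ampadj _ _ SS'); apply: pdiff.
  exists (S' \o X); first by apply: Dmul => //; exact: Dadj SS'.
  by move=> i; rewrite ampE Xy.
pose P i j v := coord (p (single j v)) i.
have Pcomm i j : commutant D (P i j).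
  split.
    have [_ [C C0 pC]] := iffLR (bounded_operatorsP _) pb.
    apply/bounded_operatorsP; split.
      by move=> a u v; rewrite /P single_linear pl.
    exists C => // v; apply: le_trans (sqn_coord_le _ _) _.
    by apply: le_trans (pC _) _; rewrite sqn_single.
  move=> S DS; apply/funext => v /=; rewrite -ampE -pamp//; congr (coord (p _) i).
  apply: coord_ext => k; rewrite ampE !coord_single; case: eqP => // _.
  by have [Sl _] := Db _ DS; rewrite linear_op0.
have pT x : p (amp T x) = amp T (p x).
  apply: coord_ext => i; rewrite ampE [in LHS](l2_fin_sum (amp T x)).
  rewrite [in RHS](l2_fin_sum x) !(linear_op_sum _ _ _ pl).
  rewrite !(big_morph (fun x => coord x i) (id1 := 0) (op1 := +%R))//.
  rewrite (linear_op_sum _ _ _ (bounded_linear Tb)); apply: eq_bigr => j _.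
  by rewrite ampE; exact: (esym (TD _ (Pcomm i j) (coord x j))).
have [x xE] : exists x : L, coord x = xi by exact: l2_fin.
have px : p x = x.
  apply: unique; last by move=> y _; rewrite subrr dot0l.
  move=> d d0; exists x; first by exists idfun => // i; rewrite xE.
  by rewrite subrr sqn0.
pose s := \sum_i sqn (eta i).
have s0 : 0 <= s by apply: sumr_ge0 => i _; exact: sqn_ge0.
have [|y [S DS Sy] yd] := pK (amp T x) (e ^+ 2 / (s + 1)).
  by rewrite divr_gt0 ?exprn_gt0// ltr_wpDl.
exists S => // i; rewrite normc_lt// -dotBl.
apply: le_lt_trans (dot_normsq_le _ _) _.
rewrite pT px ltr_pdivlMr in yd; last by rewrite ltr_wpDl.
apply: le_lt_trans yd.
have -> : T (xi i) - S (xi i) = coord (amp T x - y) i.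
  by rewrite coordB ampE Sy xE.
rewrite ler_pM ?sqn_ge0 ?sqn_coord_le//.
apply: (@le_trans _ _ s); last by lra.
by rewrite /s (bigD1 i)//= lerDl sumr_ge0// => j _; exact: sqn_ge0.
Qed.

End bicommutant.

(** * Completeness of L2 *)

Section real_L2_completeness.
Context d (T : measurableType d) (R : realType) (mu : probability T R).

Lemma Lfun2P (f : T -> R) : f \in Lfun mu 2%:E <->
  measurable_fun setT f /\ (\int[mu]_x (f x ^+ 2)%:E < +oo)%E.
Proof.
split=> [lf|[mf fi]].
  have mf : measurable_fun setT f by move: lf => /[!inE] /andP[/[!inE]/= mf _].
  split=> //; exact: integrable_lty (Lfun2_integrable_sqr lf).
apply/andP; split; first by rewrite inE.
rewrite inE /= /finite_norm unlock /= poweR_lty//.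
rewrite (eq_integral (fun x => (f x ^+ 2)%:E))// => x _.
by rewrite /= powR_mulrn// real_normK ?num_real.
Qed.

(** With [c = 2 ^ k.+1], the bound [`|t| <= c / 2 * t ^+ 2 + c^-1 / 2] shows that the
    integrals of the [`|g k x|] are at most [c^-1], so their sum is integrable. *)
Lemma fast_cauchy_cvg (g : nat -> T -> R) : (forall k, measurable_fun setT (g k)) ->
  (forall k, (\int[mu]_x (g k x ^+ 2)%:E <= ((2 ^ k.+1)%:R^-1 ^+ 2)%:E)%E) ->
  {ae mu, forall x, cvgn (series (fun k => g k x))}.
Proof.
move=> mg gc.
have mng k : measurable_fun setT (EFin \o (fun x => `|g k x| : R)).
  by apply/measurable_EFinP; exact: measurableT_comp.
have i1 k : (\int[mu]_x `|g k x|%:E <= (1 / (2 ^ k.+1)%:R)%:E)%E.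
  set c : R := (2 ^ k.+1)%:R; have c0 : 0 < c by rewrite ltr0n expn_gt0.
  apply: (@le_trans _ _ (\int[mu]_x ((c / 2)%:E * (g k x ^+ 2)%:E + (c^-1 / 2)%:E))%E).
    apply: ge0_le_integral => //.
    - exact: mng.
    - apply: emeasurable_funD => //; apply: measurable_funeM.
      by apply/measurable_EFinP; exact: measurable_funX.
    - move=> x _; rewrite -EFinM -EFinD lee_fin -[g k x ^+ 2]real_normK ?num_real//.
      have cV : c * c^-1 = 1 by rewrite divff ?gt_eqF.
      have := sqr_ge0 (c * `|g k x| - 1); move: (`|g k x|) (c^-1) cV => a b cV h.
      rewrite -(ler_pM2l c0); nra.
  have c2 : 0 <= c / 2 by rewrite mulr_ge0 ?ltW.
  have c3 : 0 <= c^-1 / 2 by rewrite mulr_ge0 ?invr_ge0 ?ltW.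
  have msq : measurable_fun setT (EFin \o (fun x => g k x ^+ 2 : R)).
    by apply/measurable_EFinP; exact: measurable_funX.
  have sq0 x : setT x -> (0 <= (g k x ^+ 2)%:E)%E by move=> _; rewrite lee_fin sqr_ge0.
  rewrite ge0_integralD//; last 2 first.
  - by move=> x _; rewrite -EFinM lee_fin mulr_ge0 ?sqr_ge0.
  - exact: measurable_funeM.
  rewrite ge0_integralZl//.
  rewrite integral_cst// [X in (_ + _ * X <= _)%E](_ : _ = 1%E) ?mule1; last exact: probability_setT.
  apply: (@le_trans _ _ ((c / 2)%:E * (c^-1 ^+ 2)%:E + (c^-1 / 2)%:E)%E).
    by rewrite leeD2r// lee_wpmul2l// lee_fin mulr_ge0 ?ltW.
  rewrite -EFinM -EFinD lee_fin div1r.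
  have -> : c / 2 * c^-1 ^+ 2 = c^-1 / 2 by field; rewrite gt_eqF.
  lra.
have int : mu.-integrable setT (fun x => \sum_(k <oo) `|g k x|%:E)%E.
  apply/integrableP; split.
    by apply: (@ge0_emeasurable_sum _ _ _ _ (fun k x => `|g k x|%:E) xpredT) => // k _; exact: mng.
  under eq_integral => x _ do rewrite gee0_abs ?nneseries_ge0//.
  rewrite integral_nneseries//; apply: (@le_lt_trans _ _ 1%:E); last exact: ltry.
  apply: le_trans (@epsilon_trick0 R 1 xpredT ler01).
  apply: lee_nneseries => [k _ _|k _]; [exact: integral_ge0|exact: i1].
apply: filterS (integrable_ae measurableT int) => x /(_ I) fx.
apply: normed_cvg; apply: nondecreasing_is_cvgn.
  by apply: nondecreasing_series => k _ _; exact: normr_ge0.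
exists (fine (\sum_(k <oo) `|g k x|%:E)%E) => _ [n _ <-].
rewrite -lee_fin fineK//= -sumEFin.
by apply: nneseries_lim_ge.
Qed.

(** A fast Cauchy subsequence converges almost everywhere, and Fatou's lemma passes the
    Cauchy bound to the limit. An upper limit is used to define a function that is
    measurable and everywhere defined. *)
Lemma real_L2_complete (f : nat -> T -> R) : (forall n, measurable_fun setT (f n)) ->
  (forall e : R, 0 < e -> exists N, forall m n, (N <= m)%N -> (N <= n)%N ->
     (\int[mu]_x ((f m x - f n x) ^+ 2)%:E <= e%:E)%E) ->
  exists2 l : T -> R, measurable_fun setT l & forall e : R, 0 < e -> exists N, forall n,
    (N <= n)%N -> (\int[mu]_x ((f n x - l x) ^+ 2)%:E <= e%:E)%E.
Proof.
move=> mf cf.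
have /choice[s0 s0P] : forall k : nat, exists N, forall m n, (N <= m)%N -> (N <= n)%N ->
     (\int[mu]_x ((f m x - f n x) ^+ 2)%:E <= ((2 ^ k.+1)%:R^-1 ^+ 2)%:E)%E.
  by move=> k; apply: cf; rewrite exprn_gt0// invr_gt0 ltr0n expn_gt0.
pose s := fix s k := if k is k'.+1 then maxn (s k') (maxn (s0 k) k) else s0 0%N.
have sS k : (s k <= s k.+1)%N by rewrite /= leq_maxl.
have ss0 k : (s0 k <= s k)%N.
  by case: k => [|k]//=; rewrite leq_max leq_maxl orbT.
have sk k : (k <= s k)%N.
  by case: k => [|k]//=; rewrite !leq_max leqnn !orbT.
pose g k x := f (s k.+1) x - f (s k) x.
have mg k : measurable_fun setT (g k) by exact: measurable_funB.
have gc : {ae mu, forall x, cvgn (series (fun k => g k x))}.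
  apply: fast_cauchy_cvg => // k.
  by apply: s0P; [exact: leq_trans (ss0 k) (sS k)|exact: ss0].
pose l x := fine (limn_esup (fun k => (f (s k) x)%:E)).
have ml : measurable_fun setT l.
  apply: measurableT_comp => //; apply: measurable_fun_limn_esup => // k.
  exact/measurable_EFinP.
exists l => // e e0; have [N NP] := cf e e0; exists N => n Nn.
have mh k : measurable_fun setT (EFin \o (fun x => (f n x - f (s k) x) ^+ 2 : R)).
  by apply/measurable_EFinP; apply: measurable_funX; exact: measurable_funB.
apply: (@le_trans _ _ (\int[mu]_x limn_einf (fun k => ((f n x - f (s k) x) ^+ 2)%:E))%E).
  apply: ae_ge0_le_integral => //.
  - by move=> x _; rewrite lee_fin sqr_ge0.
  - by apply/measurable_EFinP; apply: measurable_funX; exact: measurable_funB.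
  - move=> x _; rewrite limn_einf_lim; apply: lime_ge; first exact: is_cvg_einfs.
    by apply: nearW => k; apply: le_ereal_inf_tmp => _ [m _ <-]; rewrite lee_fin sqr_ge0.
  - rewrite [X in measurable_fun _ X](_ : _ =
      \- (fun x => limn_esup (fun k => - ((f n x - f (s k) x) ^+ 2)%:E)))%E.
      apply: measurableT_comp => //; apply: measurable_fun_limn_esup => // k.
      by apply: measurableT_comp => //; exact: mh.
    by apply/funext => x; rewrite /= -limn_einfN; congr limn_einf;
      apply/funext => k; rewrite /= opprK.
  apply: filterS gc => x gx _.
  have fl : (fun k => f (s k) x) @ \oo --> l x.
    have cl : cvgn (fun k => f (s k) x).
      rewrite (_ : (fun k => _) = (fun k => f (s 0%N) x + series (fun k => g k x) k)).
        by apply: is_cvgD; [exact: is_cvg_cst|].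
      apply/funext => k; rewrite /series /= /g.
      by rewrite (telescope_sumr (fun k => f (s k) x))// addrC subrK.
    have he : (fun k => (f (s k) x)%:E) @ \oo --> (limn (fun k => f (s k) x))%:E.
      by apply: cvg_EFin; [exact: nearW|exact: cl].
    rewrite (_ : l x = limn (fun k => f (s k) x))// /l is_cvg_limn_esupE.
      by rewrite (cvg_lim _ he).
    by apply/cvg_ex; eexists; exact: he.
  rewrite (_ : limn_einf _ = ((f n x - l x) ^+ 2)%:E)//.
  have h : (fun k => ((f n x - f (s k) x) ^+ 2)%:E) @ \oo --> ((f n x - l x) ^+ 2)%:E.
    have hb : (fun k => f n x - f (s k) x) @ \oo --> f n x - l x.
      by apply: cvgB => //; exact: cvg_cst.
    by apply: cvg_EFin; [exact: nearW|exact: (cvgM hb hb)].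
  by rewrite is_cvg_limn_einfE; [exact/cvg_lim|apply/cvg_ex; eexists; exact: h].
apply: le_trans (fatou mu measurableT mh _) _.
  by move=> k x _; rewrite lee_fin sqr_ge0.
rewrite limn_einf_lim; apply: lime_le; first exact: is_cvg_einfs.
near=> k.
apply: (@le_trans _ _ (\int[mu]_x ((f n x - f (s k) x) ^+ 2)%:E)%E).
  by apply: ereal_inf_lbound; exists k => /=.
apply: NP => //; apply: leq_trans (sk k).
by near: k; exact: nbhs_infty_ge.
Unshelve. all: by end_near. Qed.
End real_L2_completeness.

(** * Complex-valued integrals and multiplication operators *)

Section complex_integrals.
Context d (B : measurableType d) (R : realType) (nu : probability B R).
Implicit Types (f g : B -> R[i]) (z w : R[i]).

Lemma cmeasurableD f g : cmeasurable f -> cmeasurable g ->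
  cmeasurable (fun b => f b + g b).
Proof.
move=> [f1 f2] [g1 g2]; split.
  rewrite (_ : _ \o _ = (@Re R \o f) \+ (@Re R \o g)); first exact: measurable_funD.
  by apply/funext => b /=; rewrite ReD.
rewrite (_ : _ \o _ = (@Im R \o f) \+ (@Im R \o g)); first exact: measurable_funD.
by apply/funext => b /=; rewrite ImD.
Qed.

Lemma cmeasurableM f g : cmeasurable f -> cmeasurable g ->
  cmeasurable (fun b => f b * g b).
Proof.
move=> [f1 f2] [g1 g2]; split.
  rewrite (_ : _ \o _ = ((@Re R \o f) \* (@Re R \o g)) \- ((@Im R \o f) \* (@Im R \o g))).
    by apply: measurable_funB; exact: measurable_funM.
  by apply/funext => b /=; rewrite ReM.
rewrite (_ : _ \o _ = ((@Re R \o f) \* (@Im R \o g)) \+ ((@Im R \o f) \* (@Re R \o g))).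
  by apply: measurable_funD; exact: measurable_funM.
by apply/funext => b /=; rewrite ImM.
Qed.

Lemma cmeasurable_cst z : cmeasurable (fun _ : B => z).
Proof. by split; exact: measurable_cst. Qed.

Lemma cmeasurableJ f : cmeasurable f -> cmeasurable (fun b => Num.conj (f b)).
Proof.
move=> [f1 f2]; split.
  by rewrite (_ : _ \o _ = @Re R \o f)//; apply/funext => b /=; rewrite ReJ.
rewrite (_ : _ \o _ = \- (@Im R \o f)); first exact: measurableT_comp.
by apply/funext => b /=; rewrite ImJ.
Qed.

Lemma cmeasurable_real (f : B -> R) : measurable_fun setT f ->
  cmeasurable (fun b => (f b)%:C%C).
Proof. by move=> mf; split => //; exact: measurable_cst. Qed.

Lemma measurable_normsq f : cmeasurable f -> measurable_fun setT (fun b => normsq (f b)).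
Proof. by move=> [f1 f2]; apply: measurable_funD; exact: measurable_funX. Qed.

Lemma cmeasurable_comp f (h : B -> B) : measurable_fun setT h -> cmeasurable f ->
  cmeasurable (f \o h).
Proof.
by move=> mh [f1 f2]; split;
  [exact: (measurableT_comp f1 mh)|exact: (measurableT_comp f2 mh)].
Qed.

(** The value is carried along with integrability, which makes the two facts
    propagate together through sums. *)
Definition has_cintegral f z := cintegrable nu f /\ cRintegral nu f = z.

Lemma has_cintegral_measurable f z : has_cintegral f z -> cmeasurable f.
Proof.
by move=> [[i1 i2] _]; split; apply/measurable_EFinP; apply: measurable_int;
  [exact: i1|exact: i2].
Qed.

Lemma has_cintegral0 : has_cintegral (fun=> 0) 0.
Proof.
split; last by apply: complex_ext => /=; rewrite Rintegral_cst ?mul0r.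
by split; apply: (@eq_integrable _ _ _ _ _ measurableT (cst 0%E)) => //; exact: integrable0.
Qed.

Let integrable_lin (a b : R) (f g : B -> R) : nu.-integrable setT (EFin \o f) ->
  nu.-integrable setT (EFin \o g) ->
  nu.-integrable setT (EFin \o (fun x => a * f x + b * g x)).
Proof.
move=> fi gi.
have := integrableD measurableT (integrableZl measurableT a fi) (integrableZl measurableT b gi).
by apply: eq_integrable.
Qed.

Let Rintegral_lin (a b : R) (f g : B -> R) : nu.-integrable setT (EFin \o f) ->
  nu.-integrable setT (EFin \o g) ->
  \int[nu]_x (a * f x + b * g x) = a * \int[nu]_x f x + b * \int[nu]_x g x.
Proof.
move=> fi gi.
have Zi (c : R) (h : B -> R) : nu.-integrable setT (EFin \o h) ->
    nu.-integrable setT (EFin \o (fun x => c * h x)).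
  by move=> /(integrableZl measurableT c); apply: eq_integrable.
by rewrite RintegralD ?RintegralZl//; exact: Zi.
Qed.

Lemma has_cintegral_lin a f g z w : has_cintegral f z -> has_cintegral g w ->
  has_cintegral (fun b => a * f b + g b) (a * z + w).
Proof.
move=> [[f1 f2] <-] [[g1 g2] <-].
have E1 : (@Re R \o (fun b => a * f b + g b)) =
    (fun b => 1 * (Re a * Re (f b) + (- Im a) * Im (f b)) + 1 * Re (g b)).
  by apply/funext => b /=; rewrite ReD ReM !mul1r mulNr.
have E2 : (@Im R \o (fun b => a * f b + g b)) =
    (fun b => 1 * (Re a * Im (f b) + Im a * Re (f b)) + 1 * Im (g b)).
  by apply/funext => b /=; rewrite ImD ImM !mul1r.
split.
  by split; rewrite ?E1 ?E2; apply: integrable_lin => //; exact: integrable_lin.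
have cR h : Re (cRintegral nu h) = Rintegral nu setT (@Re R \o h) by [].
have cI h : Im (cRintegral nu h) = Rintegral nu setT (@Im R \o h) by [].
apply: complex_ext.
  rewrite ReD ReM !cR cI E1.
  rewrite Rintegral_lin//; last exact: integrable_lin.
  by rewrite Rintegral_lin// !mul1r mulNr.
rewrite ImD ImM !cI cR E2.
rewrite Rintegral_lin//; last exact: integrable_lin.
by rewrite Rintegral_lin// !mul1r.
Qed.

Lemma has_cintegralD f g z w : has_cintegral f z -> has_cintegral g w ->
  has_cintegral (fun b => f b + g b) (z + w).
Proof.
move=> fz gw; have := has_cintegral_lin 1 fz gw; rewrite mul1r.
by under eq_fun do rewrite mul1r.
Qed.

Lemma has_cintegralZ a f z : has_cintegral f z ->
  has_cintegral (fun b => a * f b) (a * z).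
Proof.
move=> fz; have := has_cintegral_lin a fz has_cintegral0; rewrite addr0.
by under eq_fun do rewrite addr0.
Qed.

Lemma has_cintegral_sum (I : Type) (s : seq I) (f : I -> B -> R[i]) (z : I -> R[i]) :
  (forall i, has_cintegral (f i) (z i)) ->
  has_cintegral (fun b => \sum_(i <- s) f i b) (\sum_(i <- s) z i).
Proof.
move=> fz; elim: s => [|i s IH].
  by rewrite big_nil; under eq_fun do rewrite big_nil; exact: has_cintegral0.
by rewrite big_cons; under eq_fun do rewrite big_cons; exact: has_cintegralD.
Qed.

Let integrable_ae (f g : B -> R) : measurable_fun setT g ->
  {ae nu, forall b, f b = g b} -> nu.-integrable setT (EFin \o f) ->
  nu.-integrable setT (EFin \o g) /\ \int[nu]_x f x = \int[nu]_x g x.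
Proof.
move=> mg fg /integrableP[mf fi].
have mg' : measurable_fun setT (EFin \o g) by exact/measurable_EFinP.
split.
  apply/integrableP; split=> //; apply: le_lt_trans fi.
  rewrite (@ae_eq_integral _ _ _ nu setT (abse \o (EFin \o f)))//.
  - exact: measurableT_comp.
  - exact: measurableT_comp.
  by apply: filterS fg => b /= ->.
by congr fine; apply: ae_eq_integral => //; apply: filterS fg => b /= ->.
Qed.

Lemma has_cintegral_ae f g z : cmeasurable g -> {ae nu, forall b, f b = g b} ->
  has_cintegral f z -> has_cintegral g z.
Proof.
move=> [g1 g2] fg [[f1 f2] <-].
have [|i1 e1] := integrable_ae g1 _ f1; first by apply: filterS fg => b /= ->.
have [|i2 e2] := integrable_ae g2 _ f2; first by apply: filterS fg => b /= ->.
by split=> //; apply: complex_ext; rewrite /cRintegral /= -?e1 -?e2.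
Qed.

Lemma has_cintegral_ge0 f z : has_cintegral f z ->
  {ae nu, forall b, 0 <= Re (f b)} -> 0 <= Re z.
Proof.
move=> [[f1 f2] <-] f0.
have mf : measurable_fun setT (@Re R \o f).
  by apply/measurable_EFinP; exact: measurable_int f1.
have mg : measurable_fun setT (fun b => Num.max (Re (f b)) 0).
  by apply: measurable_maxr => //; exact: measurable_cst.
have [|_ e] := integrable_ae mg _ f1.
  by apply: filterS f0 => b /= h; rewrite max_l.
by rewrite /cRintegral /= e; apply: Rintegral_ge0 => b _; rewrite le_max lexx orbT.
Qed.

Lemma has_cintegral_le f g z w : has_cintegral f z -> has_cintegral g w ->
  {ae nu, forall b, Re (f b) <= Re (g b)} -> Re z <= Re w.
Proof.
move=> fz gw fg; have := has_cintegral_lin (-1) fz gw.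
move=> /has_cintegral_ge0; rewrite mulN1r ReD ReN addrC subr_ge0; apply.
by apply: filterS fg => b h; rewrite mulN1r ReD ReN addrC subr_ge0.
Qed.

Lemma has_cintegral_eq0 f z : has_cintegral f z -> {ae nu, forall b, 0 <= Re (f b)} ->
  Re z = 0 -> {ae nu, forall b, Re (f b) = 0}.
Proof.
move=> [[f1 f2] <-] f0; rewrite /cRintegral /= => h0.
have mf : measurable_fun setT (EFin \o (@Re R \o f)) by exact: measurable_int f1.
have e : (\int[nu]_x `|(EFin \o (@Re R \o f)) x| = \int[nu]_x (Re (f x))%:E)%E.
  apply: ae_eq_integral => //; first exact: measurableT_comp.
  by apply: filterS f0 => b /= h _; rewrite ger0_norm.
have [+ _] := ae_eq_integral_abs nu measurableT mf.
rewrite e -[X in X = 0%E -> _]fineK; last exact: integrable_fin_num f1.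
rewrite [fine _]h0 => /(_ erefl) ae0.
by apply: filterS ae0 => b /(_ I) [].
Qed.

Lemma has_cintegral_normsq f z : has_cintegral (fun b => (normsq (f b))%:C%C) z ->
  (\int[nu]_b (normsq (f b))%:E)%E = (Re z)%:E.
Proof.
by move=> [[f1 _] <-]; rewrite /cRintegral /= fineK//; exact: integrable_fin_num f1.
Qed.

End complex_integrals.

Section L2_space.
Context d (B : measurableType d) (R : realType) (nu : probability B R).
Implicit Types (u v : L2 nu) (f g : B -> R[i]).

Definition rep u : B -> R[i] := repr (u : L2class nu).

Lemma rep_eq u v : u = v <-> {ae nu, forall b, rep u b = rep v b}.
Proof.
rewrite /rep -[X in X = _ <-> _](reprK (u : L2class nu)).
by rewrite -[X in _ = X <-> _](reprK (v : L2class nu)); exact: L2pi_eq.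
Qed.

Lemma rep_pi (f : L2fun nu) : {ae nu, forall b, rep (\pi_(L2class nu)%qT f) b = f b}.
Proof. exact: L2reprK. Qed.

Lemma repD u v : {ae nu, forall b, rep (u + v) b = rep u b + rep v b}.
Proof.
have piD (f g : L2fun nu) :
    (\pi_(L2class nu) (f + g) = \pi_(L2class nu) f + \pi_(L2class nu) g)%qT.
  by rewrite !piE.
have -> : u + v = (\pi_(L2class nu) (repr (u : L2class nu) + repr (v : L2class nu)))%qT.
  by rewrite piD !reprK.
exact: rep_pi.
Qed.

Lemma repZ a u : {ae nu, forall b, rep (a *: u) b = a * rep u b}.
Proof. exact: (rep_pi (a *: repr (u : L2class nu))). Qed.

Lemma rep_lin a u v : {ae nu, forall b, rep (a *: u + v) b = a * rep u b + rep v b}.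
Proof. by apply: filterS2 (repD (a *: u) v) (repZ a u) => b -> ->. Qed.

Lemma repB u v : {ae nu, forall b, rep (u - v) b = rep u b - rep v b}.
Proof.
rewrite addrC -scaleN1r; apply: filterS (rep_lin (-1) v u) => b ->.
by rewrite mulN1r addrC.
Qed.

Let rep_Lfun2 u : (@Re R \o rep u \in Lfun nu 2%:E) /\ (@Im R \o rep u \in Lfun nu 2%:E).
Proof. by have /andP[] := valP (repr (u : L2class nu)). Qed.

Lemma rep_measurable u : cmeasurable (rep u).
Proof. by have [/Lfun2P[h1 _] /Lfun2P[h2 _]] := rep_Lfun2 u. Qed.

Lemma has_cintegral_dot u v :
  has_cintegral nu (fun b => rep u b * Num.conj (rep v b)) '[u, v].
Proof.
split=> //; have [u1 u2] := rep_Lfun2 u; have [v1 v2] := rep_Lfun2 v.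
have LM a b : a \in Lfun nu 2%:E -> b \in Lfun nu 2%:E ->
    nu.-integrable setT (EFin \o (a \* b)).
  by move=> la lb; apply/Lfun1_integrable; exact: Lfun2_mul_Lfun1.
split.
  have := integrableD measurableT (LM _ _ u1 v1) (LM _ _ u2 v2).
  by apply: eq_integrable => // x _; rewrite /= ReM ReJ ImJ mulrN opprK.
have := integrableB measurableT (LM _ _ u2 v1) (LM _ _ u1 v2).
by apply: eq_integrable => // x _; rewrite /= ImM ReJ ImJ mulrN addrC.
Qed.

Lemma has_cintegral_sqn u :
  has_cintegral nu (fun b => (normsq (rep u b))%:C%C) (sqn u)%:C%C.
Proof.
have := has_cintegral_dot u u; rewrite dot_sqn.
by under eq_fun do rewrite mulcJ.
Qed.

Lemma sqn_integral u : (\int[nu]_b (normsq (rep u b))%:E)%E = (sqn u)%:E.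
Proof. exact: (has_cintegral_normsq (has_cintegral_sqn u)). Qed.

Lemma rep_L2_mk f : cmeasurable f -> (\int[nu]_b (normsq (f b))%:E < +oo)%E ->
  {ae nu, forall b, rep (L2_mk nu f) b = f b}.
Proof.
move=> [f1 f2] fi.
have fsq : f \in square_integrable nu.
  have mn : measurable_fun setT (EFin \o (fun b => normsq (f b))).
    by apply/measurable_EFinP; exact: measurable_normsq.
  apply/andP; split; apply/Lfun2P; split=> //; apply: le_lt_trans fi;
    apply: ge0_le_integral => //.
  - by move=> b _; rewrite lee_fin sqr_ge0.
  - by apply/measurable_EFinP; exact: measurable_funX.
  - by move=> b _; rewrite lee_fin; exact: Re_le_normsq.
  - by move=> b _; rewrite lee_fin sqr_ge0.
  - by apply/measurable_EFinP; exact: measurable_funX.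
  - by move=> b _; rewrite lee_fin lerDr sqr_ge0.
have := rep_pi (insubd (0 : L2fun nu) f).
by apply: filterS => b ->; rewrite insubdK.
Qed.

Lemma Linf_bound f : Linf nu f -> exists2 M : R, 0 <= M &
  {ae nu, forall b, normsq (f b) <= M ^+ 2}.
Proof.
move=> [mf [M fM]]; exists `|M|; first exact: normr_ge0.
apply: filterS fM => b h; rewrite -normc_le ?normr_ge0//.
by apply: le_trans h _; rewrite lecR ler_norm.
Qed.

Lemma rep_mul f u : Linf nu f ->
  {ae nu, forall b, rep (mul_operator f u) b = f b * rep u b}.
Proof.
move=> Lf; have [mf _] := Lf; have [M M0 fM] := Linf_bound Lf.
have mfu : cmeasurable (fun b => f b * rep u b).
  by apply: cmeasurableM => //; exact: rep_measurable.
apply: (rep_L2_mk mfu).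
apply: (@le_lt_trans _ _ (\int[nu]_b ((M ^+ 2)%:E * (normsq (rep u b))%:E))%E); last first.
  rewrite ge0_integralZl//; last 3 first.
  - by apply/measurable_EFinP; apply: measurable_normsq; exact: rep_measurable.
  - by move=> b _; rewrite lee_fin normsq_ge0.
  - by rewrite lee_fin sqr_ge0.
  by rewrite sqn_integral -EFinM ltry.
apply: ae_ge0_le_integral => //.
- by move=> b _; rewrite lee_fin normsq_ge0.
- by apply/measurable_EFinP; exact: measurable_normsq.
- by move=> b _; rewrite -EFinM lee_fin mulr_ge0 ?sqr_ge0 ?normsq_ge0.
- apply: measurable_funeM; apply/measurable_EFinP; apply: measurable_normsq.
  exact: rep_measurable.
apply: filterS fM => b h _; rewrite -EFinM lee_fin normsqM.
by rewrite ler_wpM2r ?normsq_ge0.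
Qed.

Lemma has_cintegral_mul f u v : Linf nu f ->
  has_cintegral nu (fun b => f b * (rep u b * Num.conj (rep v b))) '[mul_operator f u, v].
Proof.
move=> Lf; apply: has_cintegral_ae (has_cintegral_dot (mul_operator f u) v).
  apply: cmeasurableM; first exact: Lf.1.
  by apply: cmeasurableM; [|apply: cmeasurableJ]; exact: rep_measurable.
by apply: filterS (rep_mul u Lf) => b ->; rewrite mulrA.
Qed.

Lemma sqn_mul_operator_le f M u : Linf nu f -> {ae nu, forall b, normsq (f b) <= M} ->
  sqn (mul_operator f u : L2 nu) <= M * sqn u.
Proof.
move=> Lf fM.
have h := has_cintegralZ M%:C%C (has_cintegral_sqn u).
have := has_cintegral_le (has_cintegral_sqn (mul_operator f u)) h.
rewrite ReZ; apply; apply: filterS2 fM (rep_mul u Lf) => b h' ->.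
by rewrite ReZ /= normsqM ler_wpM2r ?normsq_ge0.
Qed.

Lemma mul_operator_bounded f : Linf nu f -> bounded_operators (mul_operator f : L2 nu -> L2 nu).
Proof.
move=> Lf; apply/bounded_operatorsP; split.
  move=> a u v; apply/rep_eq.
  apply: filterS3 (rep_mul (a *: u + v) Lf) (rep_lin a u v)
    (filterI (rep_lin a (mul_operator f u) (mul_operator f v))
      (filterI (rep_mul u Lf) (rep_mul v Lf))).
  by move=> b -> -> [-> [-> ->]]; rewrite mulrDr mulrCA.
have [M M0 fM] := Linf_bound Lf; exists (M ^+ 2); first exact: sqr_ge0.
by move=> u; exact: sqn_mul_operator_le.
Qed.

Lemma mul_operator_adjoint f : Linf nu f ->
  is_adjoint (mul_operator f : L2 nu -> L2 nu) (mul_operator (fun b => Num.conj (f b))).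
Proof.
move=> Lf u v.
have Lf' : Linf nu (fun b => Num.conj (f b)).
  move: Lf => [mf [M fM]]; split; first exact: cmeasurableJ.
  by exists M; apply: filterS fM => b; rewrite norm_conjC.
have h1 := has_cintegral_mul u v Lf.
have h2 : has_cintegral nu (fun b => f b * (rep u b * Num.conj (rep v b)))
    '[u, mul_operator (fun b => Num.conj (f b)) v].
  apply: has_cintegral_ae (has_cintegral_dot u _).
    exact: has_cintegral_measurable h1.
  apply: filterS (rep_mul v Lf') => b ->.
  by rewrite rmorphM /= conjCK mulrCA.
by rewrite -(proj2 h1) -(proj2 h2).
Qed.

Lemma L2_hilbert : hilbert (L2 nu).
Proof.
move=> u cu.
have part (p : R[i] -> R) : (forall f, cmeasurable f -> measurable_fun setT (p \o f)) ->
    (forall z w, (p z - p w) ^+ 2 <= normsq (z - w)) ->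
    exists2 l : B -> R, measurable_fun setT l & forall e : R, 0 < e -> exists N, forall n,
    (N <= n)%N -> (\int[nu]_x ((p (rep (u n) x) - l x) ^+ 2)%:E <= e%:E)%E.
  move=> mp pn; apply: (real_L2_complete (f := fun n => p \o rep (u n))).
    by move=> n; apply: mp; exact: rep_measurable.
  move=> e e0; have [N NP] := cu e e0; exists N => m n Nm Nn.
  apply: (@le_trans _ _ (sqn (u m - u n))%:E); last by rewrite lee_fin ltW// NP.
  rewrite -sqn_integral; apply: ae_ge0_le_integral => //.
  - by move=> b _; rewrite lee_fin sqr_ge0.
  - apply/measurable_EFinP; apply: measurable_funX; apply: measurable_funB;
      apply: mp; exact: rep_measurable.
  - by move=> b _; rewrite lee_fin normsq_ge0.
  - by apply/measurable_EFinP; apply: measurable_normsq; exact: rep_measurable.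
  by apply: filterS (repB (u m) (u n)) => b -> _; rewrite lee_fin /=; exact: pn.
have [||lr mlr lrP] := part (@Re R); first by move=> f [].
  by move=> z w; rewrite -ReN -ReD; exact: Re_le_normsq.
have [||li mli liP] := part (@Im R); first by move=> f [].
  by move=> z w; rewrite -ImN -ImD lerDr sqr_ge0.
pose f b := (lr b +i* li b)%C.
have mf : cmeasurable f by split.
have lim (e : R) : 0 < e -> exists N, forall n, (N <= n)%N ->
    (\int[nu]_b (normsq (rep (u n) b - f b))%:E <= e%:E)%E.
  move=> e0; have e2 : 0 < e / 2 by rewrite divr_gt0.
  have [N NP] := lrP _ e2; have [M MP] := liP _ e2; exists (maxn N M) => n.
  rewrite geq_max => /andP[Nn Mn].
  have [m1 m2] := rep_measurable (u n).
  under eq_integral => b _ do rewrite /normsq ReD ReN ImD ImN /= EFinD.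
  rewrite ge0_integralD//.
  - by rewrite [e]splitr EFinD leeD// ?NP// MP.
  - by move=> b _; rewrite lee_fin sqr_ge0.
  - by apply/measurable_EFinP; apply: measurable_funX; exact: measurable_funB.
  - by move=> b _; rewrite lee_fin sqr_ge0.
  - by apply/measurable_EFinP; apply: measurable_funX; exact: measurable_funB.
have mn n : cmeasurable (fun b => rep (u n) b - f b).
  under eq_fun do rewrite -mulN1r; apply: cmeasurableD; first exact: rep_measurable.
  by apply: cmeasurableM => //; exact: cmeasurable_cst.
have fi : (\int[nu]_b (normsq (f b))%:E < +oo)%E.
  have [N NP] := lim 1 ltr01.
  apply: (@le_lt_trans _ _ (\int[nu]_b (2%:E * ((normsq (rep (u N) b - f b))%:E +
      (normsq (rep (u N) b))%:E)))%E).
    apply: ge0_le_integral => //.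
    - by move=> b _; rewrite lee_fin normsq_ge0.
    - by apply/measurable_EFinP; exact: measurable_normsq.
    - apply: measurable_funeM; apply: emeasurable_funD; apply/measurable_EFinP;
        apply: measurable_normsq => //; exact: rep_measurable.
    - move=> b _; rewrite -EFinD -EFinM lee_fin.
      move: (rep _ b) (f b) => [a1 a2] [b1 b2]; rewrite /normsq /=.
      have := sqr_ge0 (2 * a1 - b1); have := sqr_ge0 (2 * a2 - b2); nra.
  rewrite ge0_integralZl//; last 2 first.
  - apply: emeasurable_funD; apply/measurable_EFinP;
      apply: measurable_normsq => //; exact: rep_measurable.
  - by move=> b _; rewrite -EFinD lee_fin addr_ge0// normsq_ge0.
  rewrite ge0_integralD//; last 4 first.
  - by move=> b _; rewrite lee_fin normsq_ge0.
  - by apply/measurable_EFinP; exact: measurable_normsq.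
  - by move=> b _; rewrite lee_fin normsq_ge0.
  - by apply/measurable_EFinP; apply: measurable_normsq; exact: rep_measurable.
  rewrite sqn_integral lte_mul_pinfty// lte_add_pinfty ?ltry//.
  by apply: le_lt_trans (NP N (leqnn _)) _; exact: ltry.
exists (L2_mk nu f) => e e0; have [N NP] := lim (e / 2) (divr_gt0 e0 (ltr0Sn _ _)).
exists N => n Nn; apply: (@le_lt_trans _ _ (e / 2)).
  rewrite -lee_fin -sqn_integral; apply: le_trans (NP n Nn).
  apply: ae_ge0_le_integral => //.
  - by move=> b _; rewrite lee_fin normsq_ge0.
  - by apply/measurable_EFinP; apply: measurable_normsq; exact: rep_measurable.
  - by move=> b _; rewrite lee_fin normsq_ge0.
  - by apply/measurable_EFinP; exact: measurable_normsq.
  by apply: filterS2 (repB (u n) (L2_mk nu f)) (rep_L2_mk mf fi) => b -> ->.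
by rewrite ltr_pdivrMr// ltr_pMr// ltr1n.
Qed.

End L2_space.

(** * Functionals and operators determined on finitely supported vectors *)

Section l2_functionals.
Variables (R : realType) (I : choiceType) (K : innerProductSpace R).

Lemma dot_single_ext (x y : l2 I K) :
  (forall i u, '[x, single i u] = '[y, single i u]) -> x = y.
Proof.
move=> h; apply: coord_ext => i; apply: dot_ext => u.
by rewrite -!dot_single h.
Qed.

(** The difference of the two Riesz vectors is orthogonal to every [single i u]. *)
Lemma functional_ext (f g : l2 I K -> R[i]) : hilbert K ->
  bounded_functional f -> bounded_functional g ->
  (forall i u, f (single i u) = g (single i u)) -> forall x, f x = g x.
Proof.
move=> cK fb gb fg.
have [y fy] := riesz (l2_hilbert (I := I) cK) fb.
have [z gz] := riesz (l2_hilbert (I := I) cK) gb.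
suff yz : y = z by move=> x; rewrite fy gz yz.
apply/eqP; rewrite -subr_eq0; apply/eqP/orth_singles => i u.
by rewrite dotBr -fy -gz fg subrr.
Qed.

Lemma operator_ext (H : innerProductSpace R) (S T : l2 I K -> H) : hilbert K ->
  linear S -> linear T ->
  (exists C, forall x, sqn (S x) <= C * sqn x) ->
  (exists C, forall x, sqn (T x) <= C * sqn x) ->
  (forall i u, S (single i u) = T (single i u)) -> forall x, S x = T x.
Proof.
move=> cK Sl Tl [C SC] [D TD] ST x; apply: dot_ext => y; move: x.
apply: functional_ext => //.
- split; first by move=> a u v; rewrite Sl dotDl dotZl.
  exists (C * sqn y) => x; apply: le_trans (dot_normsq_le _ _) _.
  by rewrite mulrAC ler_wpM2r ?sqn_ge0.
- split; first by move=> a u v; rewrite Tl dotDl dotZl.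
  exists (D * sqn y) => x; apply: le_trans (dot_normsq_le _ _) _.
  by rewrite mulrAC ler_wpM2r ?sqn_ge0.
by move=> i u; rewrite ST.
Qed.

Lemma bounded_operator_ext (S T : l2 I K -> l2 I K) : hilbert K ->
  bounded_operators S -> bounded_operators T ->
  (forall i u, S (single i u) = T (single i u)) -> S = T.
Proof.
move=> cK /bounded_operatorsP[Sl [C _ SC]] /bounded_operatorsP[Tl [D _ TD]] ST.
by apply/funext; apply: operator_ext => //; [exists C|exists D].
Qed.

Lemma coord_sum (J : Type) (s : seq J) (f : J -> l2 I K) i :
  coord (\sum_(j <- s) f j) i = \sum_(j <- s) coord (f j) i.
Proof. exact: (big_morph (fun x => coord x i)). Qed.

Lemma sqn_sum_single (J : eqType) (s : seq J) (f : J -> I) (z : J -> K) :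
  injective f -> uniq s ->
  sqn (\sum_(j <- s) single (f j) (z j)) = \sum_(j <- s) sqn (z j).
Proof.
move=> fi; elim: s => [|j s IH] /=; first by rewrite !big_nil sqn0.
move=> /andP[js us]; rewrite !big_cons sqnD sqn_single IH// single_dot coord_sum.
have -> : \sum_(k <- s) coord (single (f k) (z k)) (f j) = 0.
  rewrite big_seq big1// => k ks; rewrite coord_single; case: eqP => // /fi jk.
  by rewrite jk ks in js.
by rewrite dot0r mul0rn addr0.
Qed.

End l2_functionals.

(** * Translations, and l2(Gamma, K) as a tensor product *)

Section translations.
Variables (R : realType) (Gamma : groupType) (K : innerProductSpace R).
Implicit Types (g h k x : Gamma) (xi eta : l2 Gamma K).

Lemma coord_translation g xi h : coord (translation g xi) h = coord xi (g^-1 * h)%g.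
Proof. exact: translationE. Qed.

Lemma delta1_single (u : K) : delta1 Gamma u = single 1%g u.
Proof. by []. Qed.

Lemma translation_linear g : linear (translation g : l2 Gamma K -> l2 Gamma K).
Proof. by move=> a x y; apply: coord_ext => h; rewrite coordD coordZ !coord_translation. Qed.

Lemma translation_dot g xi eta : '[translation g xi, translation g eta] = '[xi, eta].
Proof.
rewrite !l2_dotE -[RHS](csum_reindex _ (h := fun h => (g^-1 * h)%g)).
  by congr csum; apply/funext => h; rewrite /= !coord_translation.
exact: (Bijective (mulVKg g) (mulKg g)).
Qed.

Lemma sqn_translation g xi : sqn (translation g xi) = sqn xi.
Proof. by rewrite /sqn translation_dot. Qed.

Lemma translation_bounded g : bounded_operators (translation g : l2 Gamma K -> l2 Gamma K).
Proof.
apply/bounded_operatorsP; split; first exact: translation_linear.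
by exists 1 => // x; rewrite sqn_translation mul1r.
Qed.

Lemma translationM g h xi : translation g (translation h xi) = translation (g * h)%g xi.
Proof. by apply: coord_ext => k; rewrite !coord_translation invgM mulgA. Qed.

Lemma translation1 xi : translation 1%g xi = xi.
Proof. by apply: coord_ext => k; rewrite !coord_translation invg1 mul1g. Qed.

Lemma translationK g xi : translation g^-1%g (translation g xi) = xi.
Proof. by rewrite translationM mulVg translation1. Qed.

Lemma translationVK g xi : translation g (translation g^-1%g xi) = xi.
Proof. by rewrite translationM mulgV translation1. Qed.

Lemma translation_single g h u : translation g (single h u : l2 Gamma K) = single (g * h)%g u.
Proof.
apply: coord_ext => k; rewrite coord_translation !coord_single.
by rewrite -(inj_eq (mulgI g) (g^-1 * k)%g h) mulVKg.
Qed.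

Definition right_translation x : l2 Gamma K -> l2 Gamma K :=
  fun xi => l2_mk (fun h => coord xi (h * x^-1)%g).

Lemma coord_right_translation x xi h :
  coord (right_translation x xi) h = coord xi (h * x^-1)%g.
Proof.
rewrite /coord /right_translation l2_mkE//; apply/square_summableP.
have := l2_rsummable xi; rewrite /rsummable /summable.
rewrite (reindex_esum setT setT (fun h => h * x^-1)%g)//.
split=> //; first by move=> k l _ _; exact: mulIg.
by move=> k _; exists (k * x)%g => //; rewrite mulgK.
Qed.

Lemma right_translation_linear x : linear (right_translation x).
Proof.
by move=> a y z; apply: coord_ext => h; rewrite coordD coordZ !coord_right_translation.
Qed.

Lemma right_translation_dot x xi eta :
  '[right_translation x xi, right_translation x eta] = '[xi, eta].
Proof.
rewrite !l2_dotE -[RHS](csum_reindex _ (h := fun h => (h * x^-1)%g)).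
  by congr csum; apply/funext => h; rewrite /= !coord_right_translation.
exact: (Bijective (mulgVK x) (mulgK x)).
Qed.

Lemma sqn_right_translation x xi : sqn (right_translation x xi) = sqn xi.
Proof. by rewrite /sqn right_translation_dot. Qed.

Lemma right_translation_bounded x : bounded_operators (right_translation x).
Proof.
apply/bounded_operatorsP; split; first exact: right_translation_linear.
by exists 1 => // y; rewrite sqn_right_translation mul1r.
Qed.

Lemma right_translationM x h xi :
  right_translation x (right_translation h xi) = right_translation (h * x)%g xi.
Proof. by apply: coord_ext => k; rewrite !coord_right_translation invgM mulgA. Qed.

Lemma right_translationVK x xi : right_translation x (right_translation x^-1%g xi) = xi.
Proof.
apply: coord_ext => h; rewrite !coord_right_translation.
by rewrite invgK mulgVK.
Qed.

Lemma right_translation_adjoint x :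
  is_adjoint (right_translation x) (right_translation x^-1%g).
Proof.
by move=> xi eta; rewrite -[eta in LHS](right_translationVK x) right_translation_dot.
Qed.

Lemma right_translation_single x h u : right_translation x (single h u) = single (h * x)%g u.
Proof.
apply: coord_ext => k; rewrite coord_right_translation !coord_single.
by rewrite -(inj_eq (mulIg x) (k * x^-1)%g h) mulgVK.
Qed.

Lemma left_right_translation g x xi :
  translation g (right_translation x xi) = right_translation x (translation g xi).
Proof.
apply: coord_ext => h; rewrite [LHS]coord_translation [LHS]coord_right_translation.
by rewrite [RHS]coord_right_translation [RHS]coord_translation mulgA.
Qed.

End translations.

Section right_equivariance.
Variables (R : realType) (Gamma : groupType).
Notation H := (ell2 R Gamma).

(** The commutant of the right translations is a von Neumann algebra that contains the
    left translations. *)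
Lemma group_vN_right_equivariant (X : H -> H) : group_vN R Gamma X ->
  commutant (range (@right_translation R Gamma (scalar_space R))) X.
Proof.
apply; split; first apply: commutant_vN_subalgebra.
- by move=> _ [x _ <-]; exact: right_translation_bounded.
- move=> _ [x _ <-]; exists (right_translation x^-1%g); first by exists x^-1%g.
  exact: right_translation_adjoint.
move=> _ [g _ <-]; split; first exact: translation_bounded.
by move=> _ [x _ <-]; apply/funext => xi /=; exact: left_right_translation.
Qed.

Definition basis (k : Gamma) : H := @single R Gamma (scalar_space R) k (1 : R[i]^o).

Lemma single_basis k (z : scalar_space R) : single k z = (z : R[i]) *: basis k.
Proof.
rewrite -singleZ; congr single.
exact: (esym (mulr1 (z : R[i]))).
Qed.

Lemma coord_basis k h : coord (basis k) h = (if h == k then 1 else 0 : R[i]).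
Proof. by rewrite /basis coord_single. Qed.

Lemma dot_basis (xi : H) k : '[xi, basis k] = coord xi k.
Proof.
rewrite dot_single; transitivity ((coord xi k : R[i]) * Num.conj (1 : R[i])) => //.
by rewrite conjC1 mulr1.
Qed.

End right_equivariance.

Section tensors.
Variables (R : realType) (Gamma : groupType) (K : innerProductSpace R).
Notation H := (ell2 R Gamma).

(** The vector [u (x) xi], under the identification of l2(Gamma, K) with the tensor
    product of K and l2(Gamma). *)
Definition tensor (u : K) (xi : H) : l2 Gamma K :=
  l2_mk (fun h => (coord xi h : R[i]) *: u).

Let tensor_exists u (xi : H) : exists z : l2 Gamma K,
  coord z = (fun h => (coord xi h : R[i]) *: u) /\ sqn z <= sqn xi * sqn u.
Proof.
apply: l2_exists => s us; under eq_bigr do rewrite sqn_scale -scalar_sqnE.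
by rewrite -mulr_suml ler_wpM2r ?sqn_ge0//; exact: sum_sqn_coord_le.
Qed.

Lemma tensor_coord u xi h : coord (tensor u xi) h = (coord xi h : R[i]) *: u.
Proof.
have [z [zE _]] := tensor_exists u xi.
have e : (fun h => (coord xi h : R[i]) *: u) \in @square_summable R Gamma K.
  by rewrite -zE; exact: (valP (z : l2seq Gamma K)).
exact: (congr1 (@^~ h) (l2_mkE e)).
Qed.

Lemma sqn_tensor_le u xi : sqn (tensor u xi) <= sqn xi * sqn u.
Proof.
have [z [zE zle]] := tensor_exists u xi.
rewrite (_ : tensor u xi = z)//; apply: coord_ext => h.
by rewrite tensor_coord zE.
Qed.

Lemma tensor_linear u a xi eta :
  tensor u (a *: xi + eta) = a *: tensor u xi + tensor u eta.
Proof.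
apply: coord_ext => h; rewrite [RHS]coordD coordZ !tensor_coord.
have -> : (coord (a *: xi + eta) h : R[i]) = a * (coord xi h : R[i]) + (coord eta h : R[i]).
  by [].
by rewrite scalerDl scalerA.
Qed.

Lemma tensor_basis u k : tensor u (basis R k) = single k u.
Proof.
apply: coord_ext => h.
transitivity ((coord (basis R k) h : R[i]) *: u); first exact: tensor_coord.
transitivity ((if h == k then 1 else 0 : R[i]) *: u).
  by congr (_ *: u); exact: coord_basis.
rewrite [RHS]coord_single.
by case: ifP => _; [exact: scale1r|exact: scale0r].
Qed.

Lemma translation_tensor g u xi : translation g (tensor u xi) = tensor u (translation g xi).
Proof. by apply: coord_ext => h; rewrite coord_translation !tensor_coord coord_translation. Qed.

End tensors.

(** * Essentially bounded functions *)

Section essentially_bounded.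
Context d (B : measurableType d) (R : realType) (nu : probability B R).
Implicit Types (f g : B -> R[i]) (u : L2 nu).

Lemma LinfP f : Linf nu f <->
  cmeasurable f /\ exists M : R, {ae nu, forall b, normsq (f b) <= M}.
Proof.
split=> [Lf|[mf [M fM]]].
  by split; [exact: Lf.1|have [M _ fM] := Linf_bound Lf; exists (M ^+ 2)].
split=> //; exists (1 + `|M|); apply: filterS fM => b h.
have M0 := normr_ge0 M; rewrite normc_le ?addr_ge0//.
by apply: le_trans h _; have := ler_norm M; nra.
Qed.

Lemma Linf_lin a f g : Linf nu f -> Linf nu g -> Linf nu (fun b => a * f b + g b).
Proof.
move=> /LinfP[mf [M fM]] /LinfP[mg [N gN]]; apply/LinfP; split.
  by apply: cmeasurableD => //; apply: cmeasurableM => //; exact: cmeasurable_cst.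
exists (2 * (normsq a * M + N)); apply: filterS2 fM gN => b h1 h2.
apply: le_trans (normsq_lin_le _ _ _) _.
by rewrite ler_pM2l// lerD// ler_wpM2l// normsq_ge0.
Qed.

Lemma Linf_cst z : Linf nu (fun=> z).
Proof.
apply/LinfP; split; first exact: cmeasurable_cst.
by exists (normsq z); apply: nearW.
Qed.

Lemma mul_operator_ext f g u : Linf nu f -> Linf nu g ->
  {ae nu, forall b, f b = g b} -> mul_operator f u = mul_operator g u.
Proof.
move=> Lf Lg fg; apply/rep_eq.
by apply: filterS3 fg (rep_mul u Lf) (rep_mul u Lg) => b e -> ->; rewrite e.
Qed.

Lemma mul_operator_cst z u : mul_operator (fun=> z) u = z *: u :> L2 nu.
Proof.
apply/rep_eq.
by apply: filterS2 (repZ z u) (rep_mul u (Linf_cst z)) => b -> ->.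
Qed.

Lemma mul_operator_lin a f g u : Linf nu f -> Linf nu g ->
  mul_operator (fun b => a * f b + g b) u = a *: mul_operator f u + mul_operator g u :> L2 nu.
Proof.
move=> Lf Lg; apply/rep_eq.
apply: filterS3 (rep_mul u (Linf_lin a Lf Lg))
  (rep_lin a (mul_operator f u) (mul_operator g u))
  (filterI (rep_mul u Lf) (rep_mul u Lg)) => b -> -> [-> ->].
by rewrite mulrDl mulrA.
Qed.

End essentially_bounded.

(** * The equivariant expectation and the averaged operators *)

Section equivariant_expectation.
Context d (B : measurableType d) (R : realType) (Gamma : groupType).
Context (nu : probability B R) (act : Gamma -> B -> B).
Implicit Types (F G : Gamma -> B -> R[i]) (f : B -> R[i]).

Lemma Linf_prodP F : Linf_prod nu F <->
  (forall g, cmeasurable (F g)) /\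
  exists M : R, forall g, {ae nu, forall b, normsq (F g b) <= M}.
Proof.
split=> [[mF [M FM]]|[mF [M FM]]]; split=> //.
  exists (`|M| ^+ 2) => g; apply: filterS (FM g) => b h.
  by rewrite -normc_le ?normr_ge0//; apply: le_trans h _; rewrite lecR ler_norm.
exists (1 + `|M|) => g; apply: filterS (FM g) => b h.
have M0 := normr_ge0 M; rewrite normc_le ?addr_ge0//.
by apply: le_trans h _; have := ler_norm M; nra.
Qed.

Lemma Linf_prod_lin a F G : Linf_prod nu F -> Linf_prod nu G ->
  Linf_prod nu (fun g b => a * F g b + G g b).
Proof.
move=> /Linf_prodP[mF [M FM]] /Linf_prodP[mG [N GN]]; apply/Linf_prodP; split.
  move=> g; apply: cmeasurableD; last exact: mG.
  by apply: cmeasurableM => //; exact: cmeasurable_cst.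
exists (2 * (normsq a * M + N)) => g; apply: filterS2 (FM g) (GN g) => b h1 h2.
apply: le_trans (normsq_lin_le _ _ _) _.
by rewrite ler_pM2l// lerD// ler_wpM2l// normsq_ge0.
Qed.

Lemma Linf_prodJ F : Linf_prod nu F -> Linf_prod nu (fun g b => Num.conj (F g b)).
Proof.
move=> /Linf_prodP[mF [M FM]]; apply/Linf_prodP; split.
  by move=> g; exact: cmeasurableJ.
by exists M => g; apply: filterS (FM g) => b; rewrite normsqJ.
Qed.

Lemma Linf_Linf_prod f : Linf nu f -> Linf_prod nu (fun _ : Gamma => f).
Proof. by move=> /LinfP[mf [M fM]]; apply/Linf_prodP; split=> //; exists M. Qed.

Lemma Linf_prodM f F : Linf nu f -> Linf_prod nu F -> Linf_prod nu (fun g b => f b * F g b).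
Proof.
move=> /LinfP[mf [M fM]] /Linf_prodP[mF [N FN]]; apply/Linf_prodP; split.
  by move=> g; apply: cmeasurableM => //.
exists (M * N) => g; apply: filterS2 fM (FN g) => b h1 h2.
by rewrite normsqM ler_pM// normsq_ge0.
Qed.

Definition lift (p : Gamma -> R[i]) : Gamma -> B -> R[i] := fun g _ => p g.

Definition bounded_on_group (p : Gamma -> R[i]) := exists M : R, forall g, normsq (p g) <= M.

Lemma lift_Linf_prod p : bounded_on_group p -> Linf_prod nu (lift p).
Proof.
move=> [M pM]; apply/Linf_prodP; split; first by move=> g; exact: cmeasurable_cst.
by exists M => g; apply: nearW => b; exact: pM.
Qed.

Variable P : (Gamma -> B -> R[i]) -> B -> R[i].
Hypothesis P_Linf : forall F, Linf_prod nu F -> Linf nu (P F).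
Hypothesis P_linear : forall (a : R[i]) F G, Linf_prod nu F -> Linf_prod nu G ->
  P (fun g b => a * F g b + G g b) = (fun b => a * P F b + P G b) %[ae nu].
Hypothesis P_pos : forall F, Linf_prod nu F -> (forall g, {ae nu, forall b, 0 <= F g b}) ->
  {ae nu, forall b, 0 <= P F b}.
Hypothesis P_id : forall f, Linf nu f -> P (fun=> f) = f %[ae nu].
Hypothesis P_mod : forall f F, Linf nu f -> Linf_prod nu F ->
  P (fun g b => f b * F g b) = (fun b => f b * P F b) %[ae nu].

Lemma P_lin a F G : Linf_prod nu F -> Linf_prod nu G ->
  {ae nu, forall b, P (fun g b => a * F g b + G g b) b = a * P F b + P G b}.
Proof. by move=> LF LG; apply: filterS (P_linear a LF LG) => b /(_ I). Qed.

Lemma P_constant f : Linf nu f -> {ae nu, forall b, P (fun=> f) b = f b}.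
Proof. by move=> Lf; apply: filterS (P_id Lf) => b /(_ I). Qed.

(** Adding a large constant to [F] makes it positive. *)
Lemma P_real F : Linf_prod nu F -> (forall g b, Im (F g b) = 0) ->
  {ae nu, forall b, Im (P F b) = 0}.
Proof.
move=> LF F0; have [mF [M FM]] := iffLR (Linf_prodP _) LF.
have LM : Linf nu (fun=> (1 + `|M|)%:C%C) by exact: Linf_cst.
have LM' := Linf_Linf_prod LM.
have pos g : {ae nu, forall b, 0 <= 1 * F g b + (1 + `|M|)%:C%C}.
  apply: filterS (FM g) => b h; have := F0 g b; have := le_trans (Re_le_normsq _) h.
  case: (F g b) => x y /= h1 ->; rewrite lecE /=; apply/andP; split; first by apply/eqP; lra.
  have := ler_norm M; have := normr_ge0 M; rewrite leNgt => h2 h3; apply/negP; nra.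
apply: filterS3 (P_pos (Linf_prod_lin 1 LF LM') pos) (P_lin 1 LF LM') (P_constant LM).
move=> b h e1 e2; move: h; rewrite e1 e2 mul1r lecE => /andP[/eqP + _].
by rewrite ImD /= addr0.
Qed.

(** Consequence of [P_real] for [F + F^*] and ['i * (F^* - F)]. *)
Lemma P_conj F : Linf_prod nu F ->
  {ae nu, forall b, P (fun g b => Num.conj (F g b)) b = Num.conj (P F b)}.
Proof.
move=> LF; have LJ := Linf_prodJ LF.
have h1 := P_real (Linf_prod_lin 1 LF LJ) _.
have L0 := Linf_Linf_prod (Linf_cst nu 0).
have h2 := P_real (Linf_prod_lin 'i%C (Linf_prod_lin (-1) LF LJ) L0) _.
apply: filterS3 (h1 _) (h2 _) (filterI (P_lin 1 LF LJ) (filterI (P_lin (-1) LF LJ)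
  (filterI (P_lin 'i%C (Linf_prod_lin (-1) LF LJ) L0) (P_constant (Linf_cst nu 0))))).
- move=> b e1 e2 [e3 [e4 [e5 e6]]].
  move: e1 e2; rewrite e3 e5 e4 e6 !(ReD, ImD, ReM, ImM, ReJ, ImJ, ReN, ImN) /=.
  by move=> e1 e2; apply: complex_ext; rewrite ?ReJ ?ImJ; lra.
- by move=> g b; rewrite !(ReD, ImD, ReM, ImM, ReJ, ImJ, ReN, ImN) /=; lra.
- by move=> g b; rewrite !(ReD, ImD, ReM, ImM, ReJ, ImJ, ReN, ImN) /=; lra.
Qed.

Lemma P_Re_le F (c : B -> R) : Linf_prod nu F -> Linf nu (fun b => (c b)%:C%C) ->
  (forall g, {ae nu, forall b, Re (F g b) <= c b}) ->
  {ae nu, forall b, Re (P F b) <= c b}.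
Proof.
move=> LF Lc Fc; have LJ := Linf_prodJ LF.
have L1 := Linf_prod_lin 1 LF LJ.
have L2c := Linf_Linf_prod (Linf_lin 1 Lc Lc).
have pos g : {ae nu, forall b, 0 <= -1 * (1 * F g b + Num.conj (F g b)) +
    (1 * (c b)%:C%C + (c b)%:C%C)}.
  apply: filterS (Fc g) => b h; rewrite lecE.
  rewrite !(ReD, ImD, ReM, ImM, ReJ, ImJ, ReN, ImN) /=.
  by apply/andP; split; [apply/eqP; lra|lra].
apply: filterS3 (P_pos (Linf_prod_lin (-1) L1 L2c) pos) (P_lin (-1) L1 L2c)
  (filterI (filterI (P_lin 1 LF LJ) (P_conj LF)) (P_constant (Linf_lin 1 Lc Lc))).
move=> b + e1 [[e2 e3] e4]; rewrite e1 e2 e3 e4 lecE => /andP[_].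
by rewrite !(ReD, ImD, ReM, ImM, ReJ, ImJ, ReN, ImN) /=; lra.
Qed.

Lemma P_sum_mod (Q : eqType) (s : seq Q) (f : Q -> B -> R[i]) (p : Q -> Gamma -> R[i]) :
  (forall q, q \in s -> Linf nu (f q)) -> (forall q, bounded_on_group (p q)) ->
  Linf_prod nu (fun g b => \sum_(q <- s) f q b * p q g) /\
  {ae nu, forall b, P (fun g b => \sum_(q <- s) f q b * p q g) b =
    \sum_(q <- s) f q b * P (lift (p q)) b}.
Proof.
move=> Lf pb; elim: s Lf => [|q s IH] Lf.
  have -> : (fun (g : Gamma) b => \sum_(q <- [::]) f q b * p q g) = (fun=> fun=> 0).
    by apply/funext => g; apply/funext => b; rewrite big_nil.
  split; first exact: Linf_Linf_prod (Linf_cst nu 0).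
  by apply: filterS (P_constant (Linf_cst nu 0)) => b ->; rewrite big_nil.
have [|LS PS] := IH; first by move=> q' q's; apply: Lf; rewrite in_cons q's orbT.
have Lfq : Linf nu (f q) by apply: Lf; rewrite in_cons eqxx.
have Lq := Linf_prodM Lfq (lift_Linf_prod (pb q)).
have -> : (fun (g : Gamma) b => \sum_(q <- q :: s) f q b * p q g) =
    (fun g b => 1 * (f q b * lift (p q) g b) + \sum_(q <- s) f q b * p q g).
  by apply/funext => g; apply/funext => b; rewrite big_cons mul1r.
split; first exact: Linf_prod_lin.
apply: filterS3 (P_lin 1 Lq LS) PS (P_mod Lfq (lift_Linf_prod (pb q))) => b -> -> e.
by rewrite big_cons mul1r e.
Qed.

(** This plays the part of the complete positivity of [P]. The hypothesis is applied at
    each point [b] to the values of [x] and [y] at [b], then [P] is applied, and the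
    result is integrated in [b]. Since [P] acts on bounded functions only, these values
    are first multiplied by [r b = expR (- N b)], where [N b] is the sum of their squared
    moduli; the resulting factor [r b ^+ 2] is cancelled after [P] has been applied. The
    weights [al] and [be] serve to treat in the same way a finite block of a matrix and
    a single entry at two arbitrary vectors. *)
Lemma P_form_le (I J : eqType) (s : seq I) (t : seq J) (p : I -> J -> Gamma -> R[i])
    (A : R) (al : J -> R) (be : I -> R) (x : J -> L2 nu) (y : I -> L2 nu) :
  0 <= A -> (forall j, 0 <= al j) -> (forall i, 0 <= be i) ->
  (forall i j, bounded_on_group (p i j)) ->
  (forall g (c : J -> R[i]) (e : I -> R[i]),
    Re (\sum_(i <- s) \sum_(j <- t) p i j g * (c j * Num.conj (e i))) <=
    A * (\sum_(j <- t) al j * normsq (c j) + \sum_(i <- s) be i * normsq (e i))) ->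
  Re (\sum_(i <- s) \sum_(j <- t) '[mul_operator (P (lift (p i j))) (x j), y i]) <=
  A * (\sum_(j <- t) al j * sqn (x j) + \sum_(i <- s) be i * sqn (y i)).
Proof.
move=> A0 al0 be0 pb pA.
pose u j := rep (x j); pose v i := rep (y i).
have mu j : cmeasurable (u j) by exact: rep_measurable.
have mv i : cmeasurable (v i) by exact: rep_measurable.
pose N b := \sum_(j <- t) normsq (u j b) + \sum_(i <- s) normsq (v i b).
have N0 b : 0 <= N b by rewrite addr_ge0// sumr_ge0// => k _; exact: normsq_ge0.
pose r b : R := expR (- N b).
have r0 b : 0 < r b by exact: expR_gt0.
have rN b : r b * N b <= 1.
  rewrite /r expRN mulrC ler_pdivrMr ?expR_gt0// mul1r.
  by apply: le_trans (expR_ge1Dx _); rewrite lerDr.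
have r1 b : r b <= 1 by rewrite /r -expR0 ler_expR oppr_le0.
have mN : measurable_fun setT N.
  by apply: measurable_funD; apply: measurable_sum => k; exact: measurable_normsq.
have mr : measurable_fun setT r.
  by apply: measurableT_comp => //; apply: measurableT_comp.
have uN j b : j \in t -> normsq (u j b) <= N b.
  move=> jt; rewrite /N (big_rem _ jt) /= -addrA lerDl addr_ge0// sumr_ge0// => k _;
    exact: normsq_ge0.
have vN i b : i \in s -> normsq (v i b) <= N b.
  move=> jt; rewrite /N addrC (big_rem _ jt) /= -addrA lerDl addr_ge0// sumr_ge0// => k _;
    exact: normsq_ge0.
have scale (z : R) b : 0 <= z -> z <= N b -> z * r b ^+ 2 <= 1.
  move=> z0 zN; have := rN b; have := r1 b; have := ltW (r0 b); nra.
pose S := [seq (i, j) | i <- s, j <- t].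
have SP q : q \in S -> q.1 \in s /\ q.2 \in t.
  by move=> /allpairsP[[i j] /= [si tj ->]].
have bigS (V : nmodType) (F : I -> J -> V) :
    \sum_(i <- s) \sum_(j <- t) F i j = \sum_(q <- S) F q.1 q.2.
  by rewrite big_allpairs.
pose f (q : I * J) b := (u q.2 b * Num.conj (v q.1 b)) * (r b ^+ 2)%:C%C.
have mf q : cmeasurable (f q).
  apply: cmeasurableM; first by apply: cmeasurableM => //; exact: cmeasurableJ.
  by apply: cmeasurable_real; exact: measurable_funX.
have Lf q : q \in S -> Linf nu (f q).
  move=> /SP[si tj]; apply/LinfP; split=> //; exists 1; apply: nearW => b.
  rewrite !normsqM normsqJ normsq_real (expr2 (r b ^+ 2)) mulrACA -[leRHS]mulr1.
  have a1 := scale _ b (normsq_ge0 _) (uN _ b tj).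
  have a2 := scale _ b (normsq_ge0 _) (vN _ b si).
  by apply: ler_pM => //; apply: mulr_ge0; rewrite ?normsq_ge0 ?sqr_ge0.
have [LG PG] := P_sum_mod Lf (fun q => pb q.1 q.2).
pose c b := A * (\sum_(j <- t) al j * normsq (u j b) +
  \sum_(i <- s) be i * normsq (v i b)) * r b ^+ 2.
have mc : measurable_fun setT c.
  apply: measurable_funM; last exact: measurable_funX.
  apply: measurable_funM => //; apply: measurable_funD; apply: measurable_sum => k;
    by apply: measurable_funM => //; exact: measurable_normsq.
have c0 b : 0 <= c b.
  rewrite /c mulr_ge0 ?sqr_ge0// mulr_ge0// addr_ge0// sumr_ge0// => k _;
    by rewrite mulr_ge0// normsq_ge0.
have Lc : Linf nu (fun b => (c b)%:C%C).
  apply/LinfP; split; first exact: cmeasurable_real.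
  exists ((A * (\sum_(j <- t) al j + \sum_(i <- s) be i)) ^+ 2); apply: nearW => b.
  rewrite normsq_real ler_sqr ?nnegrE//; last first.
    by rewrite mulr_ge0// addr_ge0// sumr_ge0.
  rewrite /c -mulrA ler_wpM2l// mulrDl !mulr_suml.
  apply: lerD; rewrite big_seq [leRHS]big_seq; apply: ler_sum => k ks;
    rewrite -mulrA -[leRHS]mulr1 ler_wpM2l//; apply: scale;
    by rewrite ?normsq_ge0// ?uN// vN.
have cJ (z : R) : Num.conj z%:C%C = z%:C%C.
  by apply: complex_ext; rewrite ?ReJ ?ImJ //= oppr0.
have fE q b (w : R[i]) : f q b * w = w * ((u q.2 b * (r b)%:C%C) *
    Num.conj (v q.1 b * (r b)%:C%C)).
  have cM (z z' : R[i]) : Num.conj (z * z') = Num.conj z * Num.conj z' by exact: rmorphM.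
  by rewrite /f cM cJ rmorphXn expr2 [LHS]mulrC [in RHS]mulrACA.
have key : {ae nu, forall b, Re (\sum_(q <- S) P (lift (p q.1 q.2)) b *
    (u q.2 b * Num.conj (v q.1 b))) <= A * (\sum_(j <- t) al j * normsq (u j b) +
  \sum_(i <- s) be i * normsq (v i b))}.
  apply: filterS2 PG (P_Re_le LG Lc _) => [b -> h|g]; last first.
    apply: nearW => b; under eq_bigr do rewrite fE.
    have := pA g (fun j => u j b * (r b)%:C%C) (fun i => v i b * (r b)%:C%C).
    rewrite bigS => /le_trans; apply; rewrite /c -mulrA mulrDl !mulr_suml.
    apply: ler_wpM2l => //; apply: lerD; apply: ler_sum => k _;
      by rewrite normsqM normsq_real mulrA.
  rewrite -(ler_pM2l (exprn_gt0 2 (r0 b))) [leRHS]mulrC -ReZ mulr_sumr.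
  apply: le_trans h; rewrite le_eqVlt; apply/orP; left; apply/eqP; congr Re.
  by apply: eq_bigr => q _; rewrite /f [RHS]mulrC [RHS]mulrA mulrC mulrA.
have hL := has_cintegral_sum S (fun q => has_cintegral_mul (x q.2) (y q.1)
  (P_Linf (lift_Linf_prod (pb q.1 q.2)))).
have hR := has_cintegralZ A%:C%C (has_cintegralD
  (has_cintegral_sum t (fun j => has_cintegralZ (al j)%:C%C (has_cintegral_sqn (x j))))
  (has_cintegral_sum s (fun i => has_cintegralZ (be i)%:C%C (has_cintegral_sqn (y i))))).
have := has_cintegral_le hL hR; rewrite bigS.
have RC (I' : Type) (s' : seq I') (k l : I' -> R) :
    Re (\sum_(i <- s') (k i)%:C%C * (l i)%:C%C) = \sum_(i <- s') k i * l i.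
  rewrite (_ : \sum_(i <- s') _ = (\sum_(i <- s') k i * l i)%:C%C)//.
  by rewrite rmorph_sum; apply: eq_bigr => i _; rewrite rmorphM.
rewrite ReZ ReD !RC; apply; apply: filterS key => b h.
by rewrite ReZ ReD !RC.
Qed.

Notation H := (ell2 R Gamma).
Implicit Types (T X : H -> H) (xi eta : H) (u v : L2 nu).
Implicit Types (W Y : l2 Gamma (L2 nu) -> l2 Gamma (L2 nu)).

(** The entry at [xi] and [eta] of the conjugates of [T] by right translations. *)
Definition pairing T xi eta (x : Gamma) : R[i] :=
  '[T (right_translation x xi), right_translation x eta].

Lemma pairing_bounded T xi eta : bounded_operators T ->
  bounded_on_group (pairing T xi eta).
Proof.
move=> /bounded_operatorsP[_ [C C0 TC]]; exists (C * sqn xi * sqn eta) => x.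
apply: le_trans (dot_normsq_le _ _) _; rewrite sqn_right_translation.
by rewrite ler_wpM2r ?sqn_ge0//; apply: le_trans (TC _) _; rewrite sqn_right_translation.
Qed.

Definition averaged_entry T xi eta : B -> R[i] := P (lift (pairing T xi eta)).

Lemma averaged_entry_Linf T xi eta : bounded_operators T ->
  Linf nu (averaged_entry T xi eta).
Proof. by move=> Tb; apply: P_Linf; apply: lift_Linf_prod; exact: pairing_bounded. Qed.

Lemma P_lift_lin a p q : bounded_on_group p -> bounded_on_group q ->
  {ae nu, forall b, P (lift (fun x => a * p x + q x)) b =
    a * P (lift p) b + P (lift q) b}.
Proof. by move=> pb qb; exact: (P_lin a (lift_Linf_prod pb) (lift_Linf_prod qb)). Qed.

Lemma averaged_entry_lin_l T a xi xi' eta : bounded_operators T ->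
  {ae nu, forall b, averaged_entry T (a *: xi + xi') eta b =
    a * averaged_entry T xi eta b + averaged_entry T xi' eta b}.
Proof.
move=> Tb; rewrite /averaged_entry (_ : pairing T _ eta =
    fun x => a * pairing T xi eta x + pairing T xi' eta x).
  by apply: P_lift_lin; exact: pairing_bounded.
apply/funext => x; rewrite /pairing right_translation_linear.
by rewrite (bounded_linear Tb) dotDl dotZl.
Qed.

Lemma averaged_entry_lin_r T a xi eta eta' : bounded_operators T ->
  {ae nu, forall b, averaged_entry T xi (a *: eta + eta') b =
    Num.conj a * averaged_entry T xi eta b + averaged_entry T xi eta' b}.
Proof.
move=> Tb; rewrite /averaged_entry (_ : pairing T xi _ =
    fun x => Num.conj a * pairing T xi eta x + pairing T xi eta' x).
  by apply: P_lift_lin; exact: pairing_bounded.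
by apply/funext => x; rewrite /pairing right_translation_linear dotDr dotZr.
Qed.

Lemma averaged_entry_lin T S a xi eta : bounded_operators T -> bounded_operators S ->
  {ae nu, forall b, averaged_entry (fun x => a *: T x + S x) xi eta b =
    a * averaged_entry T xi eta b + averaged_entry S xi eta b}.
Proof.
move=> Tb Sb; rewrite /averaged_entry (_ : pairing _ xi eta =
    fun x => a * pairing T xi eta x + pairing S xi eta x).
  by apply: P_lift_lin; exact: pairing_bounded.
by apply/funext => x; rewrite /pairing dotDl dotZl.
Qed.

Lemma Re_dot_operator_le (K : innerProductSpace R) (T : K -> K) C : 0 <= C ->
  (forall x, sqn (T x) <= C * sqn x) ->
  forall x y, Re '[T x, y] <= Num.sqrt C / 2 * (sqn x + sqn y).
Proof.
move=> C0 TC x y; have x0 := sqn_ge0 x; have y0 := sqn_ge0 y.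
apply: Re_le_sqrt; first by rewrite !mulr_ge0 ?sqrtr_ge0 ?addr_ge0.
apply: le_trans (dot_normsq_le _ _) _.
rewrite !exprMn sqr_sqrtr//.
apply: (@le_trans _ _ (C * sqn x * sqn y)); first by rewrite ler_wpM2r.
rewrite -!mulrA ler_wpM2l//; have := sqr_ge0 (sqn x - sqn y); lra.
Qed.

Lemma averaged_form_le T C xi eta u v : bounded_operators T -> 0 <= C ->
  (forall x, sqn (T x) <= C * sqn x) ->
  Re '[mul_operator (averaged_entry T xi eta) u, v] <=
    Num.sqrt C / 2 * (sqn xi * sqn u + sqn eta * sqn v).
Proof.
move=> Tb C0 TC.
have A0 : 0 <= Num.sqrt C / 2 by rewrite mulr_ge0 ?sqrtr_ge0.
have := @P_form_le unit unit [:: tt] [:: tt] (fun _ _ => pairing T xi eta) _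
  (fun=> sqn xi) (fun=> sqn eta) (fun=> u) (fun=> v) A0
  (fun=> sqn_ge0 _) (fun=> sqn_ge0 _) (fun _ _ => pairing_bounded xi eta Tb) _.
rewrite !big_seq1; apply => g c e; rewrite !big_seq1 /pairing.
rewrite (mulrC (sqn xi)) (mulrC (sqn eta)) [X in Re X]mulrC -mulrA.
have := Re_dot_operator_le C0 TC (c tt *: right_translation g xi) (e tt *: right_translation g eta).
rewrite (linear_opZ _ _ (bounded_linear Tb)) dotZl dotZr !sqn_scale !sqn_right_translation.
by [].
Qed.

(** The operator on l2(Gamma, L^2(B)) obtained by averaging [T] over right
    translations with the expectation [P]. *)
Definition averaged T W :=
  bounded_operators W /\ forall i j u, coord (W (single j u)) i =
    mul_operator (averaged_entry T (basis R j) (basis R i)) u.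

(** The finite blocks of the conjugates of [T] by right translations are bounded by the
    norm of [T]; by [P_form_le] so are the blocks of the averaged matrix. *)
Lemma averaged_exists T : bounded_operators T -> exists W, averaged T W.
Proof.
move=> Tb; have /bounded_operatorsP[Tl [C C0 TC]] := Tb.
pose m i j := mul_operator (averaged_entry T (basis R j) (basis R i)) : L2 nu -> L2 nu.
pose m' i j := mul_operator (fun b => Num.conj (averaged_entry T (basis R j) (basis R i) b)) : L2 nu -> L2 nu.
have Lm i j : Linf nu (averaged_entry T (basis R j) (basis R i)).
  exact: averaged_entry_Linf.
have ml i j : linear (m i j).
  exact: (bounded_linear (mul_operator_bounded (Lm i j))).
have [|s t x y us ut|W WP] := @matrix_operator R Gamma (L2 nu) (L2_hilbert (nu := nu)) m m' C C0.
- by move=> i j; exact: mul_operator_adjoint.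
- set w := \sum_(i <- s) _.
  have A0 : 0 <= Num.sqrt C / 2 by rewrite mulr_ge0 ?sqrtr_ge0.
  have X0 : 0 <= \sum_(j <- t) sqn (x j) by apply: sumr_ge0 => j _; exact: sqn_ge0.
  have Y0 : 0 <= \sum_(i <- s) sqn (y i) by apply: sumr_ge0 => j _; exact: sqn_ge0.
  have -> : C = 4 * (Num.sqrt C / 2) ^+ 2.
    by rewrite exprMn sqr_sqrtr//; field.
  rewrite mulrAC; apply: normsq_le_of_Re => // a.
  have -> : a * w = \sum_(i <- s) \sum_(j <- t) '[m i j (a *: x j), y i].
    rewrite /w mulr_sumr; apply: eq_bigr => i _; rewrite mulr_sumr; apply: eq_bigr => j _.
    by rewrite (linear_opZ _ _ (ml i j)) dotZl.
  have := @P_form_le Gamma Gamma s t (fun i j => pairing T (basis R j) (basis R i)) _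
    (fun=> 1) (fun=> 1) (fun j => a *: x j) y A0 (fun=> ler01) (fun=> ler01)
    (fun i j => pairing_bounded (basis R j) (basis R i) Tb) _.
  rewrite mulr_sumr; under [\sum_(j <- t) normsq a * _]eq_bigr do rewrite -sqn_scale.
  under [\sum_(j <- t) 1 * _]eq_bigr do rewrite mul1r.
  under [\sum_(j <- s) 1 * _]eq_bigr do rewrite mul1r.
  apply => g c e.
  pose xi := \sum_(j <- t) @single R Gamma (scalar_space R) (j * g)%g (c j).
  pose eta := \sum_(i <- s) @single R Gamma (scalar_space R) (i * g)%g (e i).
  have := Re_dot_operator_le C0 TC xi eta.
  rewrite /xi /eta !sqn_sum_single//; try exact: mulIg.
  under [\sum_(j <- t) sqn _]eq_bigr do rewrite scalar_sqnE -[normsq _]mul1r.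
  under [\sum_(j <- s) sqn _]eq_bigr do rewrite scalar_sqnE -[normsq _]mul1r.
  congr (_ <= _); congr Re; rewrite dot_sumr; apply: eq_bigr => i _.
  rewrite (linear_op_sum _ _ _ Tl) dot_suml; apply: eq_bigr => j _.
  rewrite !(single_basis _ (c _)) !(single_basis _ (e _)) (linear_opZ _ _ Tl) dotZl dotZr.
  by rewrite /pairing /basis !right_translation_single [LHS]mulrA [LHS]mulrC.
by exists W.
Qed.

Lemma coord_basis_dot X X' k h : is_adjoint X X' ->
  (coord (X (basis R k)) h : R[i]) = Num.conj (coord (X' (basis R h)) k : R[i]).
Proof. by move=> XX'; rewrite -!dot_basis XX' [LHS]dotC. Qed.

(** Both sides are bounded functionals of [xi], and antilinearly of [eta], that agree on
    the canonical basis; on the right the bound comes from [averaged_form_le]. *)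
Lemma averaged_tensor T W u v xi eta : bounded_operators T -> averaged T W ->
  '[W (tensor u xi), tensor v eta] = '[mul_operator (averaged_entry T xi eta) u, v].
Proof.
move=> Tb [Wb WE]; have /bounded_operatorsP[Tl [C C0 TC]] := Tb.
have /bounded_operatorsP[Wl [C' C'0 WC]] := Wb.
have A0 : 0 <= Num.sqrt C / 2 by rewrite mulr_ge0 ?sqrtr_ge0.
have L zeta theta := averaged_entry_Linf zeta theta Tb.
have mul_lin f g h a w : Linf nu f -> Linf nu g -> Linf nu h ->
    {ae nu, forall b, f b = a * g b + h b} ->
    mul_operator f w = a *: mul_operator g w + mul_operator h w :> L2 nu.
  move=> Lf Lg Lh fgh; rewrite -mul_operator_lin//; apply: mul_operator_ext => //.
  exact: Linf_lin.
have s0 (w : L2 nu) := sqn_ge0 w; have t0 (z : H) := sqn_ge0 z.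
have fl eta' : bounded_functional (fun xi => '[W (tensor u xi), tensor v eta']).
  split; first by move=> a x y; rewrite tensor_linear Wl dotDl dotZl.
  exists (C' * sqn u * sqn (tensor v eta')) => x; apply: le_trans (dot_normsq_le _ _) _.
  rewrite mulrAC ler_wpM2r ?sqn_ge0//; apply: le_trans (WC _) _.
  by rewrite -mulrA ler_wpM2l// mulrC sqn_tensor_le.
have fr xi' : bounded_functional (fun eta => '[tensor v eta, W (tensor u xi')]).
  split; first by move=> a x y; rewrite tensor_linear dotDl dotZl.
  exists (sqn v * sqn (W (tensor u xi'))) => x; apply: le_trans (dot_normsq_le _ _) _.
  by rewrite mulrAC ler_wpM2r ?sqn_ge0// mulrC sqn_tensor_le.
have gl eta' : bounded_functional (fun xi => '[mul_operator (averaged_entry T xi eta') u, v]).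
  apply: (@bounded_functional_of_Re _ _ _ (Num.sqrt C / 2 * (sqn u + 1)) (sqn eta' * sqn v)).
  - move=> a x y.
    have e := averaged_entry_lin_l a x y eta' Tb.
    have e' := mul_lin _ _ _ _ u (L _ _) (L _ _) (L _ _) e.
    apply: etrans (congr1 (fun z => '[z, v]) e') _.
    by apply: etrans (dotDl _ _ _) _; congr (_ + _); exact: dotZl.
  - by rewrite mulr_ge0// addr_ge0.
  - by rewrite mulr_ge0.
  move=> x; apply: le_trans (averaged_form_le x eta' u v Tb C0 TC) _.
  rewrite -[leRHS]mulrA ler_wpM2l//; have := s0 u; have := t0 x.
  have : 0 <= sqn eta' * sqn v by rewrite mulr_ge0.
  move: (sqn eta' * sqn v) => w w0; nra.
have gr xi' : bounded_functional
    (fun eta => '[v, mul_operator (averaged_entry T xi' eta) u]).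
  apply: (@bounded_functional_of_Re _ _ _ (Num.sqrt C / 2 * (sqn v + 1)) (sqn xi' * sqn u)).
  - move=> a x y.
    have e := averaged_entry_lin_r a xi' x y Tb.
    have e' := mul_lin _ _ _ _ u (L _ _) (L _ _) (L _ _) e.
    apply: etrans (congr1 (fun z => '[v, z]) e') _.
    apply: etrans (dotDr _ _ _) _; congr (_ + _).
    by apply: etrans (dotZr _ _ _) _; rewrite conjCK.
  - by rewrite mulr_ge0// addr_ge0.
  - by rewrite mulr_ge0.
  move=> x; rewrite dotC ReJ; apply: le_trans (averaged_form_le xi' x u v Tb C0 TC) _.
  rewrite -[leRHS]mulrA ler_wpM2l//; have := s0 v; have := t0 x.
  have : 0 <= sqn xi' * sqn u by rewrite mulr_ge0.
  move: (sqn xi' * sqn u) => w w0; nra.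
have sH := @scalar_hilbert R.
move: xi; apply: (functional_ext sH (fl eta) (gl eta)) => j c.
rewrite (single_basis _ c) (linear_functionalZ _ _ (fl eta).1) (linear_functionalZ _ _ (gl eta).1).
congr (_ * _); rewrite dotC [RHS]dotC; congr Num.conj.
move: eta; apply: (functional_ext sH (fr _) (gr _)) => i e.
rewrite (single_basis _ e) (linear_functionalZ _ _ (fr _).1) (linear_functionalZ _ _ (gr _).1).
by congr (_ * _); rewrite !tensor_basis single_dot WE.
Qed.

(** These relations say that [Y] is [X (x) 1]. *)
Definition amplifies X (Y : l2 Gamma (L2 nu) -> l2 Gamma (L2 nu)) :=
  bounded_operators Y /\ forall k u, Y (single k u) = tensor u (X (basis R k)).

Definition right_equivariant X := forall x xi,
  X (right_translation x xi) = right_translation x (X xi).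

(** The average of [X] is [X (x) 1]: the conjugates of [X] by right translations are all
    equal to [X], and [P] fixes constants. *)
Lemma amplification_exists X : bounded_operators X -> right_equivariant X ->
  exists Y, amplifies X Y.
Proof.
move=> Xb Xr; have [Y [Yb YE]] := averaged_exists Xb; exists Y; split=> // k u.
apply: coord_ext => h; rewrite YE tensor_coord -mul_operator_cst.
apply: mul_operator_ext; [exact: averaged_entry_Linf|exact: Linf_cst|].
rewrite /averaged_entry (_ : lift _ = fun=> fun=> coord (X (basis R k)) h : R[i]).
  exact: (P_constant (Linf_cst nu _)).
apply/funext => x; apply/funext => b.
by rewrite /lift /pairing Xr right_translation_dot dot_basis.
Qed.

Lemma amplifies_adjoint X X' Y Y' : amplifies X Y -> is_adjoint X X' ->
  is_adjoint Y Y' -> amplifies X' Y'.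
Proof.
move=> [Yb YE] XX' YY'; split; first exact: adjoint_bounded YY' Yb.
move=> h v; apply: dot_single_ext => k u.
apply: etrans (dotC _ _) _; apply: etrans _ (esym (dotC _ _)); congr Num.conj.
have e1 : '[single k u, Y' (single h v)] = (coord (X (basis R k)) h : R[i]) * '[u, v].
  rewrite -[LHS]YY' YE; apply: etrans (dot_single _ _ _) _.
  by apply: etrans (congr1 (fun z => '[z, v]) (tensor_coord _ _ _)) _; exact: dotZl.
have e2 : '[single k u, tensor v (X' (basis R h))] =
    Num.conj (coord (X' (basis R h)) k : R[i]) * '[u, v].
  apply: etrans (single_dot _ _ _) _.
  by apply: etrans (congr1 (fun z => '[u, z]) (tensor_coord _ _ _)) _; exact: dotZr.
by rewrite [LHS]e1 [RHS]e2 (coord_basis_dot _ _ XX').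
Qed.

(** As [X] commutes with [T] and with right translations, moving [X] from [xi] to [eta]
    as an adjoint does not change [pairing T (X xi) eta], nor its image by [P]. *)
Lemma averaged_commutes T W X X' Y : bounded_operators T -> averaged T W ->
  is_adjoint X X' -> right_equivariant X -> right_equivariant X' ->
  (forall x, T (X x) = X (T x)) -> amplifies X Y -> W \o Y = Y \o W.
Proof.
move=> Tb WT XX' Xr X'r TX XY; have [Wb _] := WT; have [Yb YE] := XY.
have [Y' YY'] := adjoint_exists (l2_hilbert (L2_hilbert (nu := nu))) Yb.
have [_ Y'E] := amplifies_adjoint XY XX' YY'.
apply: bounded_operator_ext; [exact: L2_hilbert|exact: bounded_comp|exact: bounded_comp|].
move=> l u; apply: dot_single_ext => h v.
have e : averaged_entry T (X (basis R l)) (basis R h) =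
    averaged_entry T (basis R l) (X' (basis R h)).
  by congr (P (lift _)); apply/funext => x; rewrite /pairing -Xr TX XX' X'r.
have e1 := averaged_tensor u v (X (basis R l)) (basis R h) Tb WT.
have e2 := averaged_tensor u v (basis R l) (X' (basis R h)) Tb WT.
move: e1 e2; rewrite e !tensor_basis -YE -Y'E -YY' => e1 e2.
exact: etrans e1 (esym e2).
Qed.

Hypothesis act_nonsingular : nonsingular_space nu act.

Lemma ae_act g (Q : B -> Prop) : {ae nu, forall b, Q b} -> {ae nu, forall b, Q (act g b)}.
Proof.
move=> [N [mN N0 QN]]; have [_ _ mact null] := act_nonsingular.
exists (act g @^-1` N); split.
- by rewrite -[X in measurable X]setTI; exact: mact.
- exact/null.
- by move=> b /=; apply: QN.
Qed.

Lemma Linf_act g f : Linf nu f -> Linf nu (f \o act g).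
Proof.
move=> [mf [M fM]]; have [_ _ mact _] := act_nonsingular.
split; first exact: cmeasurable_comp.
by exists M; exact: (ae_act g fM).
Qed.

Lemma coord_crossed_embed f (xi : l2 Gamma (L2 nu)) h : Linf nu f ->
  coord (crossed_embed act f xi) h = mul_operator (f \o act h) (coord xi h).
Proof.
move=> Lf; have /LinfP[_ [M fM]] := Lf.
have [|z [zE _]] := @l2_exists R Gamma (L2 nu)
    (fun h => mul_operator (f \o act h) (coord xi h)) (`|M| * sqn xi).
  move=> s us; apply: (@le_trans _ _ (\sum_(i <- s) `|M| * sqn (coord xi i))).
    apply: ler_sum => i _; apply: sqn_mul_operator_le; first exact: Linf_act.
    by apply: filterS (ae_act i fM) => b /le_trans; apply; exact: ler_norm.
  by rewrite -mulr_sumr ler_wpM2l//; exact: sum_sqn_coord_le.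
have e : (fun h => mul_operator (f \o act h) (coord xi h)) \in
    @square_summable R Gamma (L2 nu).
  by rewrite -zE; exact: (valP (z : l2seq Gamma (L2 nu))).
exact: (congr1 (@^~ h) (l2_mkE e)).
Qed.

(** [W] has the matrix of the formal sum over [g] of [m g * lambda g] in the crossed
    product. *)
Definition covariant (m : Gamma -> B -> R[i]) (W : l2 Gamma (L2 nu) -> l2 Gamma (L2 nu)) :=
  [/\ bounded_operators W, forall g, Linf nu (m g) & forall i j u,
    coord (W (single j u)) i = mul_operator (m (i * j^-1)%g \o act i) u].

(** Formally, [S] commutes with each term [m g * lambda g] of [W]. As the sum need not
    converge in norm, the terms are compared inside a scalar product: each coordinate of
    [W (single 1 u)], viewed as a vector supported at one point [h], is
    [m h * lambda h] applied to [single 1 u]. *)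
Lemma covariant_commutes_on_unit m W S u : covariant m W -> bounded_operators S ->
  (forall g x, S (translation g x) = translation g (S x)) ->
  (forall f x, Linf nu f -> S (crossed_embed act f x) = crossed_embed act f (S x)) ->
  S (W (single 1%g u)) = W (S (single 1%g u)).
Proof.
move=> [Wb Lm WE] Sb Strans Sembed.
have cH := l2_hilbert (I := Gamma) (L2_hilbert (nu := nu)).
have [S' SS'] := adjoint_exists cH Sb; have [W' WW'] := adjoint_exists cH Wb.
apply: dot_single_ext => k v; set zeta := S (single 1%g u).
have unit_column h : single h (coord (W (single 1%g u)) h) =
    crossed_embed act (m h) (translation h (single 1%g u)).
  apply: coord_ext => i.
  have e1 : coord (crossed_embed act (m h) (translation h (single 1%g u))) i =
      mul_operator (m h \o act i) (if i == h then u else 0).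
    apply: etrans (coord_crossed_embed _ _ (Lm h)) _; congr mul_operator.
    by rewrite translation_single mulg1; exact: coord_single.
  have e2 : coord (W (single 1%g u)) h = mul_operator (m h \o act h) u.
    by apply: etrans (WE _ _ _) _; rewrite invg1 mulg1.
  rewrite [RHS]e1 e2; apply: etrans (coord_single _ _ _) _; case: eqP => [->//|_].
  have mb := mul_operator_bounded (Linf_act i (Lm h)).
  exact: esym (linear_op0 (bounded_linear mb)).
have -> : '[S (W (single 1%g u)), single k v] =
    csum (fun h => '[mul_operator (m h \o act k) (coord zeta (h^-1 * k)%g), v]).
  rewrite SS' l2_dotE; congr csum; apply/funext => h.
  rewrite -single_dot -SS' unit_column Sembed// Strans.
  apply: etrans (dot_single _ _ _) _; congr ('[_, v]).
  by apply: etrans (coord_crossed_embed _ _ (Lm h)) _; congr mul_operator;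
    exact: coord_translation.
have -> : '[W zeta, single k v] =
    csum (fun j => '[mul_operator (m (k * j^-1)%g \o act k) (coord zeta j), v]).
  rewrite WW' l2_dotE; congr csum; apply/funext => j.
  by rewrite -single_dot -WW' dot_single WE.
have bh : bijective (fun h => h^-1 * k)%g.
  exists (fun j => k * j^-1)%g => h; first by rewrite invgM invgK mulVKg.
  by rewrite invgM invgK mulgVK.
rewrite -[RHS](csum_reindex _ bh); congr csum; apply/funext => h /=.
by rewrite invgM invgK mulVKg.
Qed.

(** By the bicommutant theorem for any von Neumann algebra containing the generators.
    Multiplication on the right by [lambda j] reduces column [j] to column [1]. *)
Lemma covariant_in_crossed_product m W : covariant m W -> crossed_product act W.
Proof.
move=> mW D [Dvn DG]; have [Wb Lm WE] := mW.
have cH := l2_hilbert (I := Gamma) (L2_hilbert (nu := nu)).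
apply: (bicommutant cH Dvn Wb) => S [Sb SD].
have Strans g x : S (translation g x) = translation g (S x).
  have /SD/(congr1 (@^~ x)) : D (translation g) by apply: DG; right; exists g.
  by [].
have Sembed f x : Linf nu f -> S (crossed_embed act f x) = crossed_embed act f (S x).
  move=> Lf; have /SD/(congr1 (@^~ x)) : D (crossed_embed act f).
    by apply: DG; left; exists f.
  by [].
move=> x; have /(congr1 (@^~ x)) : W \o S = S \o W; last by [].
apply: bounded_operator_ext; [exact: L2_hilbert|exact: bounded_comp|exact: bounded_comp|].
move=> j u /=; rewrite -[j]mulg1 -translation_single Strans.
have : covariant (fun g => m (g * j^-1)%g) (W \o translation j).
  split; [exact: (bounded_comp Wb (translation_bounded _ j))|by move=> g; exact: Lm|].
  by move=> i l w; rewrite /= translation_single WE invgM mulgA.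
move=> mW'; have := covariant_commutes_on_unit u mW' Sb Strans Sembed.
by [].
Qed.

Hypothesis P_equiv : forall s F, Linf_prod nu F ->
  P (fun g b => F (s^-1 * g)%g (act s^-1%g b)) = (fun b => P F (act s^-1%g b)) %[ae nu].

Lemma averaged_entry_translate T xi eta h : bounded_operators T ->
  {ae nu, forall b, averaged_entry T (right_translation h xi) (right_translation h eta) b =
    averaged_entry T xi eta (act h b)}.
Proof.
move=> Tb; have := P_equiv h^-1%g (lift_Linf_prod (pairing_bounded xi eta Tb)).
rewrite invgK => e; apply: filterS e => b /(_ I) e'; apply: etrans _ e'.
congr (P _ b); apply/funext => x; apply/funext => b'.
by rewrite /lift /pairing !right_translationM.
Qed.

Lemma averaged_covariant T W : bounded_operators T -> averaged T W ->
  covariant (fun g => averaged_entry T (basis R g^-1%g) (basis R 1%g)) W.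
Proof.
move=> Tb [Wb WE]; split=> // [g|i j u]; first exact: averaged_entry_Linf.
rewrite WE; apply: mul_operator_ext; first exact: averaged_entry_Linf.
  by apply: Linf_act; exact: averaged_entry_Linf.
have := averaged_entry_translate (basis R (i * j^-1)^-1%g) (basis R 1%g) i Tb.
by rewrite /basis !right_translation_single mul1g invgM invgK mulgVK.
Qed.

End equivariant_expectation.

(** * Positive contractions, states and almost everywhere inequalities *)

Section positive_operators.
Variables (R : realType) (H : innerProductSpace R).
Implicit Types (c : H -> H).

Lemma positive_selfadjoint c : linear c -> positive_operator c -> is_adjoint c c.
Proof.
move=> cl cp x y; rewrite [RHS]dotC.
have im z : Im '[c z, z] = 0 by have := cp z; rewrite lecE => /andP[/eqP].
have h1 := im (x + y); have h2 := im (x + 'i%C *: y).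
move: h1 h2; rewrite !(linear_opD _ _ cl) (linear_opZ _ _ cl) !dotDl !dotDr !dotZl !dotZr.
rewrite !(ReD, ImD, ReM, ImM, ReJ, ImJ, ReN, ImN) /= !im => h1 h2.
by apply: complex_ext; rewrite ?ReJ ?ImJ; lra.
Qed.

(** [c - c ^ 2 = c * (1 - c) * c + (1 - c) * c * (1 - c)] is positive. *)
Lemma sqn_positive_contraction_le c x : linear c -> positive_operator c ->
  positive_operator (fun x => x - c x) -> sqn (c x) <= Re '[c x, x].
Proof.
move=> cl cp cp'; have ca := positive_selfadjoint cl cp.
have h1 := cp' (c x); have h2 := cp (x - c x).
have : 0 <= '[c x - c (c x), c x] + '[c (x - c x), x - c x] by exact: addr_ge0.
rewrite (linear_opB _ _ cl) -dotDr addrCA subrr addr0 dotBl (ca (c x)) lecE => /andP[_].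
by rewrite ReD ReN subr_ge0.
Qed.

Definition unit_interval c := positive_operator c /\ positive_operator (fun x => x - c x).

Lemma state_unit_interval (C : set (H -> H)) phi c : unital_star_subalgebra C ->
  state_on C phi -> C c -> unit_interval c -> 0 <= Re (phi c) <= 1 /\ Im (phi c) = 0.
Proof.
move=> [Cb C1 Clin _ _] [phil phi1 phip] Cc [cp cp'].
have Cc' : C (fun x => x - c x).
  rewrite (_ : (fun x => _) = fun x => (-1) *: c x + idfun x); first exact: Clin.
  by apply/funext => x /=; rewrite scaleN1r addrC.
have := phip _ Cc' cp'; have := phip _ Cc cp.
rewrite (_ : (fun x => x - c x) = fun x => (-1) *: c x + idfun x); last first.
  by apply/funext => x /=; rewrite scaleN1r addrC.
rewrite phil// phi1 mulN1r !lecE ImD ReD ImN ReN /= => /andP[/eqP-> ->] /andP[_ h].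
by split=> //; move: h; lra.
Qed.

(** The operator [h = c' - c + e] is positive. *)
Lemma state_Re_le (C : set (H -> H)) phi c c' (e : R) : unital_star_subalgebra C ->
  state_on C phi -> C c -> C c' -> positive_operator c -> positive_operator c' ->
  0 <= e -> (forall x, sqn (c x - c' x) <= e ^+ 2 * sqn x) ->
  Re (phi c) <= Re (phi c') + e.
Proof.
move=> [Cb C1 Clin _ _] [phil phi1 phip] Cc Cc' cp cp' e0 cc'.
(* [h] and its parts have the form [a *: S x + T x] for which linearity is stated *)
pose h := fun x => (-1) *: c x + ((1 : R[i]) *: c' x + (e%:C%C *: x + 0 *: x)).
have C0 : C (fun x => e%:C%C *: x + 0 *: x).
  rewrite (_ : (fun x => _) = (fun x => (e%:C%C - 1) *: idfun x + idfun x)).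
    exact: Clin.
  by apply/funext => x /=; rewrite scale0r addr0 scalerBl scale1r subrK.
have C' : C (fun x => (1 : R[i]) *: c' x + (e%:C%C *: x + 0 *: x)) by exact: Clin.
have Ch : C h by exact: Clin.
have hp : positive_operator h.
  move=> x; rewrite /h scale0r addr0 scale1r scaleN1r !dotDl linearNl dotZl dot_sqn.
  have imc : Im '[c x, x] = 0 by have := cp x; rewrite lecE => /andP[/eqP].
  have imc' : Im '[c' x, x] = 0 by have := cp' x; rewrite lecE => /andP[/eqP].
  rewrite lecE !(ReD, ImD, ReM, ImM, ReN, ImN) /= imc imc'.
  apply/andP; split; first by apply/eqP; lra.
  have : Re '[c x - c' x, x] <= e * sqn x.
    apply: Re_le_sqrt; first by rewrite mulr_ge0 ?sqn_ge0.
    apply: le_trans (dot_normsq_le _ _) _.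
    by rewrite exprMn [in leRHS]expr2 mulrA ler_wpM2r ?sqn_ge0//; rewrite -expr2.
  by rewrite dotBl ReD ReN; lra.
have := phip h Ch hp; rewrite /h phil// phil//.
have -> : phi (fun x => e%:C%C *: x + 0 *: x) = e%:C%C.
  rewrite (_ : (fun x => _) = (fun x => (e%:C%C - 1) *: idfun x + idfun x)).
    by rewrite phil// phi1 mulr1 subrK.
  by apply/funext => x /=; rewrite scale0r addr0 scalerBl scale1r subrK.
rewrite lecE => /andP[_].
by rewrite !(ReD, ImD, ReM, ImM, ReN, ImN) /=; lra.
Qed.

Lemma opnorm_le_sqn c (e : R) x : 0 <= e -> opnorm_le c e -> sqn (c x) <= e ^+ 2 * sqn x.
Proof.
move=> e0 /(_ x) h.
rewrite -[sqn (c x)]sqr_sqrtr ?sqn_ge0// -[sqn x]sqr_sqrtr ?sqn_ge0//.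
by rewrite -exprMn ler_sqr ?nnegrE ?sqrtr_ge0// mulr_ge0 ?sqrtr_ge0.
Qed.

Lemma wot_closed_norm_closed (D : set (H -> H)) : wot_closed D -> norm_closed D.
Proof.
move=> Dw T Tb hT; apply: Dw => // n xi eta e e0.
pose s := \sum_i sqn (xi i) * sqn (eta i).
have s0 : 0 <= s by apply: sumr_ge0 => i _; rewrite mulr_ge0 ?sqn_ge0.
have d0 : 0 < e / (1 + s) by rewrite divr_gt0// ltr_wpDr.
have [S DS ST] := hT _ d0; exists S => // i; rewrite normc_lt// -dotBl.
apply: le_lt_trans (dot_normsq_le _ _) _.
have h := opnorm_le_sqn (xi i) (ltW d0) ST.
apply: (@le_lt_trans _ _ ((e / (1 + s)) ^+ 2 * s)).
  apply: le_trans (ler_wpM2r (sqn_ge0 _) h) _.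
  rewrite -mulrA ler_wpM2l ?sqr_ge0// /s (bigD1 i)//= lerDl.
  by apply: sumr_ge0 => j _; rewrite mulr_ge0 ?sqn_ge0.
have s1 : 0 < 1 + s by rewrite ltr_wpDr.
rewrite exprMn -mulrA -[ltRHS]mulr1 ltr_pM2l ?exprn_gt0//.
rewrite exprVn mulrC ltr_pdivrMr ?exprn_gt0// mul1r; nra.
Qed.

End positive_operators.

Section almost_everywhere.
Context d (B : measurableType d) (R : realType) (nu : probability B R).

Lemma ae_countable (T : Type) (D : set T) (Q : T -> B -> Prop) : countable D ->
  (forall x, D x -> {ae nu, forall b, Q x b}) ->
  {ae nu, forall b, forall x, D x -> Q x b}.
Proof.
move=> /countable_injP[f fi] DQ.
have h : {ae nu, forall b, forall n x, D x -> f x = n -> Q x b}.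
  apply: ae_foralln => n.
  have [[y [Dy fy]]|no] := pselect (exists y, D y /\ f y = n).
    apply: filterS (DQ y Dy) => b Qy x Dx fx.
    by rewrite (fi x y) ?inE// fx fy.
  by apply: nearW => b x Dx fx; case: no; exists x.
by apply: filterS h => b hb x Dx; exact: (hb (f x) x Dx).
Qed.

Lemma has_cintegral_pos (f : B -> R[i]) z : has_cintegral nu f z ->
  {ae nu, forall b, 0 <= f b} -> 0 <= z.
Proof.
move=> fz f0; rewrite lecE; apply/andP; split; last first.
  by apply: (has_cintegral_ge0 fz); apply: filterS f0 => b; rewrite lecE => /andP[].
have im b : 0 <= f b -> Im (f b) = 0 by rewrite lecE => /andP[/eqP].
have h1 := has_cintegral_ge0 (has_cintegralZ 'i%C fz).
have h2 := has_cintegral_ge0 (has_cintegralZ (- 'i%C) fz).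
apply/eqP/le_anti/andP; split.
  have := h1 _; rewrite ReM /= mul0r mul1r sub0r oppr_ge0; apply.
  by apply: filterS f0 => b /im e; rewrite ReM e /=; lra.
have : 0 <= Re (- 'i%C * z).
  by apply: h2; apply: filterS f0 => b /im e; rewrite ReM e /=; lra.
by rewrite ReM /=; lra.
Qed.

(** Tested on the indicator function of the set where [f] is negative. *)
Lemma ae_ge0_of_form (f : B -> R) : Linf nu (fun b => (f b)%:C%C) ->
  (forall u : L2 nu, 0 <= Re '[mul_operator (fun b => (f b)%:C%C) u, u]) ->
  {ae nu, forall b, 0 <= f b}.
Proof.
move=> Lf fpos; have mf : measurable_fun setT f by have [[]] := Lf.
pose E := [set b | f b < 0].
have mE : measurable E.
  rewrite (_ : E = setT `&` f @^-1` [set` Interval -oo%O (BLeft 0)]).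
    by apply: mf => //; exact: measurable_itv.
  by rewrite setTI; apply/seteqP; split=> b; rewrite /E /= in_itv.
have mi : cmeasurable (fun b => (\1_E b)%:C%C : R[i]).
  by apply: cmeasurable_real; exact: measurable_indic.
pose u := L2_mk nu (fun b => (\1_E b)%:C%C).
have uE : {ae nu, forall b, rep u b = (\1_E b)%:C%C}.
  apply: rep_L2_mk => //.
  apply: (@le_lt_trans _ _ (\int[nu]_b (cst 1%E b))%E).
    apply: ge0_le_integral => //.
    - by move=> b _; rewrite lee_fin normsq_ge0.
    - by apply/measurable_EFinP; exact: measurable_normsq.
    - move=> b _; rewrite normsq_real lee_fin indicE.
      by case: (_ \in _); rewrite ?expr1n ?expr0n.
  by rewrite integral_cst// mul1e; apply: le_lt_trans (probability_le1 nu _) (ltry _).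
have h := has_cintegral_mul u u Lf.
have hN := has_cintegralZ (-1) h.
have ptw : {ae nu, forall b, Re (-1 * ((f b)%:C%C * (rep u b * Num.conj (rep u b)))) =
    - f b * \1_E b}.
  apply: filterS uE => b ->; rewrite mulcJ normsq_real mulN1r ReN ReZ /= indicE mulNr.
  by case: (_ \in _); rewrite ?expr1n ?expr0n.
have z0 : Re (-1 * '[mul_operator (fun b => (f b)%:C%C) u, u]) = 0.
  apply/le_anti/andP; split.
    by rewrite mulN1r ReN oppr_le0.
  apply: (has_cintegral_ge0 hN); apply: filterS ptw => b ->.
  rewrite indicE; case: (boolP (b \in E)) => bE; rewrite ?mulr0// mulr1 oppr_ge0.
  by move: bE; rewrite inE => /ltW.
have := has_cintegral_eq0 hN _ z0.
have ge : {ae nu, forall b, 0 <= Re (-1 * ((f b)%:C%C * (rep u b * Num.conj (rep u b))))}.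
  apply: filterS ptw => b ->; rewrite indicE; case: (boolP (b \in E)) => bE.
    by rewrite mulr1 oppr_ge0; move: bE; rewrite inE => /ltW.
  by rewrite mulr0.
move=> /(_ ge) e; apply: filterS2 e ptw => b -> /esym.
rewrite indicE; case: (boolP (b \in E)) => bE.
  by rewrite mulr1 => /eqP; rewrite oppr_eq0 => /eqP ->.
by move=> _; rewrite leNgt; apply: contra bE => lt; rewrite inE.
Qed.

End almost_everywhere.

(** * Conjugation by translations *)

Section conjugation.
Variables (R : realType) (Gamma : groupType) (K : innerProductSpace R).
Implicit Types (T c : l2 Gamma K -> l2 Gamma K) (g : Gamma).

Lemma conj_actionK g T : conj_action g (conj_action g^-1%g T) = T.
Proof.
apply/funext => x; rewrite /conj_action /= invgK.
by rewrite translationVK translationVK.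
Qed.

Lemma conj_action_dot g T x y : '[conj_action g T x, y] =
  '[T (translation g^-1%g x), translation g^-1%g y].
Proof. by rewrite /conj_action /= -[y in LHS](translationVK g) translation_dot. Qed.

Lemma conj_action_bounded g T : bounded_operators T -> bounded_operators (conj_action g T).
Proof.
move=> Tb; apply: (bounded_comp (bounded_comp (translation_bounded _ g) Tb)).
exact: translation_bounded.
Qed.

Lemma conj_actionE g T x : conj_action g T x = translation g (T (translation g^-1%g x)).
Proof. by []. Qed.

Lemma conj_action_mem (D : set (l2 Gamma K -> l2 Gamma K)) g T :
  unital_star_subalgebra D -> D (translation g) -> D (translation g^-1%g) -> D T ->
  D (conj_action g T).
Proof. by move=> [_ _ _ Dmul _] Dg Dg' DT; apply: (Dmul _ _ (Dmul _ _ Dg DT) Dg'). Qed.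

Lemma conj_action_commutes g T Y : T \o conj_action g^-1%g Y = conj_action g^-1%g Y \o T ->
  conj_action g T \o Y = Y \o conj_action g T.
Proof.
move=> e; apply/funext => x; rewrite /= !conj_actionE -[Y in LHS](conj_actionK g).
rewrite conj_actionE translationK.
have /(congr1 (@^~ (translation g^-1%g x))) /= -> := e.
by rewrite [in LHS]conj_actionE invgK translationVK.
Qed.

Lemma conj_action_unit_interval g c : unit_interval c -> unit_interval (conj_action g c).
Proof.
move=> [cp cp']; split=> x; first by rewrite conj_action_dot; exact: cp.
have := cp' (translation g^-1%g x); rewrite !dotBl conj_action_dot.
by rewrite (translation_dot g^-1%g x x).
Qed.

Lemma sqn_conj_action_le g c c' (e : R) :
  (forall x, sqn (c x - c' x) <= e * sqn x) ->
  forall x, sqn (conj_action g c x - conj_action g c' x) <= e * sqn x.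
Proof.
move=> h x; rewrite /conj_action /= -(linear_opB _ _ (@translation_linear _ _ K g)).
by rewrite sqn_translation; apply: le_trans (h _) _; rewrite sqn_translation.
Qed.

End conjugation.

(** Elementary inequalities behind the estimates on Fourier coefficients. *)

Lemma form_combination (R : realType) (N C r1 r2 r3 : R) :
  N * r3 <= 2 * C * (r3 - r2 + r1) ->
  0 <= - (2 * C) * r2 + (2 * C * r1 + (2 * C - N) * r3).
Proof. lra. Qed.

Lemma double_sum_le (R : realType) (a b e S : R) :
  a <= e ^+ 2 * S -> b <= e ^+ 2 * S -> (a + b) *+ 2 <= (2 * e) ^+ 2 * S.
Proof. by move=> ha hb; rewrite mulr2n exprMn; lra. Qed.

Lemma interval_perturbation (R : realType) (C e eps t1 t2 t3 t4 : R) : 0 <= C ->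
  t1 <= t2 + 2 * e -> t4 <= t3 + 2 * e -> 8 * C * e <= eps ->
  2 * C * (1 - t2 + t4) <= 2 * C * (1 - t1 + t3) + eps.
Proof.
move=> C0 h1 h2 h4.
have : C * (t4 - t3 + (t1 - t2)) <= C * (2 * e + 2 * e) by rewrite ler_wpM2l//; lra.
lra.
Qed.

Lemma interval_limit (R : realType) (C dl eps a b : R) : 0 <= C -> 0 < dl ->
  - dl < a - 1 -> b - 0 < dl -> dl * (4 * C + 1) = eps -> 2 * C * (1 - a + b) <= eps.
Proof.
move=> C0 d0 ha hb <-.
have : C * (1 - a + b) <= C * (2 * dl) by rewrite ler_wpM2l//; lra.
lra.
Qed.

Lemma divide_by_square (R : realType) (N S C p q d1 d2 : R) : 0 <= S -> S != 0 ->
  N * S ^+ 2 <= 2 * (p + q) -> p <= C * S * d1 -> q <= C * d2 * S ->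
  N * S <= 2 * C * (d1 + d2).
Proof.
move=> S0 Sn h p1 q1; have Sp : 0 < S by rewrite lt0r Sn.
rewrite -(ler_pM2r Sp) -[leLHS]mulrA -expr2; apply: le_trans h _.
rewrite (_ : 2 * C * (d1 + d2) * S = 2 * (C * S * d1 + C * d2 * S)); last by ring.
by rewrite ler_pM2l// lerD.
Qed.

Lemma ae_exists d (B : measurableType d) (R : realType) (nu : probability B R)
  (Q : B -> Prop) : {ae nu, forall b, Q b} -> exists b, Q b.
Proof.
move=> [N [mN N0 QN]]; apply: contrapT => noQ.
have NT : N = setT by apply/seteqP; split=> // b _; apply: QN => Qb; apply: noQ; exists b.
have : nu setT = 1%E := probability_setT nu.
by rewrite -NT N0 => /esym/eqP; rewrite onee_eq0.
Qed.

Lemma normsq_lt_Re (R : realType) (z : R[i]) (e : R) : 0 < e -> normsq z < e ^+ 2 ->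
  - e < Re z < e.
Proof.
move=> e0 /(le_lt_trans (Re_le_normsq z)).
by rewrite -[Re z ^+ 2]real_normK ?num_real// ltr_sqr ?nnegrE ?(ltW e0)// ltr_norml.
Qed.

Lemma exists_inv_lt (R : realType) (e : R) : 0 < e -> exists n : nat, n.+1%:R^-1 < e.
Proof.
move=> e0; exists (Num.truncn e^-1).
by rewrite invf_plt ?posrE//; exact: truncnS_gt.
Qed.

(** * Fourier coefficients in the singular case *)

Section amplified_commutant.
Context d (B : measurableType d) (R : realType) (Gamma : groupType).
Context (nu : probability B R) (act : Gamma -> B -> B).
Notation H := (ell2 R Gamma).
Variable A : set (H -> H).
Hypothesis A_star : unital_star_subalgebra A.
Hypothesis A_vN : A `<=` group_vN R Gamma.
Hypothesis A_inv : conj_invariant A.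
Hypothesis amplification : forall X, bounded_operators X -> right_equivariant X ->
  exists Y : l2 Gamma (L2 nu) -> l2 Gamma (L2 nu), amplifies X Y.

Lemma subalgebra_bounded X : A X -> bounded_operators X.
Proof. by case: A_star => Ab _ _ _ _; exact: Ab. Qed.

Lemma subalgebra_right_equivariant X : A X -> right_equivariant X.
Proof.
move=> /A_vN/group_vN_right_equivariant[_ h] x xi.
have /(congr1 (@^~ xi)) := h _ (ex_intro2 _ _ x I erefl).
by [].
Qed.

Lemma subalgebra_adjoint X : A X -> exists2 X', A X' & is_adjoint X X'.
Proof.
move=> AX; have [X' XX'] := adjoint_exists (l2_hilbert (I := Gamma) (@scalar_hilbert R)) (subalgebra_bounded AX).
by exists X' => //; case: A_star => _ _ _ _ h; exact: h XX'.
Qed.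

Definition amplified : set (l2 Gamma (L2 nu) -> l2 Gamma (L2 nu)) :=
  [set Y | exists2 X, A X & amplifies X Y].

Lemma amplified_commutant_vN : vN_subalgebra (commutant amplified).
Proof.
apply: commutant_vN_subalgebra; first by move=> Y [X _ []].
move=> Y [X AX XY]; have [Yb _] := XY.
have [X' AX' XX'] := subalgebra_adjoint AX.
have [Y' YY'] := adjoint_exists (l2_hilbert (I := Gamma) (L2_hilbert (nu := nu))) Yb.
exists Y'; last exact: YY'.
by exists X'; [exact: AX'|exact: (amplifies_adjoint XY XX' YY')].
Qed.

(** The algebra to which the SH-property is applied; it contains the averages of the
    operators that commute with [A]. *)
Definition relative_commutant := commutant amplified `&` crossed_product act.

Lemma relative_commutant_vN : vN_subalgebra relative_commutant.
Proof. exact: vN_generated_inter amplified_commutant_vN. Qed.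

Lemma amplified_conj g Y : amplified Y -> amplified (conj_action g Y).
Proof.
move=> [X AX [Yb YE]]; exists (conj_action g X); first exact: A_inv.
split; first exact: conj_action_bounded.
move=> k u; rewrite conj_actionE translation_single YE translation_tensor.
by rewrite [in RHS]conj_actionE /basis translation_single.
Qed.

Lemma relative_commutant_conj : conj_invariant relative_commutant.
Proof.
move=> g T [[Tb TY] Tcp]; split; first split.
- exact: conj_action_bounded.
- move=> Y AY; apply: conj_action_commutes; apply: TY; exact: amplified_conj.
move=> D DG; have [[Dstar _] gen] := DG.
have Dg k : D (translation k) by apply: gen; right; exists k.
by apply: (conj_action_mem Dstar (Dg _) (Dg _)); exact: Tcp.
Qed.

(** The coefficient of [lambda s] in the expansion of an element [X] of L(Gamma). It is
    read in the row of the unit because the canonical expectation is the entry at the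
    unit of an operator. *)
Definition fourier X (s : Gamma) : R[i] :=
  @coord R Gamma (scalar_space R) (X (basis R s^-1%g)) 1%g.

Lemma coord_right_equivariant X k h : right_equivariant X ->
  (coord (X (basis R k)) h : R[i]) = fourier X (h * k^-1)%g.
Proof.
move=> Xr; rewrite /fourier invgM invgK.
have -> : basis R k = right_translation h (basis R (k * h^-1)%g).
  by rewrite /basis right_translation_single mulgVK.
have := coord_right_translation h (X (basis R (k * h^-1)%g)) h.
by rewrite mulgV Xr.
Qed.

Lemma scalar_of_fourier X : bounded_operators X -> right_equivariant X ->
  (forall s, s != 1%g -> fourier X s = 0) -> forall x, X x = fourier X 1%g *: x.
Proof.
move=> Xb Xr X0; set z := fourier X 1%g.
have zb : bounded_operators (fun x : H => z *: x).
  apply/bounded_operatorsP; split.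
    by move=> a x y; rewrite scalerDr !scalerA mulrC.
  by exists (normsq z); [exact: normsq_ge0|move=> x; rewrite sqn_scale].
suff -> : X = (fun x : H => z *: x) by [].
apply: bounded_operator_ext; [exact: scalar_hilbert|exact: Xb|exact: zb|].
move=> k c; rewrite (single_basis _ c) (linear_opZ _ _ (bounded_linear Xb)).
rewrite [RHS]scalerA [z * _]mulrC -scalerA; congr (_ *: _).
apply: coord_ext => h; apply: etrans (coord_right_equivariant _ _ Xr) _.
apply: etrans _ (esym (congr1 (fun w => z * w) (coord_basis R k h))).
case: eqVneq => [->|hk]; first by rewrite mulgV mulr1.
rewrite mulr0 X0//; apply: contra hk => /eqP e.
by rewrite -[h](mulgVK k) e mul1g.
Qed.

(** Let [e] and [w] be [u] placed at [s^-1] and at the unit. Then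
    ['[Y e, w] = fourier X s * '[u, u]], and since [c] commutes with [Y] the left-hand
    side is ['[Y e, w - c w] + '[Y (c e), w]]. Both terms are estimated by the
    Cauchy-Schwarz inequality: [sqn (w - c w)] is at most ['[w - c w, w]] because [1 - c]
    is a positive contraction, and [sqn (c e)] is [sqn (c' w)], where [c'] is the
    conjugate of [c] by [s], hence at most ['[c' w, w]]. *)
Lemma fourier_le_on_vectors X (Y c : l2 Gamma (L2 nu) -> l2 Gamma (L2 nu)) C0 s
    (u : L2 nu) : amplifies X Y -> 0 <= C0 ->
  (forall x, sqn (Y x) <= C0 * sqn x) -> bounded_operators c -> unit_interval c ->
  c \o Y = Y \o c ->
  normsq (fourier X s) * sqn u <= 2 * C0 *
    (sqn u - Re '[cond_exp c u, u] + Re '[cond_exp (conj_action s c) u, u]) :> R.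
Proof.
move=> [Yb YE] C00 YC cb cI cY; have [cl _] := cb; have [cp cp'] := cI.
pose e : l2 Gamma (L2 nu) := single s^-1%g u.
pose w : l2 Gamma (L2 nu) := single 1%g u.
have ew : e = translation s^-1%g w by rewrite /e /w translation_single mulg1.
pose c' := conj_action s c.
have cb' : bounded_operators c' by exact: conj_action_bounded.
have [cp1 cp1'] : unit_interval c' by exact: conj_action_unit_interval.
have Ew : '[Y e, w] = fourier X s * '[u, u].
  rewrite /e YE; apply: etrans (dot_single _ _ _) _.
  by apply: etrans (congr1 (fun z => '[z, u]) (tensor_coord _ _ _)) _; exact: dotZl.
have ce : sqn (c e) = sqn (c' w).
  by rewrite ew /c' /conj_action /= sqn_translation.
have split_dot : '[Y e, w] = '[Y e, w - c w] + '[Y (c e), w].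
  have /(congr1 (@^~ e)) cYe := cY.
  have -> : '[Y (c e), w] = '[Y e, c w].
    by rewrite -[Y (c e)]cYe; exact: (positive_selfadjoint cl cp).
  by rewrite -dotDr subrK.
have h1 : sqn (w - c w) <= sqn u - Re '[cond_exp c u, u].
  have cl2 : linear (fun x => x - c x).
    by move=> a x y; rewrite cl scalerBr opprD addrACA.
  have cp2 : positive_operator (fun x => x - (x - c x)).
    by move=> x; rewrite opprB addrCA subrr addr0; exact: cp.
  apply: le_trans (sqn_positive_contraction_le w cl2 cp' cp2) _.
  rewrite dotBl ReD ReN le_eqVlt; apply/orP; left; apply/eqP; congr (_ - Re _).
    exact: sqn_single.
  exact: dot_single.
have h2 : sqn (c' w) <= Re '[cond_exp c' u, u].
  apply: le_trans (sqn_positive_contraction_le w (bounded_linear cb') cp1 cp1') _.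
  by rewrite le_eqVlt; apply/orP; left; apply/eqP; congr (Re _); exact: dot_single.
have sw : sqn w = sqn u by exact: sqn_single.
have sw' : sqn w <= sqn u by rewrite sw; exact: lexx.
have se : sqn e = sqn u by exact: sqn_single.
have Ye : sqn (Y e) <= C0 * sqn u by rewrite -se; exact: YC.
have Yce : sqn (Y (c e)) <= C0 * Re '[cond_exp c' u, u].
  by apply: le_trans (YC _) (ler_wpM2l C00 _); rewrite ce.
have h3 := dot_normsq_le_bound Ye h1.
have h4 := dot_normsq_le_bound Yce sw'.
have h5 : normsq (fourier X s) * sqn u ^+ 2 =
    normsq (1 * '[Y e, w - c w] + '[Y (c e), w]).
  by rewrite mul1r -split_dot Ew dot_sqn normsqM normsq_real.
have h6 := normsq_lin_le 1 '[Y e, w - c w] '[Y (c e), w].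
rewrite -h5 (_ : normsq 1 = 1) ?mul1r in h6; last by rewrite /normsq /= expr0n expr1n addr0.
have [/sqn_eq0 u0|u0] := eqVneq (sqn u) 0.
  rewrite u0 !dot0r sqn0 subr0 addr0 !mulr0; exact: lexx.
exact: (divide_by_square (sqn_ge0 u) u0 h6 h3 h4).
Qed.

(** Testing [fourier_le_on_vectors] on all [u] gives, for each [c] in the unit interval
    of the dense C*-algebra [C], a pointwise inequality [na <= q c b] for almost all [b].
    By separability there is one [b] at which it holds for all [c] and at which
    [theta b] is singular to its translate by [s]; the net that witnesses this makes
    [q c b] tend to 0. *)
Lemma singular_fourier_eq0 X s : A X -> s != 1%g ->
  gamma_singular act relative_commutant (@cond_exp R Gamma _ _ nu) -> fourier X s = 0.
Proof.
move=> AX s1 [C [theta [[[C_star C_closed] [CN _] C_inv [D [Dc DC Ddense]]]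
  [theta_state theta_meas _] theta_exp sing]]].
have [Cb C1 _ _ _] := C_star.
have Xb := subalgebra_bounded AX.
have [Y XY] := amplification Xb (subalgebra_right_equivariant AX); have [Yb _] := XY.
have [_ [C0 C00 YC]] := iffLR (bounded_operatorsP _) Yb.
set na := normsq (fourier X s).
have na0 : 0 <= na by exact: normsq_ge0.
pose q c b := 2 * C0 * (1 - Re (theta b c) + Re (theta b (conj_action s c))).
have Cs g c : C c -> C (conj_action g c) by exact: C_inv.
have theta_int c b : C c -> unit_interval c ->
    0 <= Re (theta b c) <= 1 /\ Im (theta b c) = 0.
  by move=> Cc cI; exact: state_unit_interval C_star (theta_state b) Cc cI.
have theta_real c b : C c -> unit_interval c -> theta b c = (Re (theta b c))%:C%C.
  by move=> Cc cI; apply: complex_ext => //=; exact: (theta_int c b Cc cI).2.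
have theta_Linf c : C c -> unit_interval c -> Linf nu (fun b => theta b c).
  move=> Cc cI; apply/LinfP; split; first exact: theta_meas.
  exists 1; apply: nearW => b; rewrite theta_real// normsq_real.
  by have [/andP[h0 h1] _] := theta_int c b Cc cI; exact: exprn_ile1.
have pointwise c : C c -> unit_interval c -> {ae nu, forall b, na <= q c b}.
  move=> Cc cI; have Csc := Cs s c Cc; have scI := conj_action_unit_interval s cI.
  pose f b := - (2 * C0) * Re (theta b c) +
    (2 * C0 * Re (theta b (conj_action s c)) + (2 * C0 - na)).
  have fE : (fun b => (f b)%:C%C) = (fun b => (- (2 * C0))%:C%C * theta b c +
      ((2 * C0)%:C%C * theta b (conj_action s c) + (2 * C0 - na)%:C%C)).
    apply/funext => b; rewrite (theta_real c)// (theta_real (conj_action s c))//.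
    by rewrite -!rmorphM -!rmorphD.
  have Lc := theta_Linf c Cc cI; have Lsc := theta_Linf _ Csc scI.
  have L1 := Linf_cst nu (2 * C0 - na)%:C%C.
  have L2 := Linf_lin (2 * C0)%:C%C Lsc L1.
  have fpos : {ae nu, forall b, 0 <= f b}.
    apply: ae_ge0_of_form => [|u]; first by rewrite fE; exact: Linf_lin.
    rewrite fE (mul_operator_lin _ _ Lc L2) (mul_operator_lin _ _ Lsc L1).
    rewrite mul_operator_cst !dotDl !dotZl !(ReD, ReZ) -/(sqn u).
    have cY : c \o Y = Y \o c by apply: (CN _ Cc).1.2; exists X.
    have := fourier_le_on_vectors s u XY C00 YC (Cb _ Cc) cI cY.
    rewrite (theta_exp c Cc) (theta_exp _ Csc) -/na.
    exact: form_combination.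
  apply: filterS fpos => b; rewrite /f /q.
  move: (Re (theta b c)) (Re (theta b (conj_action s c))) => t t'.
  rewrite -subr_ge0 => h; rewrite -subr_ge0; apply: le_trans h _.
  by rewrite le_eqVlt; apply/orP; left; apply/eqP; ring.
pose e n : R := n.+1%:R^-1.
have e0 n : 0 < e n by rewrite invr_gt0.
(* the elements of the countable dense set [D] need not be between 0 and 1, so for each
   precision a nearby element that is between 0 and 1 is picked when there is one *)
have /choice[pick pickP] : forall p : (l2 Gamma (L2 nu) -> l2 Gamma (L2 nu)) * nat,
    exists c, (C c /\ unit_interval c) /\
      ((exists2 c0, C c0 /\ unit_interval c0 & opnorm_le (fun x => c0 x - p.1 x) (e p.2)) ->
       opnorm_le (fun x => c x - p.1 x) (e p.2)).
  move=> p; have [[c0 c0I c0p]|no] := pselect (exists2 c0, C c0 /\ unit_interval c0 &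
      opnorm_le (fun x => c0 x - p.1 x) (e p.2)); first by exists c0.
  exists idfun; split=> //; split=> //; split=> x.
    by rewrite dot_sqn ler0c sqn_ge0.
  by rewrite subrr dot0l.
have ae_pick : {ae nu, forall b, forall c, D c -> forall n, na <= q (pick (c, n)) b}.
  apply: ae_countable => // c Hc; apply: ae_foralln => n.
  by apply: pointwise; [exact: (pickP (c, n)).1.1|exact: (pickP (c, n)).1.2].
have [b [b_pick b_sing]] := ae_exists (filterI ae_pick sing).
have dense c : C c -> unit_interval c -> na <= q c b.
  move=> Cc cI; apply/ler_addgt0Pr => eps eps0.
  have K0 : 0 < 8 * C0 + 1 by rewrite ltr_wpDl// mulr_ge0.
  have [n nP] := exists_inv_lt (divr_gt0 eps0 K0).
  have [d' Dd' cd'] := Ddense c Cc (e n) (e0 n).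
  have [[Cp pI] pn] := pickP (d', n); set c' := pick (d', n) in Cp pI pn.
  have {pn} c'd : opnorm_le (fun x => c' x - d' x) (e n) by apply: pn; exists c.
  have close x : sqn (c x - c' x) <= (2 * e n) ^+ 2 * sqn x.
    have -> : c x - c' x = (c x - d' x) - (c' x - d' x) by rewrite opprB addrA subrK.
    apply: le_trans (sqn_addle _ _) _; rewrite sqnN.
    have h1 := opnorm_le_sqn x (ltW (e0 n)) cd'.
    have h2 := opnorm_le_sqn x (ltW (e0 n)) c'd.
    exact: double_sum_le h1 h2.
  have close' x : sqn (conj_action s c' x - conj_action s c x) <= (2 * e n) ^+ 2 * sqn x.
    by apply: sqn_conj_action_le => y; rewrite sqnB_sym.
  have en0 : 0 <= 2 * e n by rewrite mulr_ge0 ?ltW.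
  have h1 := state_Re_le C_star (theta_state b) Cc Cp cI.1 pI.1 en0 close.
  have h2 := state_Re_le C_star (theta_state b) (Cs s _ Cp) (Cs s _ Cc)
    (conj_action_unit_interval s pI).1 (conj_action_unit_interval s cI).1 en0 close'.
  have h3 := b_pick _ Dd' n; apply: le_trans h3 _; rewrite -/c' /q.
  have h4 : 8 * C0 * e n <= eps.
    rewrite ltr_pdivlMr// in nP; apply: le_trans (ltW nP).
    by rewrite mulrC ler_wpM2l ?ltW// ltrDl.
  exact: (interval_perturbation C00 h1 h2 h4).
apply: normsq_eq0; apply/eqP; rewrite eq_le na0 andbT.
apply/ler_addgt0Pr => eps eps0; rewrite add0r.
have K0 : 0 < 4 * C0 + 1 by rewrite ltr_wpDl// mulr_ge0.
have d0 := divr_gt0 eps0 K0; set delta := eps / _ in d0.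
have [I [le [ai [[_ _ trans dir] aiP cvg1 cvg0]]]] := b_sing s s1.
have [i1 i1P] := cvg1 _ d0; have [i0 i0P] := cvg0 _ d0.
have [i [li1 li0]] := dir i1 i0.
have [Ca ap ap'] := aiP i.
have aI : unit_interval (ai i) by [].
(* [s^-1 . ai i] in place of [c] turns [q] into
   [2 * C0 * (1 - (s . theta b) (ai i) + theta b (ai i))], up to real parts *)
have := dense _ (Cs s^-1%g _ Ca) (conj_action_unit_interval s^-1%g aI).
rewrite /q conj_actionK.
have := i1P i li1; rewrite /state_action (normc_lt _ d0) => /(normsq_lt_Re d0)/andP[+ _].
rewrite ReD ReN /= => h1.
have := i0P i li0; rewrite (normc_lt _ d0) => /(normsq_lt_Re d0)/andP[_ +].
rewrite ReD ReN /= => h0 h; apply: le_trans h _.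
apply: (interval_limit C00 d0 h1 h0).
by rewrite /delta divfK// gt_eqF.
Qed.

End amplified_commutant.

(** * The invariant state *)

Section constant_function.
Context d (B : measurableType d) (R : realType) (nu : probability B R).

Definition L2_one : L2 nu := L2_mk nu (fun=> 1).

Lemma rep_one : {ae nu, forall b, rep L2_one b = 1}.
Proof.
apply: rep_L2_mk; first exact: cmeasurable_cst.
rewrite (_ : (fun _ : B => _) = cst (normsq (1 : R[i]))%:E)//.
by rewrite integral_cst// lte_mul_pinfty// ?lee_fin ?normsq_ge0//;
  apply: le_lt_trans (probability_le1 nu _) (ltry _).
Qed.

Lemma dot_one : '[L2_one, L2_one] = 1.
Proof.
have h := has_cintegral_dot L2_one L2_one.
have h1 : has_cintegral nu (fun=> 1) '[L2_one, L2_one].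
  apply: has_cintegral_ae h; first exact: cmeasurable_cst.
  by apply: filterS rep_one => b ->; rewrite conjC1 mulr1.
rewrite -h1.2; apply: complex_ext; rewrite /cRintegral /= Rintegral_cst//.
  rewrite (_ : fine _ = 1) ?mulr1//.
  by transitivity (fine (1%:E : \bar R)) => //; congr fine; exact: probability_setT.
by rewrite mul0r.
Qed.

Lemma mul_operator_scalar f c : Linf nu f ->
  (forall u : L2 nu, mul_operator f u = c *: u) -> {ae nu, forall b, f b = c}.
Proof.
move=> Lf fc; have := rep_mul L2_one Lf; rewrite fc => h.
apply: filterS3 h rep_one (repZ c L2_one) => b h1 e h2.
by move: h1; rewrite h2 e !mulr1 => ->.
Qed.

Lemma mul_operator_pos f (u : L2 nu) : Linf nu f -> {ae nu, forall b, 0 <= f b} ->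
  0 <= '[mul_operator f u, u].
Proof.
move=> Lf f0; apply: (has_cintegral_pos (has_cintegral_mul u u Lf)).
apply: filterS f0 => b h; rewrite mulr_ge0// mulcJ ler0c; exact: normsq_ge0.
Qed.

End constant_function.

(** For [T] commuting with [A], [f T] is the entry at the unit of the average of [T], that
    is, its image by the canonical expectation; the state is the integral of [f T]. *)
Lemma co_amenable_of_SH (R : realType) (Gamma : groupType) d (B : measurableType d)
    (nu : probability B R) (act : Gamma -> B -> B)
    (A : set (ell2 R Gamma -> ell2 R Gamma)) :
  nonsingular_space nu act -> SH_property nu act -> zimmer_amenable nu act ->
  unital_star_subalgebra A -> A `<=` group_vN R Gamma -> conj_invariant A ->
  A <> scalar_operators (ell2 R Gamma) -> co_amenable A.
Proof.
move=> ns [_ SH] [P [PL _ Plin Ppos [Pid Pmod Pequiv]]] A_star A_vN A_inv A_nontriv.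
have amp X : bounded_operators X -> right_equivariant X ->
    exists Y : l2 Gamma (L2 nu) -> l2 Gamma (L2 nu), amplifies X Y.
  exact: (amplification_exists PL Plin Ppos Pid Pmod).
have NvN := relative_commutant_vN nu act A_star.
have Ninv := @relative_commutant_conj _ _ _ _ nu act _ A_inv.
have Nsub : relative_commutant act A `<=` crossed_product (nu := nu) act by move=> T [].
have [sing|scal] := SH _ NvN Nsub Ninv.
  exfalso; apply: A_nontriv; apply/seteqP; split=> [X AX|X [z Xz]].
    have Xb := subalgebra_bounded A_star AX; have Xr := subalgebra_right_equivariant A_vN AX.
    exists (fourier X 1%g); apply: (scalar_of_fourier Xb Xr) => s s1.
    exact: (singular_fourier_eq0 A_star A_vN amp AX s1 sing).
  have [_ A1 Alin _ _] := A_star.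
  rewrite (_ : X = fun x => (z - 1) *: idfun x + idfun x); first exact: Alin.
  by apply/funext => x; rewrite Xz /= scalerBl scale1r subrK.
have Pcst := P_constant Pid.
pose f T := averaged_entry P T (basis R (1%g : Gamma)) (basis R 1%g).
have Lf T : bounded_operators T -> Linf nu (f T) by exact: averaged_entry_Linf.
pose one := L2_one nu.
exists (fun T => '[mul_operator (f T) one, one]); split.
  split.
  - move=> a S T [Sb _] [Tb _].
    have e : mul_operator (f (fun x => a *: S x + T x)) one =
        a *: mul_operator (f S) one + mul_operator (f T) one.
      rewrite -(mul_operator_lin a one (Lf _ Sb) (Lf _ Tb)).
      apply: (mul_operator_ext one (Lf _ (bounded_lin a Sb Tb))).
        exact: (Linf_lin a (Lf _ Sb) (Lf _ Tb)).
      exact: averaged_entry_lin.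
    by rewrite e dotDl dotZl.
  - have idE : f idfun = P (fun=> fun=> 1).
      rewrite /f /averaged_entry; congr P; apply/funext => x; apply/funext => b.
      by rewrite /lift /pairing /= right_translation_dot dot_basis coord_basis eqxx.
    have e : mul_operator (f idfun) one = one.
      rewrite -[RHS]scale1r -mul_operator_cst.
      apply: (mul_operator_ext one (Lf _ (@bounded_id _ _)) (Linf_cst nu 1)).
      by rewrite idE; exact: (Pcst _ (Linf_cst nu 1)).
    by rewrite e dot_one.
  - move=> T [Tb _] Tpos; apply: mul_operator_pos; first exact: Lf.
    apply: Ppos; first exact: (lift_Linf_prod nu (pairing_bounded _ _ Tb)).
    by move=> g; apply: nearW => b; exact: Tpos.
(* invariance: [f T] is constant, and equivariance relates [f T] to the entry of the
   conjugate of [T] by [g] through the action of [g^-1] *)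
move=> g T [Tb TA].
have [W TW] := averaged_exists PL Plin Ppos Pid Pmod Tb.
have NW : relative_commutant act A W.
  split; last first.
    exact: (covariant_in_crossed_product ns (averaged_covariant PL ns Pequiv Tb TW)).
  split; first exact: TW.1.
  move=> Y [X AX XY].
  have [X' AX' XX'] := subalgebra_adjoint A_star AX.
  apply: (averaged_commutes PL Plin Ppos Pid Pmod Tb TW XX' _ _ _ XY).
  - exact: (subalgebra_right_equivariant A_vN AX).
  - exact: (subalgebra_right_equivariant A_vN AX').
  - by move=> x; have /(congr1 (@^~ x)) := TA X AX.
have [z zE] : scalar_operators (L2 nu) (cond_exp W) by rewrite -scal; exists W.
have fz : {ae nu, forall b, f T b = z}.
  apply: mul_operator_scalar; first exact: Lf.
  by move=> u; rewrite -zE /cond_exp delta1_single -[RHS]/(coord _ _) TW.2.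
have gTb : bounded_operators (conj_action g T) by exact: conj_action_bounded.
have fgz : {ae nu, forall b, f (conj_action g T) b = z}.
  have h := Pequiv g _ (lift_Linf_prod nu (pairing_bounded (basis R 1%g) (basis R 1%g) Tb)).
  apply: filterS2 (ae_act ns g^-1%g fz) h => b <- /(_ I) e; apply: etrans _ e.
  rewrite /f /averaged_entry; congr (P _ b); apply/funext => x; apply/funext => b'.
  rewrite /lift /pairing conj_action_dot /basis.
  by rewrite !right_translation_single !translation_single !mul1g.
suff e : mul_operator (f (conj_action g T)) one = mul_operator (f T) one by rewrite e.
apply: (mul_operator_ext one (Lf _ gTb) (Lf _ Tb)).
by apply: filterS2 fz fgz => b -> ->.
Qed.

Lemma reduced_Cstar_sub_group_vN (R : realType) (Gamma : groupType) :
  reduced_Cstar R Gamma `<=` group_vN R Gamma.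
Proof.
move=> X CX D [[Dstar Dw] gen]; apply: CX; split=> //; split=> //.
exact: wot_closed_norm_closed.
Qed.

Theorem theorem1p1 (R : realType) (Gamma : groupType)
    (Gamma_countable : countable [set: Gamma])
    (exists_SH_amenable_space :
      exists (d : measure_display) (B : measurableType d) (nu : probability B R)
        (act : Gamma -> B -> B),
        [/\ nonsingular_space nu act, SH_property nu act
          & zimmer_amenable nu act]) :
  (forall A : set (ell2 R Gamma -> ell2 R Gamma),
    Cstar_subalgebra A -> A `<=` reduced_Cstar R Gamma -> conj_invariant A ->
    A <> scalar_operators (ell2 R Gamma) -> co_amenable A) /\
  (forall M : set (ell2 R Gamma -> ell2 R Gamma),
    vN_subalgebra M -> M `<=` group_vN R Gamma -> conj_invariant M ->
    M <> scalar_operators (ell2 R Gamma) -> co_amenable M).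
Proof.
have [d [B [nu [act [ns SH za]]]]] := exists_SH_amenable_space.
split=> [A [A_star _] A_sub A_inv A_nontriv|M [M_star _] M_sub M_inv M_nontriv].
  apply: (co_amenable_of_SH ns SH za) => //.
  exact: subset_trans A_sub (@reduced_Cstar_sub_group_vN R Gamma).
exact: (co_amenable_of_SH ns SH za).
Qed.
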